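(* Let $N\ge2$, let $C_1,\dots,C_n$ be distinct cycles, $C_i$ having length $p_i$ and points $e^{-i\theta_{i,1}},\dots,e^{-i\theta_{i,p_i}}$ listed in cyclic order, and let $\alpha_i=(\alpha_{i,1},\dots,\alpha_{i,p_i})\in\mathbb{T}^{p_i}$ for $i\in\{1,\dots,n\}$. Let $\mathfrak{R}_{C,\alpha}=\mathfrak{R}_{C_1,\alpha_1}\oplus\dots\oplus\mathfrak{R}_{C_n,\alpha_n}$ be the associated wavelet representation, and let $\varphi_C=\varphi_{C_1}\oplus\dots\oplus\varphi_{C_n}$ with $\varphi_{C_i}=(\varphi_{C_i,1},\dots,\varphi_{C_i,p_i})\in L^2(\mathbb{R})^{p_i}$. Then $\varphi_C$ is an orthogonal scaling vector for $\mathfrak{R}_{C,\alpha}$ if and only if the following conditions are satisfied: (i) $\displaystyle\sum_{i=1}^n\sum_{k=1}^{p_i}\operatorname{Per}(|\widehat{\varphi}_{C_i,k}|^2)(\xi-\theta_{i,k})=1$ for a.e. $\xi\in\mathbb{R}$; (ii) there exists a function $m_0\in L^\infty(\mathbb{T})$ such that for a.e. $\xi\in\mathbb{R}$, all $i\in\{1,\dots,n\}$ and all $j\in\{1,\dots,p_i\}$, $$\alpha_{i,j}\sqrt{N}\,\widehat{\varphi}_{C_i,j+1}(N\xi)=m_0(\theta_{i,j}+\xi)\,\widehat{\varphi}_{C_i,j}(\xi),$$ where $\widehat\varphi_{C_i,p_i+1}:=\widehat\varphi_{C_i,1}$; (iii) for each $i\in\{1,\dots,n\}$ and $j\in\{1,\dots,p_i\}$,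 $\widehat{\varphi}_{C_i,j}$ does not vanish (a.e.) on any measurable subset $E$ of $\mathbb{R}$ of positive measure that is invariant under dilation by $N^{p_i}$, i.e. $N^{p_i}E=E$.
   Context: Conventions: $\widehat f(\xi)=\int_{\mathbb{R}} f(x)e^{-i\xi x}\,dx$; $\mathbb{T}$ is the unit circle; functions on $\mathbb{T}$ are identified with $2\pi$-periodic functions on $\mathbb{R}$ by $f(\theta)=f(z)$, $z=e^{-i\theta}$. For a function $g\geq 0$ on $\mathbb{R}$, $\operatorname{Per}(g)(\xi)=\sum_{k\in\mathbb{Z}}g(\xi+2k\pi)$. A cycle of length $p$ is a set $\{z_1,\dots,z_p\}$ of distinct points of $\mathbb{T}$ with $z_1^N=z_2,\ z_2^N=z_3,\dots,z_p^N=z_1$ (this enumeration is the cyclic order). A wavelet representation of scale $N$ is a triple $(H,U,\pi)$ with $H$ a Hilbert space, $U$ a unitary on $H$ and $\pi$ a representation of $L^\infty(\mathbb{T})$ on $H$ with $U\pi(f)U^{-1}=\pi(f(z^N))$ for all $f$; put $T:=\pi(z)$. The classical one is on $L^2(\mathbb{R})$: $U\xi(x)=\frac1{\sqrt N}\xi(x/N)$, and $\pi(f)$ is the operator which on the Fourier transform side is multiplication by the $2\pi$-periodic function $x\mapsto f(e^{-ix})$ (so $T\xi(x)=\xi(x-1)$). For a cycle $C=\{z_1,\dots,z_p\}$ and $\alpha=(\alpha_1,\dots,\alpha_p)\in\mathbb{T}^p$, the wavelet representation $\mathfrak{R}_{C,\alpha}=(L^2(\mathbb{R})_{C,\alpha},U_{C,\alpha},\pi_{C,\alpha})$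 is defined by $L^2(\mathbb{R})_{C,\alpha}=L^2(\mathbb{R})\oplus\dots\oplus L^2(\mathbb{R})$ ($p$ times), $$U_{C,\alpha}(\xi_1,\dots,\xi_p)=(\alpha_1U\xi_2,\alpha_2U\xi_3,\dots,\alpha_{p-1}U\xi_p,\alpha_pU\xi_1),$$ $$\pi_{C,\alpha}(f)(\xi_1,\dots,\xi_p)=(\pi(f(z_1z))\xi_1,\dots,\pi(f(z_pz))\xi_p),$$ with $U,\pi$ the classical ones, $f(z_kz)$ denoting $z\mapsto f(z_kz)$. Direct sums of wavelet representations are taken componentwise. A multiresolution analysis (MRA) for $(H,U,\pi)$ is a sequence $(V_n)_{n\in\mathbb{Z}}$ of closed subspaces of $H$ with $V_n\subset V_{n+1}$; $\overline{\bigcup_n V_n}=H$; $\bigcap_n V_n=\{0\}$; $U(V_n)=V_{n-1}$; and some $\varphi\in V_0$ such that $\{T^k\varphi:k\in\mathbb{Z}\}$ is an orthonormal basis of $V_0$. A vector $\varphi\in H$ is an orthogonal scaling vector (orthogonal scaling function) if there is an MRA for which $\varphi\in V_0$ has this last property. *)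

(* Defs.v *)
From HB Require Import structures.
From mathcomp Require Import all_boot all_order all_algebra.
From mathcomp Require Import generic_quotient ring_quotient complex.
From mathcomp Require Import all_classical all_reals all_analysis.

Set Implicit Arguments.
Unset Strict Implicit.
Unset Printing Implicit Defensive.

Import Order.TTheory GRing.Theory Num.Theory.
Import numFieldNormedType.Exports.
Import ComplexField.Normc.

Local Open Scope classical_set_scope.
Local Open Scope ring_scope.
Local Open Scope complex_scope.
Local Open Scope quotient_scope.

Section ComplexLp.
Variable R : realType.
Local Notation mu := (@lebesgue_measure R).

Definition cLfun (p : \bar R) : {pred R -> R[i]} :=
  [pred f | ((@complex.Re R \o f) \in Lfun mu p)
         && ((@complex.Im R \o f) \in Lfun mu p)].

Lemma cLfun2_submod_closed : submod_closed (cLfun 2%:E).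
Proof.
have p1 : (1 <= 2%:E :> \bar R)%E by rewrite lee1n.
split.
  rewrite inE; apply/andP; split.
    have -> : @complex.Re R \o (0 : R -> R[i]) = 0 by apply/funext.
    exact: (Lfun_submod_closed mu p1).1.
  have -> : @complex.Im R \o (0 : R -> R[i]) = 0 by apply/funext.
  exact: (Lfun_submod_closed mu p1).1.
move=> a f g; rewrite !inE => /andP[fr fi] /andP[gr gi].
have H (b : R) (u v : R -> R) : u \in Lfun mu 2%:E -> v \in Lfun mu 2%:E ->
    b *: u + v \in Lfun mu 2%:E.
  exact: (Lfun_submod_closed mu p1).2.
apply/andP; split.
- have -> : @complex.Re R \o (a *: f + g) =
    complex.Re a *: (@complex.Re R \o f) +
      ((- complex.Im a) *: (@complex.Im R \o f) + (@complex.Re R \o g)).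
    apply/funext => x /=; rewrite !fctE /=.
    by case: (f x) (g x) a => [? ?] [? ?] [? ?] /=; rewrite /GRing.scale /= mulNr addrA.
  by apply: (H) => //; apply: H.
- have -> : @complex.Im R \o (a *: f + g) =
    complex.Re a *: (@complex.Im R \o f) +
      (complex.Im a *: (@complex.Re R \o f) + (@complex.Im R \o g)).
    apply/funext => x /=; rewrite !fctE /=.
    by case: (f x) (g x) a => [? ?] [? ?] [? ?] /=; rewrite /GRing.scale /= addrA.
  by apply: (H) => //; apply: H.
Qed.

HB.instance Definition _ :=
  GRing.isSubmodClosed.Build _ _ (cLfun 2%:E) cLfun2_submod_closed.

Record L2fun := MkL2fun { L2val :> R -> R[i]; _ : L2val \in cLfun 2%:E }.

HB.instance Definition _ := [isSub for L2val].
HB.instance Definition _ := gen_eqMixin L2fun.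
HB.instance Definition _ := gen_choiceMixin L2fun.
HB.instance Definition _ := [SubChoice_isSubLmodule of L2fun by <:].

(* Equality in L2 is equality almost everywhere: L2 is the quotient of L2fun by
   the submodule of null functions. *)
Definition ae_null : {pred L2fun} :=
  [pred f | `[< \forall x \ae mu, L2val f x = 0 >]].

Lemma ae_null_zmod_closed : zmod_closed ae_null.
Proof.
split; first by apply/asboolP; exact: (aeW mu).
move=> f g; rewrite !unfold_in => /asboolP f0 /asboolP g0; apply/asboolP.
apply: (@filterS2 _ _ (ae_filter_ringOfSetsType mu) _ _ _ _ f0 g0) => x /= fx gx.
by rewrite !fctE fx gx subr0.
Qed.

HB.instance Definition _ :=
  GRing.isZmodClosed.Build _ ae_null ae_null_zmod_closed.

Definition L2 : Type := Quotient.quot ae_null.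
HB.instance Definition _ := GRing.Zmodule.on L2.
HB.instance Definition _ := EqQuotient.on L2.

Definition L2_scale (a : R[i]) (f : L2) : L2 := \pi_L2 (a *: repr f).

Lemma pi_scale (a : R[i]) (f : L2fun) : L2_scale a (\pi_L2 f) = \pi_L2 (a *: f).
Proof.
apply/eqP; rewrite piE Quotient.equivE -scalerBr.
have : repr (\pi_L2 f) - f \in ae_null by rewrite Quotient.idealrBE reprK.
rewrite !unfold_in => /asboolP h; apply/asboolP.
apply: (@filterS _ _ (ae_filter_ringOfSetsType mu) _ _ _ h) => x /=.
by rewrite !fctE => ->; rewrite scaler0.
Qed.

Fact L2_scalerA a b f : L2_scale a (L2_scale b f) = L2_scale (a * b) f.
Proof.
by elim/quotW: f => f; rewrite (pi_scale b) (pi_scale a) (pi_scale (a * b)) scalerA.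
Qed.

Fact L2_scale1r : left_id 1 L2_scale.
Proof. by elim/quotW=> f; rewrite pi_scale scale1r. Qed.

Fact pi_L2D (f g : L2fun) : \pi_L2 (f + g) = \pi_L2 f + \pi_L2 g.
Proof. exact: Quotient.pi_add. Qed.

Fact L2_scalerDr : right_distributive L2_scale +%R.
Proof.
move=> a; elim/quotW=> f; elim/quotW=> g.
rewrite -pi_L2D (pi_scale a f) (pi_scale a g) (pi_scale a (f + g)).
by rewrite -pi_L2D scalerDr.
Qed.

Fact L2_scalerDl f : {morph L2_scale^~ f : a b / a + b}.
Proof.
move=> a b; elim/quotW: f => f.
by rewrite (pi_scale a) (pi_scale b) (pi_scale (a + b)) -pi_L2D scalerDl.
Qed.

HB.instance Definition _ := GRing.Zmodule_isLmodule.Build R[i] L2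
  L2_scalerA L2_scale1r L2_scalerDr L2_scalerDl.

Definition L2_to_fun (f : L2) : R -> R[i] := L2val (repr f).

(* The class of [f]; 0 when [f] is not square-integrable. *)
Definition mkL2 (f : R -> R[i]) : L2 := \pi_L2 (insubd (0 : L2fun) f).
End ComplexLp.

Coercion L2_to_fun : L2 >-> Funclass.

Section Analysis.
Variable R : realType.
Local Notation mu := (@lebesgue_measure R).

(* e^{it} *)
Definition expi (t : R) : R[i] := cos t +i* sin t.

Definition cintegral (D : set R) (f : R -> R[i]) : R[i] :=
  (\int[mu]_(x in D) complex.Re (f x)) +i* (\int[mu]_(x in D) complex.Im (f x)).

(* \int |f|^2 *)
Definition sqnorm (f : R -> R[i]) : \bar R :=
  (\int[mu]_x (normc (f x) ^+ 2)%:E)%E.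

Definition L2dot (f g : L2 R) : R[i] := cintegral setT (fun x => f x * (g x)^*).

(* The integral defining the Fourier transform need not converge on L2; as usual
   it is read there as the limit in L2 of the integrals over [-n, n]. *)
Definition truncated_fourier (f : R -> R[i]) (n : nat) (xi : R) : R[i] :=
  cintegral `[- n%:R, n%:R] (fun x => f x * expi (- (xi * x))).

Definition is_fourier (f g : L2 R) : Prop :=
  (fun n : nat => sqnorm (fun xi => g xi - truncated_fourier f n xi)) @ \oo --> 0%E.

Definition fourier (f : L2 R) : L2 R := xget 0 [set g | is_fourier f g].

Definition Per (g : R -> R) (xi : R) : \bar R :=
  \esum_(k in [set: int]) (g (xi + 2 * k%:~R * pi))%:E.

(* A function on the unit circle is a function on R[i] of which only the values
   on the circle matter; [pullback f] is the corresponding 2pi-periodic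
   function, with the convention z = e^{-i theta}. *)
Definition pullback (f : R[i] -> R[i]) (theta : R) : R[i] := f (expi (- theta)).

Definition Linfty_circle (f : R[i] -> R[i]) : Prop := pullback f \in cLfun +oo%E.

Definition is_cycle (N p : nat) (z : 'I_p -> R[i]) : Prop :=
  [/\ (0 < p)%N, injective z, forall k, `|z k| = 1 &
      forall k, z k ^+ N = z (ordS k)].
End Analysis.

Section DependentProduct.
Variables (K : pzRingType) (n : nat) (V : 'I_n -> lmodType K).

Definition dprod_space : Type := forall i, V i.
HB.instance Definition _ := gen_eqMixin dprod_space.
HB.instance Definition _ := gen_choiceMixin dprod_space.

Let add (x y : dprod_space) : dprod_space := fun i => x i + y i.
Let opp (x : dprod_space) : dprod_space := fun i => - x i.
Let scale (a : K) (x : dprod_space) : dprod_space := fun i => a *: x i.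

Fact dprod_addA : associative add.
Proof. by move=> x y z; apply: functional_extensionality_dep => i; exact: addrA. Qed.
Fact dprod_addC : commutative add.
Proof. by move=> x y; apply: functional_extensionality_dep => i; exact: addrC. Qed.
Fact dprod_add0 : left_id (fun i => 0 : V i) add.
Proof. by move=> x; apply: functional_extensionality_dep => i; exact: add0r. Qed.
Fact dprod_addN : left_inverse (fun i => 0 : V i) opp add.
Proof. by move=> x; apply: functional_extensionality_dep => i; exact: addNr. Qed.
HB.instance Definition _ := GRing.isZmodule.Build dprod_space
  dprod_addA dprod_addC dprod_add0 dprod_addN.

Fact dprod_scaleA a b x : scale a (scale b x) = scale (a * b) x.
Proof. by apply: functional_extensionality_dep => i; exact: scalerA. Qed.
Fact dprod_scale1 : left_id 1 scale.
Proof. by move=> x; apply: functional_extensionality_dep => i; exact: scale1r. Qed.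
Fact dprod_scaleDr : right_distributive scale +%R.
Proof. by move=> a x y; apply: functional_extensionality_dep => i; exact: scalerDr. Qed.
Fact dprod_scaleDl x : {morph scale^~ x : a b / a + b}.
Proof. by move=> a b; apply: functional_extensionality_dep => i; exact: scalerDl. Qed.
HB.instance Definition _ := GRing.Zmodule_isLmodule.Build K dprod_space
  dprod_scaleA dprod_scale1 dprod_scaleDr dprod_scaleDl.
End DependentProduct.

(* The data (H, U, pi) of a wavelet representation, with the inner product of H;
   [wrep f] is pi(f), meaningful for [Linfty_circle f]. The unitarity and
   covariance laws are not fields: only concrete representations are used. *)
Record wavelet_rep (R : realType) := WaveletRep {
  wspace : lmodType R[i];
  wdot : wspace -> wspace -> R[i];
  wU : wspace -> wspace;
  wrep : (R[i] -> R[i]) -> wspace -> wspace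
}.

Section Representations.
Variables (R : realType) (N : nat).
Local Notation C := R[i].

Definition dilation (f : L2 R) : L2 R :=
  mkL2 (fun x => ((Num.sqrt N%:R)^-1)%:C * f (x / N%:R)).

(* Multiplication by [pullback h] on the Fourier transform side. *)
Definition fourier_multiplier (h : C -> C) (f : L2 R) : L2 R :=
  xget 0 [set g | fourier g = mkL2 (fun xi => pullback h xi * fourier f xi)].

Definition classical_rep : wavelet_rep R :=
  WaveletRep (@L2dot R) dilation fourier_multiplier.

Definition cycle_rep (p : nat) (z alpha : 'I_p -> C) : wavelet_rep R :=
  @WaveletRep R ('I_p -> wspace classical_rep)
    (fun x y => \sum_k wdot (x k) (y k))
    (fun x k => alpha k *: wU (x (ordS k)))
    (fun f x k => wrep (fun w => f (z k * w)) (x k)).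

Definition dsum_rep (n : nat) (W : 'I_n -> wavelet_rep R) : wavelet_rep R :=
  @WaveletRep R (dprod_space (fun i => wspace (W i)))
    (fun x y => \sum_i wdot (x i) (y i))
    (fun x i => wU (x i))
    (fun f x i => wrep f (x i)).
End Representations.

Section MRA.
Variables (R : realType) (W : wavelet_rep R).
Local Notation C := R[i].
Local Notation H := (wspace W).
Implicit Types (A V : set H) (x y : H).

Definition hnorm x : R := Num.sqrt (complex.Re (wdot x x)).

Definition hclosure A : set H :=
  [set x | forall e : R, 0 < e -> exists2 y, A y & hnorm (x - y) < e].

Definition closed_subspace V : Prop :=
  [/\ V 0, forall (a : C) x y, V x -> V y -> V (a *: x + y) & hclosure V `<=` V].

Definition lin_span (e : int -> H) : set H :=
  [set x | exists s : seq (C * int), x = \sum_(ck <- s) ck.1 *: e ck.2].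

Definition orthonormal_basis (e : int -> H) V : Prop :=
  (forall k l, wdot (e k) (e l) = (k == l)%:R) /\ hclosure (lin_span e) = V.

(* T = pi(z) *)
Definition wT : H -> H := wrep idfun.

Definition iterz (f : H -> H) (k : int) : H -> H :=
  match k with
  | Posz n => iter n f
  | Negz n => iter n.+1 ('pinv_(fun=> 0) setT f)
  end.

Definition scaling_vector_of (V : int -> set H) (phi : H) : Prop :=
  V 0 phi /\ orthonormal_basis (fun k => iterz wT k phi) (V 0).

Record MRA (V : int -> set H) : Prop := {
  MRA_subspace : forall n, closed_subspace (V n);
  MRA_nested : forall n, V n `<=` V (n + 1);
  MRA_dense : hclosure (\bigcup_n V n) = setT;
  MRA_separated : \bigcap_n V n = [set 0];
  MRA_scale : forall n, @wU R W @` V n = V (n - 1);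
  MRA_scaling_vector : exists phi, scaling_vector_of V phi
}.

Definition orthogonal_scaling_vector (phi : H) : Prop :=
  exists2 V, MRA V & scaling_vector_of V phi.
End MRA.

(* Main.v *)
(* The Fourier transform carries the representation to the space of families
   y = (y_s) in L^2(R), s ranging over the points of all the cycles, where
   (U y)_s (xi) = alpha_s sqrt N y_{sg s} (N xi), sg being the successor in the
   cycle, and (T^k y)_s (xi) = e^{-i k (theta_s + xi)} y_s (xi).  There the scalar
   products <y, T^k phi> are the Fourier coefficients of the 2pi-periodization of
   eta |-> sum_s (y_s conj phi_s) (eta - theta_s).  Taking y = phi, orthonormality
   of the translates is (i); and then their closed span V_0 is the set of all
   families m(theta_s + xi) phi_s (xi) with m periodic and square integrable on a
   period, so that U phi in V_0 is (ii).  The spaces of the MRA are V_k = U^{-k} V_0.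

   They always have trivial intersection: for z bounded, supported away from 0 and
   infinity, |<z, U^n v>|^2 is at most C |v|^2 times the mass of phi outside a ball
   of radius d N^n.

   Density is where (iii) enters.  If z has bounded support, U^n z lives near 0 for
   large n, where the distinct angles theta_s keep the components apart, and
     dist (z, V_n)^2 = (2pi)^-1 sum_s int |z_s|^2 (1 - |phi_{sg^-n s} (N^-n xi)|^2).
   By (ii) and |m0| <= sqrt N the functions |phi_{sg^-n s} (N^-n xi)|^2 increase with
   n.  As phi belongs to all V_n, the formula applied to truncations of phi shows
   that phi_s vanishes where the limit is smaller than 1; this set is invariant under
   dilation by N^p, so by (iii) the limit is 1 and the union is dense.  Conversely, if
   phi_s vanishes on an invariant set E, a function supported by E in the component s
   is orthogonal to V_{p m} for all m >= 0. *)
Require Import Defs.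
From mathcomp Require Import all_boot all_order all_algebra.
From mathcomp Require Import complex.
From mathcomp Require Import all_classical all_reals all_analysis.
From mathcomp Require Import measurable_realfun ess_sup_inf.
From mathcomp Require Import ring lra zify.

Set Implicit Arguments.
Unset Strict Implicit.
Unset Printing Implicit Defensive.

Import Order.TTheory GRing.Theory Num.Theory.
Import numFieldNormedType.Exports.
Import ComplexField.Normc.

Local Open Scope classical_set_scope.
Local Open Scope ring_scope.
Local Open Scope complex_scope.

(** * Integration of complex functions *)

(** The bound |m0| <= sqrt N, which puts the filter in L^infty and makes the density argument
    monotone, comes from comparing (i) at eta and at N eta: by (ii), |m0 (eta)|^2 times the
    periodized sum at eta is N times a sum over part of the terms of the one at N eta.

    Truncations enter because the distance formula requires supports so short that, once translated
    by the angles, they neither overlap nor leave one period; phi itself and general vectors are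
    reached by approximation.

    The analysis rests on one uniqueness theorem: an integrable function on a period with vanishing
    Fourier coefficients is zero. Square integrability would not do, since the periodized sum in (i)
    is a priori only of class L^1. The theorem comes from polynomials in a cosine that converge to
    indicators of arcs. Parseval's identity follows; averaged over modulations it gives Plancherel's
    formula for short supports, and dilations remove the restriction on their length. The transform
    defined by truncation therefore exists. It must also be shown surjective, because pi(f) is
    defined by inverting it. *)

Section Affine.
Variable R : realType.
Local Notation mu := (@lebesgue_measure R).
Local Open Scope ereal_scope.
Implicit Types (f : R -> \bar R) (a b : R).

Let affine a b : measurableTypeR R -> measurableTypeR R := fun x => (a * x + b)%R.

Let measurable_affine a b : measurable_fun setT (affine a b).
Proof. by apply: measurable_funD => //; apply: measurable_funM. Qed.

Let affine_measure a b : {measure set (measurableTypeR R) -> \bar R} :=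
  measure_function_pushforward__canonical__measure_function_Measure
    mu (measurable_affine a b).

(** Both sides are measures in A, so by uniqueness of the Lebesgue measure they need only be
    compared on half-open intervals. *)
Lemma lebesgue_measure_affine a b (A : set R) : (0 < a)%R ->
  measurable A -> mu A = a%:E * mu [set x | A (a * x + b)%R].
Proof.
move=> a0 mA; pose k := NngNum (ltW a0); pose m := mscale k (affine_measure a b).
suff H X : ocitv X -> mu X = m X by exact: (lebesgue_measure_unique H).
move=> [[c d]] _ <-; rewrite /m /mscale/= /pushforward.
have -> : affine a b @^-1` `]c, d]%classic =
    `]((c - b) / a)%R, ((d - b) / a)%R]%classic.
  apply/seteqP; split => x /=; rewrite !in_itv/= /affine;
    by rewrite ltr_pdivrMr// ler_pdivlMr// ltrBlDr lerBrDr (mulrC x).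
rewrite !lebesgue_measure_itv/= !lte_fin ltr_pM2r ?invr_gt0// ltrD2r.
case: ifPn => _; last by rewrite mule0.
by rewrite -!EFinB -EFinM; congr EFin; field; rewrite gt_eqF.
Qed.

Lemma ge0_integral_affine f a b : (0 < a)%R -> measurable_fun setT f ->
  (forall x, 0 <= f x) -> \int[mu]_x f (a * x + b)%R = a^-1%:E * \int[mu]_x f x.
Proof.
move=> a0 mf f0; pose k := NngNum (ltW a0).
have -> : \int[mu]_x f x = a%:E * \int[mu]_x f (a * x + b)%R.
  rewrite (eq_measure_integral (mscale k (affine_measure a b)))//; last first.
    by move=> A mA _; exact: (lebesgue_measure_affine b a0).
  rewrite ge0_integral_mscale// -[RHS]/(k%:num%:E * _); congr (_ * _).
  by rewrite -[in RHS](preimage_setT (affine a b)) -ge0_integral_pushforward.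
by rewrite muleA -EFinM mulVf ?mul1e// gt_eqF.
Qed.

Lemma integral_affine f a b : (0 < a)%R -> mu.-integrable setT f ->
  mu.-integrable setT (fun x => f (a * x + b)%R) /\
  \int[mu]_x f (a * x + b)%R = a^-1%:E * \int[mu]_x f x.
Proof.
move=> a0 /[dup] fi /integrableP[mf foo].
have mfa : measurable_fun setT (fun x => f (a * x + b)%R).
  exact: (measurableT_comp mf (measurable_affine a b)).
split.
  apply/integrableP; split => //.
  rewrite (@ge0_integral_affine (fun x => `|f x|))//.
    by rewrite lte_mul_pinfty ?lee_fin ?invr_ge0 ?ltW.
  exact: measurableT_comp.
rewrite integralE [X in _ = _ * X]integralE.
have mp : measurable_fun setT f^\+ by exact: measurable_funepos.
have mn : measurable_fun setT f^\- by exact: measurable_funeneg.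
rewrite muleBr//.
  rewrite -(ge0_integral_affine b a0 mp)// -(ge0_integral_affine b a0 mn)//.
  by f_equal; [|f_equal]; apply: eq_integral => x _; rewrite ?funeposE ?funenegE.
by rewrite fin_num_adde_defl// fin_numN integrable_neg_fin_num.
Qed.

(** Elements of L^2 are known only almost everywhere, yet they are translated by angles and dilated
    by powers of N all along; preimages of null sets under these maps are null. *)
Lemma ae_affine (P : R -> Prop) a b : (0 < a)%R ->
  (\forall x \ae mu, P x) -> \forall x \ae mu, P (a * x + b)%R.
Proof.
move=> a0 [A [mA A0 PA]].
exists (affine a b @^-1` A); split.
- by rewrite -[X in measurable X]setTI; exact: measurable_affine.
- have := lebesgue_measure_affine b a0 mA; rewrite [X in X = _]A0 => /esym/eqP.
  by rewrite mule_eq0 eqe (gt_eqF a0) => /eqP.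
- by move=> x Px; apply: PA.
Qed.
End Affine.

Section AlmostEverywhere.
Variable R : realType.
Local Notation mu := (@lebesgue_measure R).

Lemma ae_imp (P Q : R -> Prop) : (forall x, P x -> Q x) ->
  (\forall x \ae mu, P x) -> \forall x \ae mu, Q x.
Proof. exact: (@filterS _ _ (ae_filter_ringOfSetsType mu)). Qed.

Lemma ae_imp2 (P1 P2 Q : R -> Prop) : (forall x, P1 x -> P2 x -> Q x) ->
  (\forall x \ae mu, P1 x) -> (\forall x \ae mu, P2 x) -> \forall x \ae mu, Q x.
Proof. exact: (@filterS2 _ _ (ae_filter_ringOfSetsType mu)). Qed.

Lemma ae_imp3 (P1 P2 P3 Q : R -> Prop) : (forall x, P1 x -> P2 x -> P3 x -> Q x) ->
  (\forall x \ae mu, P1 x) -> (\forall x \ae mu, P2 x) -> (\forall x \ae mu, P3 x) ->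
  \forall x \ae mu, Q x.
Proof. exact: (@filterS3 _ _ (ae_filter_ringOfSetsType mu)). Qed.

Lemma ae_forall (I : countType) (P : I -> R -> Prop) :
  (forall i, \forall x \ae mu, P i x) -> \forall x \ae mu, forall i, P i x.
Proof.
move=> aeP; have H n : \forall x \ae mu, forall i : I, unpickle n = Some i -> P i x.
  case en : (unpickle n) => [i|]; last by apply: aeW.
  by apply: ae_imp (aeP i) => x Px _ [<-].
have : \forall x \ae mu, forall n (i : I), unpickle n = Some i -> P i x.
  by apply/ae_foralln.
by apply: ae_imp => x Hx i; apply: (Hx (pickle i)); rewrite pickleK.
Qed.
End AlmostEverywhere.

(** * Complex numbers and the characters e^{it} *)

Section ComplexNumbers.
Variable R : realType.
Implicit Types (x y z : R[i]) (a b : R).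
Local Notation Re := (@complex.Re R).
Local Notation Im := (@complex.Im R).

Lemma complexP x y : Re x = Re y -> Im x = Im y -> x = y.
Proof. by case: x y => [? ?] [? ?] /= -> ->. Qed.

Lemma ReD x y : Re (x + y) = Re x + Re y. Proof. by case: x y => [? ?] [? ?]. Qed.
Lemma ImD x y : Im (x + y) = Im x + Im y. Proof. by case: x y => [? ?] [? ?]. Qed.
Lemma ReN x : Re (- x) = - Re x. Proof. by case: x => [? ?]. Qed.
Lemma ImN x : Im (- x) = - Im x. Proof. by case: x => [? ?]. Qed.
Lemma ReM x y : Re (x * y) = Re x * Re y - Im x * Im y.
Proof. by case: x y => [? ?] [? ?]. Qed.
Lemma ImM x y : Im (x * y) = Re x * Im y + Im x * Re y.
Proof. by case: x y => [? ?] [? ?]. Qed.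
Lemma ReJ x : Re x^* = Re x. Proof. by case: x. Qed.
Lemma ImJ x : Im x^* = - Im x. Proof. by case: x. Qed.
Lemma ReC a : Re a%:C = a. Proof. by []. Qed.
Lemma ImC a : Im a%:C = 0. Proof. by []. Qed.
Lemma Re0 : Re 0 = 0. Proof. by []. Qed.
Lemma Im0 : Im 0 = 0. Proof. by []. Qed.
Lemma Re1 : Re 1 = 1. Proof. by []. Qed.
Lemma Im1 : Im 1 = 0. Proof. by []. Qed.
Lemma conjCE x : Num.conj x = conjc x. Proof. by []. Qed.
Lemma conjcM x y : conjc (x * y) = conjc x * conjc y. Proof. exact: rmorphM. Qed.
Lemma conjcB x y : conjc (x - y) = conjc x - conjc y. Proof. exact: rmorphB. Qed.
Definition ReImE := (ReD, ImD, ReN, ImN, ReM, ImM, ReJ, ImJ, ReC, ImC, Re0, Im0, Re1, Im1).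

Lemma Re_sum I (r : seq I) (F : I -> R[i]) : Re (\sum_(i <- r) F i) = \sum_(i <- r) Re (F i).
Proof. by elim/big_rec2: _ => // i ? ? _ <-; rewrite ReD. Qed.

Lemma Im_sum I (r : seq I) (F : I -> R[i]) : Im (\sum_(i <- r) F i) = \sum_(i <- r) Im (F i).
Proof. by elim/big_rec2: _ => // i ? ? _ <-; rewrite ImD. Qed.

Lemma sqr_normcE z : normc z ^+ 2 = Re z ^+ 2 + Im z ^+ 2.
Proof. by case: z => a b /=; rewrite sqr_sqrtr// addr_ge0 ?sqr_ge0. Qed.

Lemma normc_ge0 z : 0 <= normc z.
Proof. by case: z => a b; exact: sqrtr_ge0. Qed.

Lemma ler_normr_Re z : `|Re z| <= normc z.
Proof.
rewrite -(@ler_pXn2r _ 2)// ?nnegrE ?normc_ge0//.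
by rewrite sqr_normcE real_normK ?num_real// lerDl sqr_ge0.
Qed.

Lemma ler_normr_Im z : `|Im z| <= normc z.
Proof.
rewrite -(@ler_pXn2r _ 2)// ?nnegrE ?normc_ge0//.
by rewrite sqr_normcE real_normK ?num_real// lerDr sqr_ge0.
Qed.

Lemma normc_le_ReIm z : normc z <= `|Re z| + `|Im z|.
Proof.
rewrite -(@ler_pXn2r _ 2)// ?nnegrE ?normc_ge0// ?addr_ge0//.
rewrite sqr_normcE -(real_normK (num_real (Re z))) -(real_normK (num_real (Im z))).
have : 0 <= `|Re z| * `|Im z| by rewrite mulr_ge0.
nra.
Qed.

Lemma normcJ' z : normc z^* = normc z.
Proof. by case: z => a b /=; rewrite sqrrN. Qed.

Lemma normcC a : normc a%:C = `|a|.
Proof. by rewrite /= expr0n/= addr0 sqrtr_sqr. Qed.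

Lemma normrcE z : `|z| = (normc z)%:C. Proof. by rewrite normc_def; case: z. Qed.

Lemma mulJc z : z * z^* = (normc z ^+ 2)%:C.
Proof. by apply: complexP; rewrite !ReImE ?sqr_normcE; ring. Qed.

Lemma expiD a b : expi (a + b) = expi a * expi b.
Proof. by apply: complexP; rewrite /expi !ReImE/= ?cosD ?sinD//; ring. Qed.

Lemma expi0 : expi 0 = 1 :> R[i].
Proof. by rewrite /expi cos0 sin0. Qed.

Lemma normc_expi a : normc (expi a) = 1.
Proof. by rewrite /= cos2Dsin2 sqrtr1. Qed.

Lemma expiJ a : (expi a)^* = expi (- a).
Proof. by rewrite /expi/= cosN sinN. Qed.

Lemma expi_neq0 a : expi a != 0.
Proof. by apply/eqP => e0; have := normc_expi a; rewrite e0 normc0 => /esym/eqP; rewrite oner_eq0. Qed.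

Lemma expiNV a : expi (- a) = (expi a)^-1.
Proof. by apply: (mulfI (expi_neq0 a)); rewrite -expiD subrr expi0 mulfV ?expi_neq0. Qed.

Lemma expiX a n : expi a ^+ n = expi (n%:R * a).
Proof.
by elim: n => [|n IH]; rewrite ?mul0r ?expi0// exprS IH -expiD mulrSr mulrDl mul1r addrC.
Qed.

Lemma expiXz a (k : int) : expi (k%:~R * a) = expi a ^ k.
Proof.
case: k => n; first by rewrite -exprnP expiX.
by rewrite NegzE mulrNz mulNr expiNV -expiX.
Qed.

Lemma expi_2pi : expi (2 * pi) = 1 :> R[i].
Proof. by rewrite /expi -[2 * pi]add0r mulr_natl cosD2pi sinD2pi cos0 sin0. Qed.

Lemma expi_2piz (k : int) : expi (2 * k%:~R * pi) = 1 :> R[i].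
Proof. by rewrite -mulrA mulrCA expiXz expi_2pi exp1rz. Qed.
End ComplexNumbers.

Section ComplexMeasurable.
Context d (T : measurableType d) (R : realType).
Implicit Types f g : T -> R[i].

Definition cmeasurable f :=
  measurable_fun setT (fun x => complex.Re (f x)) /\
  measurable_fun setT (fun x => complex.Im (f x)).

Lemma cmeasurableD f g : cmeasurable f -> cmeasurable g ->
  cmeasurable (fun x => f x + g x).
Proof.
move=> [fr fi] [gr gi]; split; under eq_fun do rewrite ReImE;
  exact: measurable_funD.
Qed.

Lemma cmeasurableM f g : cmeasurable f -> cmeasurable g ->
  cmeasurable (fun x => f x * g x).
Proof.
move=> [fr fi] [gr gi]; split; under eq_fun do rewrite ReImE.
  by apply: measurable_funB; exact: measurable_funM.
by apply: measurable_funD; exact: measurable_funM.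
Qed.

Lemma cmeasurable_cst (z : R[i]) : cmeasurable (fun=> z).
Proof. by split; exact: measurable_cst. Qed.

Lemma cmeasurableN f : cmeasurable f -> cmeasurable (fun x => - f x).
Proof.
move=> [fr fi]; split; under eq_fun do rewrite ReImE; exact: measurableT_comp.
Qed.

Lemma cmeasurableB f g : cmeasurable f -> cmeasurable g ->
  cmeasurable (fun x => f x - g x).
Proof. by move=> ? ?; apply: cmeasurableD => //; exact: cmeasurableN. Qed.

Lemma cmeasurableJ f : cmeasurable f -> cmeasurable (fun x => (f x)^*).
Proof.
move=> [fr fi]; split; under eq_fun do rewrite ReImE; first by [].
exact: measurableT_comp.
Qed.

Lemma cmeasurable_sum I (r : seq I) (F : I -> T -> R[i]) :
  (forall i, cmeasurable (F i)) -> cmeasurable (fun x => \sum_(i <- r) F i x).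
Proof.
move=> mF; elim: r => [|i r IH].
  by under eq_fun do rewrite big_nil; exact: cmeasurable_cst.
by under eq_fun do rewrite big_cons; exact: cmeasurableD.
Qed.

Lemma cmeasurableC (f : T -> R) : measurable_fun setT f ->
  cmeasurable (fun x => (f x)%:C).
Proof. by move=> mf; split => //=; exact: measurable_cst. Qed.

Lemma cmeasurable_expi (f : T -> R) : measurable_fun setT f ->
  cmeasurable (fun x => expi (f x)).
Proof.
move=> mf; split => /=; apply: measurableT_comp => //;
  apply: continuous_measurable_fun; [exact: continuous_cos|exact: continuous_sin].
Qed.

Lemma cmeasurable_indic (A : set T) : measurable A ->
  cmeasurable (fun x => (\1_A x)%:C : R[i]).
Proof. by move=> mA; apply: cmeasurableC; exact: measurable_indic. Qed.

Lemma measurable_sqr_normc f : cmeasurable f ->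
  measurable_fun setT (fun x => normc (f x) ^+ 2).
Proof.
move=> [fr fi]; under eq_fun do rewrite sqr_normcE.
by apply: measurable_funD; exact: measurable_funX.
Qed.

Lemma measurable_normc f : cmeasurable f ->
  measurable_fun setT (fun x => normc (f x)).
Proof.
move=> mf; have -> : (fun x => normc (f x)) = Num.sqrt \o (fun x => normc (f x) ^+ 2).
  by apply/funext => x /=; rewrite sqrtr_sqr ger0_norm// normc_ge0.
apply: measurableT_comp; last exact: measurable_sqr_normc.
by apply: continuous_measurable_fun; exact: sqrt_continuous.
Qed.
End ComplexMeasurable.

Lemma cmeasurable_comp d d' (T : measurableType d) (T' : measurableType d') (R : realType)
    (f : T -> R[i]) (g : T' -> T) :
  cmeasurable f -> measurable_fun setT g -> cmeasurable (fun x => f (g x)).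
Proof.
by move=> [fr fi] mg; split; [exact: (measurableT_comp fr)|exact: (measurableT_comp fi)].
Qed.

Section ComplexIntegral.
Variable R : realType.
Local Notation mu := (@lebesgue_measure R).
Implicit Types f g : R -> R[i].

Definition cintegrable f :=
  mu.-integrable setT (fun x => (complex.Re (f x))%:E) /\
  mu.-integrable setT (fun x => (complex.Im (f x))%:E).

Local Notation cint := (cintegral setT).

Lemma cintegrable_cmeasurable f : cintegrable f -> cmeasurable f.
Proof.
by move=> [/measurable_int/measurable_EFinP ? /measurable_int/measurable_EFinP ?].
Qed.

Lemma le_cintegrable f (g : R -> R) : cmeasurable f ->
  mu.-integrable setT (fun x => (g x)%:E) -> (forall x, normc (f x) <= g x) ->
  cintegrable f.
Proof.
move=> [mr mi] gi fg; split; apply: le_integrable gi => //; first exact/measurable_EFinP.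
- move=> x _; rewrite !abse_EFin lee_fin; apply: le_trans (ler_normr_Re _) _.
  by rewrite (le_trans (fg x))// ler_norm.
- exact/measurable_EFinP.
- move=> x _; rewrite !abse_EFin lee_fin; apply: le_trans (ler_normr_Im _) _.
  by rewrite (le_trans (fg x))// ler_norm.
Qed.

Lemma cintegrable_normc f : cintegrable f ->
  mu.-integrable setT (fun x => (normc (f x))%:E).
Proof.
move=> /[dup] /cintegrable_cmeasurable mf [fr fi].
have h := integrableD measurableT (integrable_norm fr) (integrable_norm fi).
apply: le_integrable h => //.
  by apply/measurable_EFinP; exact: measurable_normc.
move=> x _ /=; rewrite lee_fin ger0_norm ?normc_ge0// (le_trans (normc_le_ReIm _))//.
exact: ler_norm.
Qed.

Lemma cintegrableD f g : cintegrable f -> cintegrable g ->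
  cintegrable (fun x => f x + g x).
Proof.
move=> [fr fi] [gr gi]; split.
  by under eq_fun do rewrite ReImE EFinD; exact: integrableD.
by under eq_fun do rewrite ReImE EFinD; exact: integrableD.
Qed.

Lemma cintegrableZ (a : R[i]) f : cintegrable f -> cintegrable (fun x => a * f x).
Proof.
move=> [fr fi]; split; under eq_fun do rewrite ReImE ?EFinB ?EFinD 2!EFinM.
  by apply: integrableB => //; exact: integrableZl.
by apply: integrableD => //; exact: integrableZl.
Qed.

Lemma cintegrable0 : cintegrable (fun=> 0).
Proof. by split => /=; exact: integrable0. Qed.

Lemma cintegrable_sum I (r : seq I) (F : I -> R -> R[i]) :
  (forall i, cintegrable (F i)) -> cintegrable (fun x => \sum_(i <- r) F i x).
Proof.
move=> mF; elim: r => [|i r IH].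
  by under eq_fun do rewrite big_nil; exact: cintegrable0.
by under eq_fun do rewrite big_cons; exact: cintegrableD.
Qed.

Lemma cintegrable_bounded f g (M : R) : cintegrable f -> cmeasurable g ->
  (forall x, normc (g x) <= M) -> cintegrable (fun x => f x * g x).
Proof.
move=> /[dup] /cintegrable_cmeasurable mf fi mg gM.
apply: (@le_cintegrable _ (fun x => M * normc (f x))).
- exact: cmeasurableM.
- by under eq_fun do rewrite EFinM; apply: integrableZl => //; exact: cintegrable_normc.
- by move=> x; rewrite normcM mulrC ler_wpM2r ?normc_ge0.
Qed.

Lemma cintD f g : cintegrable f -> cintegrable g ->
  cint (fun x => f x + g x) = cint f + cint g.
Proof.
move=> [fr fi] [gr gi]; apply: complexP; rewrite ReImE /=.
  by under eq_Rintegral do rewrite ReImE; rewrite RintegralD.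
by under eq_Rintegral do rewrite ReImE; rewrite RintegralD.
Qed.

Lemma cintZ (a : R[i]) f : cintegrable f -> cint (fun x => a * f x) = a * cint f.
Proof.
have rZ (c : R) h : mu.-integrable setT (fun x => (h x)%:E) ->
    mu.-integrable setT (fun x => (c * h x)%:E).
  by move=> hi; under eq_fun do rewrite EFinM; exact: integrableZl.
move=> [fr fi]; apply: complexP; rewrite ReImE /=; under eq_Rintegral do rewrite ReImE.
  by rewrite RintegralB ?RintegralZl//; exact: rZ.
by rewrite RintegralD ?RintegralZl//; exact: rZ.
Qed.

Lemma cintJ f : cintegrable f -> cint (fun x => (f x)^*) = (cint f)^*.
Proof.
move=> [fr fi]; apply: complexP; rewrite ReImE /=; under eq_Rintegral do rewrite ReImE; first by [].
by rewrite -mulN1r -RintegralZl//; apply: eq_Rintegral => x _; rewrite mulN1r.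
Qed.

Lemma cintN f : cintegrable f -> cint (fun x => - f x) = - cint f.
Proof. by move=> fi; rewrite -mulN1r -cintZ//; under [in RHS]eq_fun do rewrite mulN1r. Qed.

Lemma cintB f g : cintegrable f -> cintegrable g ->
  cint (fun x => f x - g x) = cint f - cint g.
Proof.
move=> fi gi; rewrite cintD ?cintN//.
by have := cintegrableZ (-1) gi; under eq_fun do rewrite mulN1r.
Qed.

Lemma cint_sum I (r : seq I) (F : I -> R -> R[i]) : (forall i, cintegrable (F i)) ->
  cint (fun x => \sum_(i <- r) F i x) = \sum_(i <- r) cint (F i).
Proof.
move=> mF; elim: r => [|i r IH].
  under eq_fun do rewrite big_nil.
  by rewrite big_nil /cintegral/= /Rintegral integral0.
by rewrite big_cons -IH -cintD//; [under eq_fun do rewrite big_cons|exact: cintegrable_sum].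
Qed.

Lemma ae_eq_cint f g : cmeasurable f -> cmeasurable g ->
  (\forall x \ae mu, f x = g x) -> cint f = cint g.
Proof.
move=> [fr fi] [gr gi] fg; apply: complexP => /=; rewrite /Rintegral; congr fine;
  apply: ae_eq_integral => //; try exact/measurable_EFinP;
  by apply: ae_imp fg => x ->.
Qed.

Lemma cint_affine f (a b : R) : 0 < a -> cintegrable f ->
  cintegrable (fun x => f (a * x + b)) /\
  cint (fun x => f (a * x + b)) = (a^-1)%:C * cint f.
Proof.
move=> a0 [fr fi].
have [ir er] := integral_affine b a0 fr; have [ii ei] := integral_affine b a0 fi.
split; first by [].
by apply: complexP; rewrite !ReImE /cintegral/= /Rintegral ?er ?ei fineM ?integrable_fin_num// ?mul0r ?subr0 ?addr0.
Qed.
End ComplexIntegral.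

(** * Inner product spaces *)

Section InnerProduct.
Variables (R : realType) (V : lmodType R[i]) (dot : V -> V -> R[i]).

(** Positivity is stated for the real part, as in [hnorm]; that [dot x x] is real follows from the
    hermitian symmetry, see [idotxx]. *)
Record inner_product : Prop := {
  inner_lin : forall a x y z, dot (a *: x + y) z = a * dot x z + dot y z;
  inner_herm : forall x y, dot y x = (dot x y)^*;
  inner_ge0 : forall x, 0 <= complex.Re (dot x x);
  inner_eq0 : forall x, complex.Re (dot x x) = 0 -> x = 0 }.

Definition inorm x : R := Num.sqrt (complex.Re (dot x x)).

Hypothesis dotP : inner_product.

Lemma idotDl x y z : dot (x + y) z = dot x z + dot y z.
Proof. by have := inner_lin dotP 1 x y z; rewrite scale1r mul1r. Qed.

Lemma idot0l z : dot 0 z = 0.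
Proof. by apply: (addrI (dot 0 z)); rewrite -idotDl !addr0. Qed.

Lemma idotZl a x z : dot (a *: x) z = a * dot x z.
Proof. by have := inner_lin dotP a x 0 z; rewrite addr0 idot0l addr0. Qed.

Lemma idotNl x z : dot (- x) z = - dot x z.
Proof. by rewrite -scaleN1r idotZl mulN1r. Qed.

Lemma idotBl x y z : dot (x - y) z = dot x z - dot y z.
Proof. by rewrite idotDl idotNl. Qed.

Lemma idotDr x y z : dot z (x + y) = dot z x + dot z y.
Proof. by rewrite (inner_herm dotP) idotDl rmorphD/= -!(inner_herm dotP). Qed.

Lemma idotZr a x z : dot z (a *: x) = a^* * dot z x.
Proof. by rewrite (inner_herm dotP) idotZl rmorphM/= -!(inner_herm dotP). Qed.

Lemma idot0r z : dot z 0 = 0.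
Proof. by rewrite (inner_herm dotP) idot0l conjc0. Qed.

Lemma idotNr x z : dot z (- x) = - dot z x.
Proof. by rewrite (inner_herm dotP) idotNl rmorphN/= -!(inner_herm dotP). Qed.

Lemma idot_suml I (r : seq I) (F : I -> V) z :
  dot (\sum_(i <- r) F i) z = \sum_(i <- r) dot (F i) z.
Proof.
by elim: r => [|i r IH]; rewrite ?big_nil ?idot0l// !big_cons idotDl IH.
Qed.

Lemma idotxx x : dot x x = (inorm x ^+ 2)%:C.
Proof.
rewrite /inorm sqr_sqrtr ?(inner_ge0 dotP)//; apply: complexP => //=.
have := inner_herm dotP x x; move/(congr1 (@complex.Im R)); rewrite !ReImE => h.
lra.
Qed.

Lemma sqr_inorm x : inorm x ^+ 2 = complex.Re (dot x x).
Proof. by rewrite idotxx. Qed.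

Lemma inorm_ge0 x : 0 <= inorm x. Proof. exact: sqrtr_ge0. Qed.

Lemma inorm0 : inorm 0 = 0.
Proof. by rewrite /inorm idot0l sqrtr0. Qed.

Lemma inorm0_eq0 x : inorm x = 0 -> x = 0.
Proof. by move=> x0; apply: (inner_eq0 dotP); rewrite -sqr_inorm x0 expr0n. Qed.

Lemma inormZ a x : inorm (a *: x) = normc a * inorm x.
Proof.
apply/eqP; rewrite -(@eqrXn2 _ 2)// ?mulr_ge0 ?normc_ge0 ?inorm_ge0//.
by rewrite exprMn !sqr_inorm idotZl idotZr mulrA mulJc idotxx -rmorphM.
Qed.

Lemma inormN x : inorm (- x) = inorm x.
Proof. by rewrite /inorm idotNl idotNr opprK. Qed.

Lemma inormBC x y : inorm (x - y) = inorm (y - x).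
Proof. by rewrite -inormN opprB. Qed.

Lemma sqr_inormD x y :
  inorm (x + y) ^+ 2 = inorm x ^+ 2 + inorm y ^+ 2 + 2 * complex.Re (dot x y).
Proof.
rewrite !sqr_inorm !idotDl !idotDr (inner_herm dotP x y) !ReImE; ring.
Qed.

(** The squared norm of x minus its projection on y is nonnegative. *)
Lemma cauchy_schwarz x y : normc (dot x y) <= inorm x * inorm y.
Proof.
have [y0|y0] := eqVneq (inorm y) 0.
  by rewrite (inorm0_eq0 y0) idot0r normc0 inorm0 mulr0.
have yp : 0 < inorm y by rewrite lt_def y0 inorm_ge0.
have := sqr_ge0 (inorm (x - (dot x y / dot y y) *: y)).
rewrite sqr_inormD inormN inormZ idotNr idotZr ReN mulrN.
have -> : dot x y / dot y y = (inorm y ^- 2)%:C * dot x y.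
  by rewrite idotxx mulrC -fmorphV.
have -> : complex.Re (((inorm y ^- 2)%:C * dot x y)^* * dot x y) =
    normc (dot x y) ^+ 2 / inorm y ^+ 2.
  by rewrite !ReImE sqr_normcE; ring.
rewrite normcM normcC ger0_norm ?invr_ge0 ?sqr_ge0//.
move=> h; rewrite -(@ler_pXn2r _ 2)// ?nnegrE ?normc_ge0 ?mulr_ge0 ?inorm_ge0//.
rewrite exprMn -ler_pdivrMr ?exprn_gt0//.
set n := normc _ in h *.
have e : (inorm y ^- 2 * n * inorm y) ^+ 2 = n ^+ 2 / inorm y ^+ 2 by field.
by rewrite e in h; lra.
Qed.

Lemma le_inormD x y : inorm (x + y) <= inorm x + inorm y.
Proof.
rewrite -(@ler_pXn2r _ 2)// ?nnegrE ?inorm_ge0 ?addr_ge0 ?inorm_ge0//.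
rewrite sqr_inormD sqrrD; have := cauchy_schwarz x y.
have := ler_normr_Re (dot x y); have := ler_norm (complex.Re (dot x y)).
lra.
Qed.

Lemma le_inorm_dist x y z : inorm (x - z) <= inorm (x - y) + inorm (y - z).
Proof. by rewrite -[x - z](subrKA y) le_inormD. Qed.

Lemma ler_inorm_sub x y : inorm x - inorm y <= inorm (x - y).
Proof. by rewrite lerBlDr -{1}(subrK y x) le_inormD. Qed.

Lemma pythagoras x y : dot x y = 0 -> inorm (x + y) ^+ 2 = inorm x ^+ 2 + inorm y ^+ 2.
Proof. by rewrite sqr_inormD => ->; rewrite Re0 mulr0 addr0. Qed.

Section Orthonormal.
Variable e : nat -> V.
Hypothesis eP : forall k l, dot (e k) (e l) = (k == l)%:R.

Definition fourier_sum K x := \sum_(j < K) dot x (e j) *: e j.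

Lemma dot_comb K (c : 'I_K -> R[i]) (l : 'I_K) :
  dot (\sum_(j < K) c j *: e j) (e l) = c l.
Proof.
rewrite idot_suml (bigD1 l)//= idotZl eP eqxx mulr1 big1 ?addr0// => j jl.
by rewrite idotZl eP (inj_eq val_inj) (negbTE jl) mulr0.
Qed.

Lemma sqr_inorm_comb K (c : 'I_K -> R[i]) :
  inorm (\sum_(j < K) c j *: e j) ^+ 2 = \sum_(j < K) normc (c j) ^+ 2.
Proof.
rewrite sqr_inorm idot_suml Re_sum; apply: eq_bigr => j _.
by rewrite idotZl (inner_herm dotP) dot_comb mulJc.
Qed.

Lemma sqr_inorm_fourier_sum K x :
  inorm (fourier_sum K x) ^+ 2 = \sum_(j < K) normc (dot x (e j)) ^+ 2.
Proof. exact: sqr_inorm_comb. Qed.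

Lemma sqr_inorm_sub_fourier_sum K x :
  inorm (x - fourier_sum K x) ^+ 2 =
  inorm x ^+ 2 - \sum_(j < K) normc (dot x (e j)) ^+ 2.
Proof.
apply/eqP; rewrite eq_sym subr_eq -sqr_inorm_fourier_sum -pythagoras ?subrK//.
rewrite (inner_herm dotP) idot_suml big1 ?conjc0// => j _.
by rewrite idotZl [dot (e j) _](inner_herm dotP) idotBl dot_comb subrr conjc0 mulr0.
Qed.

Lemma bessel K x : \sum_(j < K) normc (dot x (e j)) ^+ 2 <= inorm x ^+ 2.
Proof. by rewrite -subr_ge0 -sqr_inorm_sub_fourier_sum sqr_ge0. Qed.

Lemma fourier_sumB K x y : fourier_sum K (x - y) = fourier_sum K x - fourier_sum K y.
Proof.
by rewrite /fourier_sum -sumrB; apply: eq_bigr => j _; rewrite idotBl scalerBl.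
Qed.

(** Subtracting a combination z of the e_j from x does not change the residual x - S x, and a
    residual is never longer than the vector it comes from, here x - z. *)
Lemma fourier_sum_best K x (c : 'I_K -> R[i]) :
  inorm (x - fourier_sum K x) <= inorm (x - \sum_(j < K) c j *: e j).
Proof.
set z := \sum_(j < K) c j *: e j.
have zE : fourier_sum K z = z.
  by apply: eq_bigr => j _; rewrite dot_comb.
have -> : x - fourier_sum K x = (x - z) - fourier_sum K (x - z).
  by rewrite fourier_sumB zE opprB addrA subrK.
rewrite -(@ler_pXn2r _ 2)// ?nnegrE ?inorm_ge0//.
rewrite sqr_inorm_sub_fourier_sum gerBl sumr_ge0// => j _; exact: sqr_ge0.
Qed.
End Orthonormal.
End InnerProduct.

Lemma hnormE (R : realType) (W : wavelet_rep R) (x : wspace W) : hnorm x = inorm (@wdot R W) x.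
Proof. by []. Qed.

(** The constant c accommodates the Fourier transform, which multiplies squared norms by 2 pi. *)
Lemma polarization (R : realType) (V W : lmodType R[i]) (dV : V -> V -> R[i])
    (dW : W -> W -> R[i]) (F : V -> W) (c : R) :
  inner_product dV -> inner_product dW ->
  (forall a x y, F (a *: x + y) = a *: F x + F y) ->
  (forall x, inorm dW (F x) ^+ 2 = c * inorm dV x ^+ 2) ->
  forall x y, dW (F x) (F y) = c%:C * dV x y.
Proof.
move=> pV pW Fl FN x y.
have F0 : F 0 = 0.
  by apply: (addrI (F 0)); have := Fl 1 0 0; rewrite !scale1r !addr0 => {3}->.
have FZ a z : F (a *: z) = a *: F z by have := Fl a z 0; rewrite F0 !addr0.
have FD z w : F (z + w) = F z + F w by have := Fl 1 z w; rewrite !scale1r.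
have H z w : complex.Re (dW (F z) (F w)) = c * complex.Re (dV z w).
  have := FN (z + w); rewrite FD !sqr_inormD// !FN; lra.
apply: complexP; rewrite !ReImE ?H; first by ring.
(* The identity of real parts, applied to i x, is the identity of imaginary parts for x. *)
have := H ((0 +i* 1)%C *: x) y; rewrite FZ (idotZl pV) (idotZl pW) !ReImE/=.
by rewrite !mul0r !sub0r !mul1r mulrN => /oppr_inj ->; rewrite addr0.
Qed.

(** * The Hilbert space of square-integrable functions *)

Section L2Functions.
Variable R : realType.
Local Notation mu := (@lebesgue_measure R).
Implicit Types (f g h : R -> R[i]).

Lemma Lfun2P (g : R -> R) : g \in Lfun mu 2%:E <->
  measurable_fun setT g /\ (\int[mu]_x (g x ^+ 2)%:E < +oo)%E.
Proof.
have e : ('N[mu]_2%:E[EFin \o g] `^ 2 = \int[mu]_x (g x ^+ 2)%:E)%E.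
  rewrite powR_Lnorm//; apply: eq_integral => x _ /=.
  by rewrite powR_mulrn// real_normK// num_real.
split.
  rewrite inE => /andP[/[!inE]/= mg ng]; split => //.
  by rewrite -e poweR_lty.
move=> [mg ng]; rewrite inE; apply/andP; split; rewrite inE//=.
by apply: (@lty_poweRy _ _ 2); rewrite ?pnatr_eq0// e.
Qed.

Lemma sqnormE f : sqnorm f =
  (\int[mu]_x (complex.Re (f x) ^+ 2 + complex.Im (f x) ^+ 2)%:E)%E.
Proof. by apply: eq_integral => x _; rewrite sqr_normcE. Qed.

Lemma sqnorm_ge0 f : (0 <= sqnorm f)%E.
Proof. by apply: integral_ge0 => x _; rewrite lee_fin sqr_ge0. Qed.

Lemma cLfun2P f : f \in cLfun 2%:E <-> cmeasurable f /\ (sqnorm f < +oo)%E.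
Proof.
have e : cmeasurable f -> sqnorm f =
    (\int[mu]_x (complex.Re (f x) ^+ 2)%:E + \int[mu]_x (complex.Im (f x) ^+ 2)%:E)%E.
  move=> [mr mi]; rewrite sqnormE; under eq_integral do rewrite EFinD.
  rewrite ge0_integralD//; try by move=> x _; rewrite lee_fin sqr_ge0.
    by apply/measurable_EFinP; exact: measurable_funX.
  by apply/measurable_EFinP; exact: measurable_funX.
split.
  rewrite inE => /andP[/Lfun2P[mr nr] /Lfun2P[mi ni]].
  have mf : cmeasurable f by split.
  by split => //; rewrite e// lte_add_pinfty.
move=> [mf]; rewrite e// => nf; case: (mf) => mr mi; rewrite inE; apply/andP; split; apply/Lfun2P; split => //.
  by apply: le_lt_trans nf; rewrite leeDl// integral_ge0// => x _; rewrite lee_fin sqr_ge0.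
by apply: le_lt_trans nf; rewrite leeDr// integral_ge0// => x _; rewrite lee_fin sqr_ge0.
Qed.

Lemma measurable_sqnorm f : cmeasurable f ->
  measurable_fun setT (fun x => (normc (f x) ^+ 2)%:E).
Proof. by move=> mf; apply/measurable_EFinP; exact: measurable_sqr_normc. Qed.

Lemma ae_eq_sqnorm f g : cmeasurable f -> cmeasurable g ->
  (\forall x \ae mu, f x = g x) -> sqnorm f = sqnorm g.
Proof.
move=> mf mg fg; apply: ae_eq_integral => //; try exact: measurable_sqnorm.
by apply: ae_imp fg => x ->.
Qed.

Lemma ae_le_sqnorm f g : cmeasurable f -> cmeasurable g ->
  (\forall x \ae mu, normc (f x) <= normc (g x)) -> (sqnorm f <= sqnorm g)%E.
Proof.
move=> mf mg fg; apply: ae_ge0_le_integral => //; try exact: measurable_sqnorm.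
- by move=> x _; rewrite lee_fin sqr_ge0.
- by move=> x _; rewrite lee_fin sqr_ge0.
- by apply: ae_imp fg => x fgx _; rewrite lee_fin lerXn2r ?nnegrE ?normc_ge0.
Qed.

Lemma sqnormZ (a : R[i]) f : cmeasurable f ->
  sqnorm (fun x => a * f x) = ((normc a ^+ 2)%:E * sqnorm f)%E.
Proof.
move=> mf; rewrite /sqnorm -ge0_integralZl_EFin//.
- by apply: eq_integral => x _; rewrite normcM exprMn EFinM.
- by move=> x _; rewrite lee_fin sqr_ge0.
- exact: measurable_sqnorm.
- exact: sqr_ge0.
Qed.

Lemma sqnorm_affine f (a b : R) : 0 < a -> cmeasurable f ->
  sqnorm (fun x => f (a * x + b)) = (a^-1%:E * sqnorm f)%E.
Proof.
move=> a0 mf; rewrite /sqnorm.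
rewrite -(@ge0_integral_affine _ (fun x => (normc (f x) ^+ 2)%:E) a b)//.
  exact: measurable_sqnorm.
by move=> x; rewrite lee_fin sqr_ge0.
Qed.

Lemma sqnorm_eq0 f : cmeasurable f -> sqnorm f = 0%E -> \forall x \ae mu, f x = 0.
Proof.
move=> mf f0.
have : ae_eq mu setT (fun x => (normc (f x) ^+ 2)%:E) (cst 0%E).
  apply/(ae_eq_integral_abs mu measurableT (measurable_sqnorm mf)).
  rewrite -[RHS]f0; apply: eq_integral => x _.
  by rewrite gee0_abs// lee_fin sqr_ge0.
apply: ae_imp => x /(_ I)[/eqP]; rewrite sqrf_eq0 => /eqP.
exact: eq0_normc.
Qed.

Lemma cLfun2_le f g : cmeasurable f -> g \in cLfun 2%:E ->
  (\forall x \ae mu, normc (f x) <= normc (g x)) -> f \in cLfun 2%:E.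
Proof.
move=> mf /cLfun2P[mg g2] fg; apply/cLfun2P; split => //.
by apply: le_lt_trans g2; exact: ae_le_sqnorm.
Qed.

Lemma cLfun2D f g : f \in cLfun 2%:E -> g \in cLfun 2%:E ->
  (fun x => f x + g x) \in cLfun 2%:E.
Proof.
move=> fL gL; have := (cLfun2_submod_closed R).2 1 f g fL gL.
by rewrite scale1r.
Qed.

Lemma cLfun2Z (a : R[i]) f : f \in cLfun 2%:E -> (fun x => a * f x) \in cLfun 2%:E.
Proof.
move=> fL; have := (cLfun2_submod_closed R).2 a f 0 fL (cLfun2_submod_closed R).1.
by rewrite addr0.
Qed.

Lemma cLfun2B f g : f \in cLfun 2%:E -> g \in cLfun 2%:E ->
  (fun x => f x - g x) \in cLfun 2%:E.
Proof.
move=> fL gL; have := cLfun2D fL (cLfun2Z (-1) gL).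
by under eq_fun do rewrite mulN1r.
Qed.

Lemma cLfun2J f : f \in cLfun 2%:E -> (fun x => (f x)^*) \in cLfun 2%:E.
Proof.
move=> /[dup] fL /cLfun2P[mf _]; apply: cLfun2_le (fL) _ => //.
  exact: cmeasurableJ.
by apply: aeW => x; rewrite normcJ'.
Qed.

Lemma cLfun2_sum I (r : seq I) (F : I -> R -> R[i]) :
  (forall i, F i \in cLfun 2%:E) -> (fun x => \sum_(i <- r) F i x) \in cLfun 2%:E.
Proof.
move=> mF; elim: r => [|i r IH].
  by under eq_fun do rewrite big_nil; exact: (cLfun2_submod_closed R).1.
by under eq_fun do rewrite big_cons; exact: cLfun2D.
Qed.

Lemma cLfun2_bounded f g (M : R) : f \in cLfun 2%:E -> cmeasurable g ->
  (\forall x \ae mu, normc (g x) <= M) -> (fun x => g x * f x) \in cLfun 2%:E.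
Proof.
move=> fL mg gM; case/cLfun2P: (fL) => mf _.
apply: (@cLfun2_le _ (fun x => `|M|%:C * f x)); [exact: cmeasurableM|exact: cLfun2Z|].
apply: ae_imp gM => x gM; rewrite !normcM normcC normr_id ler_wpM2r ?normc_ge0//.
by rewrite (le_trans gM)// ler_norm.
Qed.

Lemma cLfun2_affine f (a b : R) : 0 < a -> f \in cLfun 2%:E ->
  (fun x => f (a * x + b)) \in cLfun 2%:E.
Proof.
move=> a0 /cLfun2P[mf f2]; apply/cLfun2P; split.
  apply: cmeasurable_comp => //.
  by apply: measurable_funD => //; exact: measurable_funM.
by rewrite sqnorm_affine// lte_mul_pinfty// lee_fin invr_ge0 ltW.
Qed.

Lemma cLfun2_mul f g : f \in cLfun 2%:E -> g \in cLfun 2%:E ->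
  cintegrable (fun x => f x * g x).
Proof.
move=> /cLfun2P[mf f2] /cLfun2P[mg g2].
have fi h : cmeasurable h -> (sqnorm h < +oo)%E ->
    mu.-integrable setT (fun x => (normc (h x) ^+ 2)%:E).
  move=> mh h2; apply/integrableP; split; first exact: measurable_sqnorm.
  apply: le_lt_trans h2; rewrite /sqnorm; under eq_integral => x _.
    rewrite gee0_abs ?lee_fin ?sqr_ge0//; over.
  by [].
apply: (@le_cintegrable _ _ (fun x => normc (f x) ^+ 2 + normc (g x) ^+ 2)).
- exact: cmeasurableM.
- by under eq_fun do rewrite EFinD; apply: integrableD => //; exact: fi.
- move=> x; rewrite normcM.
  have := sqr_ge0 (normc (f x) - normc (g x)).
  have := normc_ge0 (f x); have := normc_ge0 (g x); nra.
Qed.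

Lemma cint_mulJ f : f \in cLfun 2%:E ->
  cintegral setT (fun x => f x * (f x)^*) = (fine (sqnorm f))%:C.
Proof.
move=> fL; apply: complexP; rewrite ReImE /cintegral/= /Rintegral.
  by congr fine; apply: eq_integral => x _; rewrite mulJc.
by rewrite integral0_eq// => x _; rewrite mulJc.
Qed.
End L2Functions.

Section L2Space.
Variable R : realType.
Local Notation mu := (@lebesgue_measure R).
Local Open Scope quotient_scope.
Implicit Types f g h : L2 R.

Lemma L2_fun f : (f : R -> R[i]) \in cLfun 2%:E.
Proof. exact: (valP (repr f : L2fun R)). Qed.

Lemma L2_cmeasurable f : cmeasurable f.
Proof. by have /cLfun2P[] := L2_fun f. Qed.

Lemma L2_sqnorm_lty f : (sqnorm f < +oo)%E.
Proof. by have /cLfun2P[] := L2_fun f. Qed.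

Lemma L2_piE (u : L2fun R) : \forall x \ae mu, (\pi_(L2 R) u : L2 R) x = L2val u x.
Proof.
have : repr (\pi_(L2 R) u) - u \in @ae_null R by rewrite Quotient.idealrBE reprK.
rewrite unfold_in => /asboolP; apply: ae_imp => x /=.
by rewrite !fctE => /eqP; rewrite subr_eq0 => /eqP.
Qed.

Lemma L2_eqP f g : f = g <-> \forall x \ae mu, f x = g x.
Proof.
split=> [->|fg]; first exact: aeW.
rewrite -[f]reprK -[g]reprK; apply/eqP; rewrite piE Quotient.equivE.
rewrite unfold_in; apply/asboolP; apply: ae_imp fg => x /= e.
by rewrite !fctE; apply/eqP; rewrite subr_eq0; apply/eqP.
Qed.

Lemma mkL2E (u : R -> R[i]) : u \in cLfun 2%:E -> \forall x \ae mu, mkL2 u x = u x.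
Proof. by move=> uL; rewrite /mkL2 /insubd insubT; exact: L2_piE. Qed.

Lemma L2DE f g : \forall x \ae mu, (f + g : L2 R) x = f x + g x.
Proof.
have e : f + g = \pi_(L2 R) (repr f + repr g) by rewrite pi_L2D !reprK.
by apply: ae_imp2 ((L2_eqP _ _).1 e) (L2_piE (repr f + repr g)) => x -> ->.
Qed.

Lemma L2ZE (a : R[i]) f : \forall x \ae mu, (a *: f : L2 R) x = a * f x.
Proof. have e : a *: f = \pi_(L2 R) (a *: repr f) by rewrite -pi_scale reprK.
by apply: ae_imp2 ((L2_eqP _ _).1 e) (L2_piE (a *: repr f)) => x -> ->. Qed.

Lemma L20E : \forall x \ae mu, (0 : L2 R) x = 0.
Proof. by have := L2ZE 0 0; rewrite scale0r; apply: ae_imp => x ->; rewrite mul0r. Qed.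

Lemma L2NE f : \forall x \ae mu, (- f : L2 R) x = - f x.
Proof. by have := L2ZE (-1) f; rewrite scaleN1r; apply: ae_imp => x ->; rewrite mulN1r. Qed.

Lemma L2BE f g : \forall x \ae mu, (f - g : L2 R) x = f x - g x.
Proof. by apply: ae_imp2 (L2DE f (- g)) (L2NE g) => x -> ->. Qed.

Lemma L2_sumE I (r : seq I) (F : I -> L2 R) :
  \forall x \ae mu, (\sum_(i <- r) F i : L2 R) x = \sum_(i <- r) F i x.
Proof.
elim: r => [|i r IH].
  by rewrite big_nil; apply: ae_imp L20E => x ->; rewrite big_nil.
by rewrite big_cons; apply: ae_imp2 (L2DE (F i) (\sum_(j <- r) F j)) IH => x -> ->; rewrite big_cons.
Qed.

Lemma L2dot_inner : inner_product (@L2dot R).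
Proof.
split.
- move=> a x y z; rewrite /L2dot -cintZ; last by apply: cLfun2_mul (cLfun2J _); exact: L2_fun.
  rewrite -cintD; first last.
    + by apply: cLfun2_mul (cLfun2J _); exact: L2_fun.
    + by apply: cintegrableZ; apply: cLfun2_mul (cLfun2J _); exact: L2_fun.
  apply: ae_eq_cint.
  + by apply: cmeasurableM (cmeasurableJ _); exact: L2_cmeasurable.
  + apply: cmeasurableD.
      apply: cmeasurableM; first exact: cmeasurable_cst.
      by apply: cmeasurableM (cmeasurableJ _); exact: L2_cmeasurable.
    by apply: cmeasurableM (cmeasurableJ _); exact: L2_cmeasurable.
  by apply: ae_imp2 (L2DE (a *: x) y) (L2ZE a x) => t -> ->; rewrite mulrDl mulrA.
- move=> x y; rewrite /L2dot -cintJ; last by apply: cLfun2_mul (cLfun2J _); exact: L2_fun.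
  by congr cintegral; apply/funext => t; rewrite rmorphM/= conjcK mulrC.
- by move=> x; rewrite /L2dot cint_mulJ ?L2_fun//= fine_ge0// sqnorm_ge0.
- move=> x; rewrite /L2dot cint_mulJ ?L2_fun//= => x0; apply/L2_eqP.
  have : sqnorm (x : L2 R) = 0%E.
    by rewrite -[LHS]fineK ?x0// ge0_fin_numE ?sqnorm_ge0// L2_sqnorm_lty.
  move=> /(sqnorm_eq0 (L2_cmeasurable x)) h.
  by apply: ae_imp2 h L20E => t -> ->.
Qed.

Local Notation L2norm := (inorm (@L2dot R)).

Lemma sqnorm_L2 f : sqnorm f = (L2norm f ^+ 2)%:E.
Proof.
rewrite (sqr_inorm L2dot_inner) /L2dot cint_mulJ ?L2_fun//= fineK//.
by rewrite ge0_fin_numE ?sqnorm_ge0// L2_sqnorm_lty.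
Qed.

Lemma sqnorm_L2_eq f (u : R -> R[i]) : cmeasurable u ->
  (\forall x \ae mu, f x = u x) -> sqnorm u = (L2norm f ^+ 2)%:E.
Proof.
by move=> mu fu; rewrite -sqnorm_L2; apply/esym/ae_eq_sqnorm => //; exact: L2_cmeasurable.
Qed.

Lemma L2norm_mkL2 (u : R -> R[i]) : u \in cLfun 2%:E ->
  (L2norm (mkL2 u) ^+ 2)%:E = sqnorm u.
Proof. by move=> uL; apply/esym/sqnorm_L2_eq; [case/cLfun2P: uL|exact: mkL2E]. Qed.

Lemma L2dot_mkL2 (u v : R -> R[i]) : u \in cLfun 2%:E -> v \in cLfun 2%:E ->
  L2dot (mkL2 u) (mkL2 v) = cintegral setT (fun x => u x * (v x)^*).
Proof.
move=> uL vL; apply: ae_eq_cint.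
- by apply: cmeasurableM (cmeasurableJ _); exact: L2_cmeasurable.
- by case/cLfun2P: uL => ? _; case/cLfun2P: vL => ? _; apply: cmeasurableM (cmeasurableJ _).
- by apply: ae_imp2 (mkL2E uL) (mkL2E vL) => x -> ->.
Qed.

Lemma mkL2_eq (u v : R -> R[i]) : u \in cLfun 2%:E -> v \in cLfun 2%:E ->
  (\forall x \ae mu, u x = v x) -> mkL2 u = mkL2 v.
Proof.
move=> uL vL uv; apply/L2_eqP.
by apply: ae_imp3 uv (mkL2E uL) (mkL2E vL) => x -> -> ->.
Qed.

Lemma mkL2K f : mkL2 f = f.
Proof. by apply/L2_eqP; exact: mkL2E (L2_fun f). Qed.

Lemma mkL2_lin (a : R[i]) (u v : R -> R[i]) : u \in cLfun 2%:E -> v \in cLfun 2%:E ->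
  mkL2 (fun x => a * u x + v x) = a *: mkL2 u + mkL2 v.
Proof.
move=> uL vL; apply/L2_eqP.
have h1 := mkL2E (cLfun2D (cLfun2Z a uL) vL).
apply: ae_imp3 h1 (L2DE (a *: mkL2 u) (mkL2 v)) _; last first.
  by apply: ae_imp3 (L2ZE a (mkL2 u)) (mkL2E uL) (mkL2E vL) => x e1 e2 e3; exact: (conj e1 (conj e2 e3)).
by move=> x -> -> [-> [-> ->]].
Qed.

Lemma mkL2B (u v : R -> R[i]) : u \in cLfun 2%:E -> v \in cLfun 2%:E ->
  mkL2 (fun x => u x - v x) = mkL2 u - mkL2 v.
Proof.
move=> uL vL; rewrite -scaleN1r addrC -mkL2_lin//.
by congr mkL2; apply/funext => x; rewrite mulN1r addrC.
Qed.

Lemma L2norm_mkL2B f (v : R -> R[i]) : v \in cLfun 2%:E ->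
  (L2norm (f - mkL2 v) ^+ 2)%:E = sqnorm (fun x => f x - v x).
Proof.
by move=> vL; rewrite -{1}(mkL2K f) -mkL2B ?L2_fun// L2norm_mkL2// cLfun2B// L2_fun.
Qed.
End L2Space.

Notation L2norm := (inorm (@L2dot _)).

#[global] Opaque inorm L2dot mkL2.

(** * Completeness of L^2 *)

Section Completeness.
Variable R : realType.
Local Notation mu := (@lebesgue_measure R).

Definition hcauchy (V : lmodType R[i]) (dot : V -> V -> R[i]) (u : nat -> V) :=
  forall e : R, 0 < e -> exists N, forall m n, (N <= m)%N -> (N <= n)%N ->
    inorm dot (u m - u n) < e.

Definition hcvg (V : lmodType R[i]) (dot : V -> V -> R[i]) (u : nat -> V) (l : V) :=
  forall e : R, 0 < e -> exists N, forall n, (N <= n)%N -> inorm dot (u n - l) < e.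

(* Under this decay, sum_k 2^k |d_k|^2 is integrable, hence finite a.e. *)
Lemma ae_fast_decay (d : nat -> R -> R[i]) : (forall k, cmeasurable (d k)) ->
  (forall k, (sqnorm (d k) <= ((4 ^+ k.+1)^-1)%:E)%E) ->
  \forall x \ae mu, exists M, forall k, normc (d k x) ^+ 2 <= M * 2^-1 ^+ k.
Proof.
move=> md dle; pose F k x := (2 ^+ k * normc (d k x) ^+ 2)%:E.
have F0 k x : (0 <= F k x)%E by rewrite lee_fin mulr_ge0 ?sqr_ge0 ?exprn_ge0.
have mF k : measurable_fun setT (F k).
  by apply/measurable_EFinP; apply: measurable_funM => //; exact: measurable_sqr_normc.
have Foo : (\int[mu]_x (\sum_(0 <= k <oo) F k x) < +oo)%E.
  rewrite integral_nneseries//.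
  apply: (@le_lt_trans _ _ 1%:E); last exact: ltry.
  apply: le_trans (epsilon_trick0 xpredT ler01); apply: lee_nneseries.
    by move=> k _ _; apply: integral_ge0.
  move=> k _; rewrite /F; under eq_integral do rewrite EFinM.
  rewrite ge0_integralZl_EFin//; last 2 first.
    - by move=> x _; rewrite lee_fin sqr_ge0.
    - exact: measurable_sqnorm.
  apply: (@le_trans _ _ ((2 ^+ k)%:E * ((4 ^+ k.+1)^-1)%:E)%E).
    by apply: lee_wpmul2l; [rewrite lee_fin exprn_ge0|exact: dle].
  rewrite -EFinM lee_fin natrX div1r (_ : 4 = 2 * 2 :> R); last by rewrite -natrM.
  have k0 : (0 : R) < 2 ^+ k.+1 by rewrite exprn_gt0.
  rewrite exprMn invfM mulrA ler_piMl ?invr_ge0 ?(ltW k0)//.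
  by rewrite ler_pdivrMr// mul1r ler_eXn2l ?ltr1n.
have Fi : mu.-integrable setT (fun x => \sum_(0 <= k <oo) F k x)%E.
  apply/integrableP; split.
    by apply: (@ge0_emeasurable_sum _ _ _ setT F xpredT) => k *; [exact: F0|exact: mF].
  apply: le_lt_trans Foo; rewrite le_eqVlt; apply/orP; left; apply/eqP.
  by apply: eq_integral => x _; rewrite gee0_abs// nneseries_ge0.
apply: ae_imp (integrable_ae measurableT Fi) => x /(_ I) fx.
exists (fine (\sum_(0 <= k <oo) F k x)%E) => k.
rewrite -[X in X <= _]mul1r -[X in X * _ <= _](@divff _ (2 ^+ k)) ?expf_neq0 ?pnatr_eq0//.
rewrite mulrAC exprVn ler_pM2r ?invr_gt0 ?exprn_gt0// -lee_fin fineK//.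
apply: le_trans (nneseries_lim_ge k.+1 _) => //.
by rewrite big_mkord big_ord_recr/= leeDr// sume_ge0.
Qed.

(** The increments are bounded by sqrt M q^k with q = sqrt (1/2) < 1, so the telescoping series
    converges absolutely. *)
Lemma geometric_step_cvg (r : R ^nat) (M : R) :
  (forall k, (r k.+1 - r k) ^+ 2 <= M * 2^-1 ^+ k) -> cvgn r.
Proof.
move=> h; have M0 : 0 <= M by have := h 0%N; rewrite expr0 mulr1; apply: le_trans; exact: sqr_ge0.
have : cvgn (series (telescope r)).
  apply: (@normed_cvg R R^o); pose q : R := Num.sqrt 2^-1.
  have q1 : q < 1.
    by rewrite -sqrtr1 ltr_sqrt// invf_lt1// ltr1n.
  apply: (@series_le_cvg _ _ (geometric (Num.sqrt M) q)) => //.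
  - by move=> k; exact: normr_ge0.
  - by move=> k; rewrite /geometric/= mulr_ge0 ?exprn_ge0 ?sqrtr_ge0.
  - move=> k; rewrite /telescope /geometric/=.
    rewrite -(@ler_pXn2r _ 2)// ?nnegrE ?mulr_ge0 ?exprn_ge0 ?sqrtr_ge0//.
    rewrite real_normK ?num_real// exprMn sqr_sqrtr// -exprM mulnC exprM.
    by rewrite sqr_sqrtr ?invr_ge0.
  - by apply: is_cvg_geometric_series; rewrite ger0_norm// sqrtr_ge0.
move=> /cvg_ex[l hl]; apply/cvg_ex; exists (r 0%N + l).
have e : (fun=> r 0%N) + series (telescope r) = r.
  by apply/funext => n; rewrite fctE [RHS]eq_sum_telescope.
by rewrite -[X in X @ _]e; apply: cvgD => //; exact: cvg_cst.
Qed.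

Lemma limn_einf_le (u : (\bar R)^nat) (c : \bar R) k :
  (forall n, (k <= n)%N -> (u n <= c)%E) -> (limn_einf u <= c)%E.
Proof.
move=> uc; rewrite limn_einf_lim; apply: lime_le; first exact: is_cvg_einfs.
apply: nearW => n; apply: (@le_trans _ _ (u (maxn k n))); last by rewrite uc// leq_maxl.
by apply: ereal_inf_lbound; exists (maxn k n) => //=; rewrite leq_maxr.
Qed.

(** The limit is taken pointwise, and Fatou's lemma transfers to it any bound on the distances from
    v_k to the later terms. The conclusion is stated for an arbitrary bound c so that it yields both
    the square integrability of the limit and the rate of convergence. *)
Lemma fast_cauchy_cvg (v : nat -> L2 R) :
  (forall k, L2norm (v k.+1 - v k) ^+ 2 <= (4 ^+ k.+1)^-1) ->
  (exists c, forall j, L2norm (v j - v 0%N) ^+ 2 <= c) ->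
  exists l : L2 R, forall k (c : R), (forall j, (k <= j)%N -> L2norm (v j - v k) ^+ 2 <= c) ->
    L2norm (v k - l) ^+ 2 <= c.
Proof.
move=> hv [c0 hc0].
have : \forall x \ae mu, exists M, forall k, normc ((v k.+1 - v k : L2 R) x) ^+ 2 <= M * 2^-1 ^+ k.
  apply: ae_fast_decay => k; first exact: L2_cmeasurable.
  by rewrite sqnorm_L2 lee_fin.
move=> h1; have h2 : \forall x \ae mu, forall k, (v k.+1 - v k : L2 R) x = v k.+1 x - v k x.
  by apply: ae_forall => k; exact: L2BE.
(* The limit superior is defined and measurable everywhere, also at the points where the sequence
   diverges. *)
pose lr x := fine (limn_esup (fun k => (complex.Re (v k x))%:E)).
pose li x := fine (limn_esup (fun k => (complex.Im (v k x))%:E)).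
have ml (T : R[i] -> R) : (forall k, measurable_fun setT (fun x => T (v k x))) ->
    measurable_fun setT (fun x => fine (limn_esup (fun k => (T (v k x))%:E))).
  move=> mT; apply: (measurableT_comp (fine_measurable measurableT)).
  apply: (@measurable_fun_limn_esup _ _ _ _ (fun k x => (T (v k x))%:E)) => k.
  exact/measurable_EFinP.
pose l x := lr x +i* li x.
have mlr : cmeasurable l.
  by split; apply: ml => k; case: (L2_cmeasurable (v k)).
have cvl : \forall x \ae mu,
    (fun k => complex.Re (v k x)) @ \oo --> lr x /\ (fun k => complex.Im (v k x)) @ \oo --> li x.
  apply: ae_imp2 h1 h2 => x [M hM] e.
  have cT (T : R[i] -> R) : (forall z w, T (z - w) = T z - T w) ->
      (forall z, `|T z| <= normc z) ->
      (fun k => T (v k x)) @ \oo --> fine (limn_esup (fun k => (T (v k x))%:E)).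
    move=> TB Tn; have /cvg_ex[a ha] : cvgn (fun k => T (v k x)).
      apply: (@geometric_step_cvg _ M) => k; rewrite -TB -e.
      apply: le_trans (hM k); rewrite -[X in X <= _]real_normK ?num_real//.
      by rewrite lerXn2r ?nnegrE ?normc_ge0.
    have ha' : (fun k => (T (v k x))%:E) @ \oo --> a%:E by apply: cvg_EFin => //; apply: nearW.
    by rewrite (cvg_limn_einf_sup ha').2.
  split; [apply: (cT (@complex.Re R))|apply: (cT (@complex.Im R))].
  - by move=> z w; rewrite !ReImE.
  - exact: ler_normr_Re.
  - by move=> z w; rewrite !ReImE.
  - exact: ler_normr_Im.
have key k c : (forall j, (k <= j)%N -> L2norm (v j - v k) ^+ 2 <= c) ->
    (sqnorm (fun x => l x - v k x)%R <= c%:E)%E.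
  move=> hc; pose F j x := (normc (v j x - v k x) ^+ 2)%:E.
  have mF j : measurable_fun setT (F j).
    apply: (@measurable_sqnorm _ (fun x => v j x - v k x)).
    by apply: cmeasurableB; exact: L2_cmeasurable.
  have : (\int[mu]_x limn_einf (F^~ x) <= limn_einf (fun j => \int[mu]_x F j x))%E.
    by apply: fatou => // j x _; rewrite lee_fin sqr_ge0.
  move=> /le_trans H; have -> : sqnorm (fun x => l x - v k x) = (\int[mu]_x limn_einf (F^~ x))%E.
    apply: ae_eq_integral => //.
    - by apply: measurable_sqnorm; apply: cmeasurableB => //; exact: L2_cmeasurable.
    - have -> : (fun x => limn_einf (F^~ x)) = (fun x => - limn_esup (fun j => - F j x))%E.
        by apply/funext => x; rewrite -limn_einfN; congr limn_einf; apply/funext => j; rewrite /comp oppeK.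
      apply: measurableT_comp => //; apply: (@measurable_fun_limn_esup _ _ _ _ (fun j x => - F j x)%E) => j.
      exact: measurableT_comp.
    - apply: ae_imp cvl => x [cr ci] _; apply/esym.
      suff /cvg_limn_einf_sup[] : F^~ x @ \oo --> (normc (l x - v k x) ^+ 2)%:E by [].
      apply: cvg_EFin; first by apply: nearW.
      have -> : fine \o F^~ x = (fun j =>
          (complex.Re (v j x) - complex.Re (v k x)) ^+ 2 +
          (complex.Im (v j x) - complex.Im (v k x)) ^+ 2).
        by apply/funext => j; rewrite /F/= -?[Num.sqrt _]/(normc _) sqr_normcE !ReImE.
      rewrite sqr_normcE !ReImE; apply: cvgD; rewrite expr2.
        by apply: cvgM; apply: cvgB => //; exact: cvg_cst.
      by apply: cvgM; apply: cvgB => //; exact: cvg_cst.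
  apply: H; apply: (@limn_einf_le _ _ k) => j kj.
  rewrite -[X in (X <= _)%E]/(sqnorm (fun x => v j x - v k x)).
  rewrite (@sqnorm_L2_eq _ (v j - v k)) ?lee_fin ?hc//; last exact: L2BE.
  by apply: cmeasurableB; exact: L2_cmeasurable.
have lL : l \in cLfun 2%:E.
  have -> : l = (fun x => (l x - v 0%N x) + v 0%N x) by apply/funext => x; rewrite subrK.
  apply: cLfun2D; last exact: L2_fun.
  apply/cLfun2P; split; first by apply: cmeasurableB => //; exact: L2_cmeasurable.
  by apply: le_lt_trans (key 0%N c0 _) (ltry _) => j _.
exists (mkL2 l) => k c hc; rewrite (inormBC (L2dot_inner R)).
rewrite -lee_fin -(@sqnorm_L2_eq _ (mkL2 l - v k) (fun x => l x - v k x)); first exact: key.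
  by apply: cmeasurableB => //; exact: L2_cmeasurable.
by apply: ae_imp2 (L2BE (mkL2 l) (v k)) (mkL2E lL) => x -> ->.
Qed.

Lemma L2_complete (u : nat -> L2 R) : hcauchy (@L2dot R) u -> exists l, hcvg (@L2dot R) u l.
Proof.
have IP := L2dot_inner R.
move=> hu; have gP k : exists N, forall m n, (N <= m)%N -> (N <= n)%N ->
    L2norm (u m - u n) < (2 ^+ k.+1)^-1.
  by apply: hu; rewrite invr_gt0 exprn_gt0.
(* The maximum makes the extracted subsequence nondecreasing. *)
have [g hg] := choice gP; pose s k := (\max_(i < k.+1) g i)%N.
have gs k : (g k <= s k)%N by exact: (leq_bigmax (@ord_max k)).
have sS k j : (k <= j)%N -> (s k <= s j)%N.
  move=> kj; apply/bigmax_leqP => i _.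
  by apply: (leq_bigmax (widen_ord (_ : k.+1 <= j.+1)%N i)).
have sq k m n : (s k <= m)%N -> (s k <= n)%N -> L2norm (u m - u n) ^+ 2 <= (4 ^+ k.+1)^-1.
  move=> km kn; have -> : 4 ^- k.+1 = ((2 ^+ k.+1)^-1) ^+ 2 :> R.
    by rewrite exprVn -exprM mulnC exprM expr2 -natrM.
  rewrite lerXn2r ?nnegrE ?inorm_ge0 ?invr_ge0 ?exprn_ge0// ltW//.
  by apply: hg; exact: leq_trans (gs k) _.
have [||l hl] := @fast_cauchy_cvg (u \o s).
- by move=> k; apply: sq => //; exact: sS.
- by exists (4 ^- 1) => j; apply: sq => //; exact: sS.
exists l => e e0.
have [k hk] : exists k, (2 ^+ k.+1)^-1 < e / 2.
  exists (Num.Def.archi_bound (e / 2)^-1).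
  rewrite -ltf_pV2 ?invrK ?posrE ?invr_gt0 ?exprn_gt0 ?divr_gt0//.
  exact: upper_nthrootP.
exists (s k) => n kn; apply: le_lt_trans (le_inorm_dist IP _ (u (s k)) _) _.
have h1 : L2norm (u n - u (s k)) < e / 2.
  by apply: lt_trans hk; apply: hg; [exact: leq_trans (gs k) _|exact: gs].
have h2 : L2norm (u (s k) - l) <= e / 2.
  rewrite -(@ler_pXn2r _ 2)// ?nnegrE ?inorm_ge0 ?divr_ge0 ?(ltW e0)//.
  apply: hl => j kj; apply: le_trans (sq k _ _ _ _) _ => //; first exact: sS.
  have -> : 4 ^- k.+1 = ((2 ^+ k.+1)^-1) ^+ 2 :> R.
    by rewrite exprVn -exprM mulnC exprM expr2 -natrM.
  by rewrite lerXn2r ?nnegrE ?invr_ge0 ?exprn_ge0 ?divr_ge0 ?(ltW e0) ?(ltW hk).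
by rewrite [e]splitr ltr_leD.
Qed.
End Completeness.

(** * Completeness of the trigonometric system *)

Section ZeroCoefficients.
Variable R : realType.
Local Notation cint := (cintegral setT).
Implicit Types f : R -> R[i].

Lemma bernoulli_ge (x : R) n : -1 <= x -> 1 + n%:R * x <= (1 + x) ^+ n.
Proof.
move=> x1; elim: n => [|n IH]; first by rewrite mul0r addr0.
rewrite exprS; apply: le_trans (ler_wpM2l _ IH); last by lra.
rewrite -natr1; have := sqr_ge0 x; have : (0 : R) <= n%:R by []. nra.
Qed.

Lemma step_poly_ge0 (u : R) n m : 0 <= u <= 1 -> 0 <= (1 - u ^+ n) ^+ m <= 1.
Proof.
move=> /andP[u0 u1]; have un : u ^+ n <= 1 by rewrite exprn_ile1.
have un0 : 0 <= u ^+ n by rewrite exprn_ge0.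
by rewrite exprn_ge0 ?subr_ge0// exprn_ile1// ?subr_ge0// gerBl.
Qed.

(** Bernoulli's inequality gives (1 - u^n)^(k^n) >= 1 - (k u)^n. *)
Lemma step_poly_cvg1 (u : R) k : 0 <= u <= 1 -> k%:R * u < 1 ->
  (fun n => (1 - u ^+ n) ^+ (k ^ n)) @ \oo --> (1 : R).
Proof.
move=> u01 ku; case/andP: (u01) => u0 u1.
apply: (@squeeze_cvgr _ \oo _ _ (fun n => 1 - (k%:R * u) ^+ n) (cst 1)).
- near=> n; have /andP[_ ->] := step_poly_ge0 n (k ^ n) u01; rewrite andbT.
  have := @bernoulli_ge (- u ^+ n) (k ^ n).
  by rewrite lerN2 exprn_ile1// natrX mulrN -exprMn => ->.
- rewrite -[X in _ --> X]subr0; apply: cvgB; first exact: cvg_cst.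
  by apply: cvg_expr; rewrite ger0_norm// mulr_ge0.
- exact: cvg_cst.
Unshelve. all: by end_near. Qed.

(** As (1 - u^n) (1 + u^n) <= 1, the power is at most 1 / (1 + u^n)^(k^n), hence at most (k u)^-n by
    Bernoulli's inequality. These estimates are those of the Brosowski-Deutsch proof of the
    Stone-Weierstrass theorem. *)
Lemma step_poly_cvg0 (u : R) k : 0 <= u <= 1 -> 1 < k%:R * u ->
  (fun n => (1 - u ^+ n) ^+ (k ^ n)) @ \oo --> (0 : R).
Proof.
move=> u01 ku; case/andP: (u01) => u0 u1.
have ku0 : 0 < k%:R * u by exact: lt_trans ku.
apply: (@squeeze_cvgr _ \oo _ _ (cst 0) (fun n => (k%:R * u)^-1 ^+ n)).
- near=> n; have /andP[-> p1] /= := step_poly_ge0 n (k ^ n) u01.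
  rewrite exprVn -[leRHS]mul1r ler_pdivlMr ?exprn_gt0//.
  have h : (k%:R * u) ^+ n <= (1 + u ^+ n) ^+ (k ^ n).
    apply: le_trans (bernoulli_ge _ _); first by rewrite natrX -exprMn ler_wpDl.
    by rewrite (@le_trans _ _ 0)// ?exprn_ge0// oppr_le0.
  have /andP[p0 _] := step_poly_ge0 n (k ^ n) u01.
  apply: le_trans (ler_wpM2l p0 h) _; rewrite -exprMn -subr_sqr expr1n.
  by rewrite exprn_ile1// ?subr_ge0 ?gerBl -?exprM ?exprn_ge0// exprn_ile1.
- exact: cvg_cst.
- by apply: cvg_expr; rewrite ger0_norm ?invr_ge0 ?(ltW ku0)// invf_lt1.
Unshelve. all: by end_near. Qed.

(** This property is stable under multiplication by trigonometric polynomials, which is how the step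
    polynomials are brought under the integral. *)
Definition zero_coef f :=
  cintegrable f /\ forall k : int, cint (fun x => f x * expi (k%:~R * x)) = 0.

Lemma cintegrable_expi f (c d : R) : cintegrable f ->
  cintegrable (fun x => f x * expi (c * x + d)).
Proof.
move=> fi; apply: (@cintegrable_bounded _ _ _ 1) => //.
  by apply: cmeasurable_expi; apply: measurable_funD => //; exact: measurable_funM.
by move=> x; rewrite normc_expi.
Qed.

Lemma cintegrable_expiM f (c : R) : cintegrable f ->
  cintegrable (fun x => f x * expi (c * x)).
Proof. by move=> /(cintegrable_expi c 0); under eq_fun do rewrite addr0. Qed.

Lemma zero_coefD f g : zero_coef f -> zero_coef g -> zero_coef (fun x => f x + g x).
Proof.
move=> [fi f0] [gi g0]; split; first exact: cintegrableD.
move=> k; under eq_fun do rewrite mulrDl.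
by rewrite cintD ?f0 ?g0 ?addr0//; exact: cintegrable_expiM.
Qed.

Lemma zero_coefZ (a : R[i]) f : zero_coef f -> zero_coef (fun x => a * f x).
Proof.
move=> [fi f0]; split; first exact: cintegrableZ.
move=> k; under eq_fun do rewrite -mulrA.
by rewrite cintZ ?f0 ?mulr0//; exact: cintegrable_expiM.
Qed.

Lemma zero_coef_expi (k : int) f : zero_coef f -> zero_coef (fun x => f x * expi (k%:~R * x)).
Proof.
move=> [fi f0]; split; first exact: cintegrable_expiM.
move=> l; rewrite -(f0 (k + l)); congr cintegral; apply/funext => x.
by rewrite -mulrA -expiD intrD mulrDl.
Qed.

Lemma expi_cos (t : R) : (cos t)%:C = (2^-1)%:C * (expi t + expi (- t)) :> R[i].
Proof. by apply: complexP; rewrite !ReImE /expi/= cosN sinN; field. Qed.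

Lemma zero_coef_cos (x0 : R) f : zero_coef f ->
  zero_coef (fun x => f x * (cos (x - x0))%:C).
Proof.
move=> f0.
have := zero_coefD (zero_coefZ ((2^-1)%:C * expi (- x0)) (zero_coef_expi 1 f0))
  (zero_coefZ ((2^-1)%:C * expi x0) (zero_coef_expi (-1) f0)).
congr zero_coef; apply/funext => x; rewrite expi_cos expiD opprB addrC -[x0 - x]/(x0 + - x) expiD.
rewrite mul1r mulN1r; ring.
Qed.

Lemma zero_coef_step (x0 c : R) n m f : zero_coef f ->
  zero_coef (fun x => f x * ((1 - (c * ((1 - cos (x - x0)) / 2)) ^+ n) ^+ m)%:C).
Proof.
have H0 : forall f, zero_coef f -> zero_coef (fun x => f x * (c * ((1 - cos (x - x0)) / 2))%:C).
  move=> g g0; have := zero_coefD (zero_coefZ (c / 2)%:C g0)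
    (zero_coefZ (- c / 2)%:C (zero_coef_cos x0 g0)).
  congr zero_coef; apply/funext => x.
  rewrite (mulrCA _ (g x)) [_%:C * g x]mulrC -mulrDr; congr (_ * _).
  by rewrite -rmorphM -rmorphD; congr (_%:C); field.
have Hn : forall f, zero_coef f -> zero_coef (fun x => f x * ((c * ((1 - cos (x - x0)) / 2)) ^+ n)%:C).
  move=> g g0; elim: n => [|n IH]; first by under eq_fun do rewrite expr0 mulr1.
  by have := H0 _ IH; under eq_fun do rewrite -mulrA -rmorphM -exprSr.
move=> f0; elim: m => [|m IH]; first by under eq_fun do rewrite expr0 mulr1.
have := zero_coefD IH (zero_coefZ (-1) (Hn _ IH)).
congr zero_coef; apply/funext => x.
by rewrite mulN1r -mulrN -rmorphN -{1}[f x * _]mulr1 -mulrDr -(rmorph1 (real_complex R)) -rmorphD -mulrA -rmorphM -exprSr.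
Qed.
End ZeroCoefficients.

Section Arcs.
Variable R : realType.
Local Notation mu := (@lebesgue_measure R).
Local Notation cint := (cintegral setT).
Implicit Types f : R -> R[i].

Lemma zero_integral_lim (g : R -> R) (q : nat -> R -> R) (l : R -> R) :
  mu.-integrable setT (EFin \o g) ->
  (forall n, measurable_fun setT (q n)) -> measurable_fun setT l ->
  (forall n x, 0 <= q n x <= 1) ->
  (\forall x \ae mu, (fun n => g x * q n x) @ \oo --> g x * l x) ->
  (forall n, \int[mu]_x (g x * q n x) = 0) ->
  \int[mu]_x (g x * l x) = 0.
Proof.
move=> gi mq ml q01 gq g0.
have mg : measurable_fun setT g by apply/measurable_EFinP; exact: measurable_int gi.
have gq' n x : (`|(g x * q n x)%:E| <= `|(EFin \o g) x|)%E.
  rewrite lee_fin normrM; have /andP[q0 q1] := q01 n x.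
  by rewrite (ger0_norm q0) ler_piMr.
have [| | | | | _ _ h] := @dominated_convergence _ _ _ mu setT measurableT
    (fun n x => (g x * q n x)%:E) (fun x => (g x * l x)%:E) (fun x => `|(EFin \o g) x|%E).
- by move=> n; apply/measurable_EFinP; apply: measurable_funM => //; exact: mq.
- by apply/measurable_EFinP; apply: measurable_funM.
- by apply: ae_imp gq => x H _; apply: cvg_EFin => //; apply: nearW.
- exact: integrable_abse.
- by apply: aeW => x n _; exact: gq'.
have e : (fun n => \int[mu]_x (g x * q n x)%:E)%E = cst 0%E.
  apply/funext => n; rewrite -[LHS]fineK.
    by have := congr1 EFin (g0 n).
  apply: integrable_fin_num => //; apply: le_integrable gi => //.
    by apply/measurable_EFinP; apply: measurable_funM => //; exact: mq.
move: h; rewrite e => h.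
have h' : cst 0%E @ \oo --> (\int[mu]_x (g x * l x)%:E)%E := h.
by rewrite /Rintegral (cvg_unique (@ereal_hausdorff R) h' (cvg_cst _)).
Qed.

Definition arc_indic (a b : R) : R -> R := \1_(`]a, b[%classic).

Lemma cos_gt_arc (a x y : R) : a < x < a + 2 * pi -> a < y < x ->
  cos ((x - a) / 2) < cos (y - (a + x) / 2).
Proof.
move=> /andP[ax xa] /andP[ay yx].
have -> : cos (y - (a + x) / 2) = cos `|y - (a + x) / 2|.
  by case: ger0P => _; rewrite ?cosN.
have h : `|y - (a + x) / 2| < (x - a) / 2 by rewrite ltr_norml; apply/andP; split; lra.
have h0 := normr_ge0 (y - (a + x) / 2).
by rewrite ltr_cos ?in_itv//=; apply/andP; split; lra.
Qed.

(** Reflection about pi reduces the claim to the monotonicity of cos on [0, pi]: for y in the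
    complementary arc, y - (a + x) / 2 is closer to pi than (x - a) / 2 is. *)
Lemma cos_lt_arc (a x y : R) : a < x < a + 2 * pi -> x < y < a + 2 * pi ->
  cos (y - (a + x) / 2) < cos ((x - a) / 2).
Proof.
move=> /andP[ax xa] /andP[xy ya].
have pi0 := pi_gt0 R.
have -> : cos (y - (a + x) / 2) = cos (pi - `|pi - (y - (a + x) / 2)|).
  have e (t : R) : cos (2 * pi - t) = cos t.
    by rewrite mulr_natl addrC cosD2pi cosN.
  case: ger0P => _; first by congr cos; ring.
  by rewrite -e; congr cos; ring.
have h : `|pi - (y - (a + x) / 2)| < pi - (x - a) / 2.
  by rewrite ltr_norml; apply/andP; split; lra.
have h0 := normr_ge0 (pi - (y - (a + x) / 2)).
by rewrite ltr_cos ?in_itv//=; [lra|apply/andP; split; lra..].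
Qed.

(* The polynomials (1 - u^n)^(k^n) in u = c (1 - cos (y - x0)) / 2, where x0 is the
   midpoint of the arc, converge to 1 where u < 1/k and to 0 where u > 1/k; the
   constant c is chosen so that u = 1/k at the endpoints. *)
Lemma zero_coef_arc (a x : R) f : a < x < a + 2 * pi ->
  (forall y, ~ (a <= y < a + 2 * pi) -> f y = 0) -> zero_coef f ->
  (\int[mu]_y (complex.Re (f y) * arc_indic a x y) = 0) /\
  (\int[mu]_y (complex.Im (f y) * arc_indic a x y) = 0).
Proof.
move=> axa fs f0; case/andP: (axa) => ax xa; have pi0 := pi_gt0 R.
pose x0 := (a + x) / 2; pose d := (x - a) / 2; pose tau := (1 - cos d) / 2.
have tau1 : tau < 1.
  rewrite /tau ltr_pdivrMr// mul1r; have : cos pi < cos d.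
    by rewrite ltr_cos ?in_itv/= /d//; [lra|apply/andP; split; lra..].
  rewrite cospi; lra.
have tau0 : 0 < tau.
  rewrite /tau divr_gt0// subr_gt0 -(@cos0 R).
  by rewrite ltr_cos ?in_itv/= /d//; [lra|apply/andP; split; lra..].
(* With k tau >= 1 the constant c = 1 / (k tau) is at most 1, so that u stays in [0, 1]; then k u y
   < 1 means (1 - cos (y - x0)) / 2 < tau. *)
pose k := (Num.Def.archi_bound tau^-1).+1.
have ktau : 1 <= k%:R * tau.
  rewrite -ler_pdivrMr// mul1r ltW// (lt_trans (archi_boundP _))// ?invr_ge0 ?(ltW tau0)//.
  by rewrite ltr_nat.
pose c := (k%:R * tau)^-1.
have kt0 : 0 < k%:R * tau by exact: lt_le_trans ktau.
have c0 : 0 < c by rewrite invr_gt0.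
have c1 : c <= 1 by rewrite invf_le1.
pose u y := c * ((1 - cos (y - x0)) / 2).
have u01 y : 0 <= u y <= 1.
  have := cos_le1 (y - x0); have := cos_geN1 (y - x0) => h1 h2.
  have /andP[w0 w1] : 0 <= (1 - cos (y - x0)) / 2 <= 1 by apply/andP; split; lra.
  by rewrite /u mulr_ge0 ?(ltW c0)//= mulr_ile1 ?(ltW c0).
pose q n y := (1 - u y ^+ n) ^+ (k ^ n).
have kuE y : k%:R * u y = ((1 - cos (y - x0)) / 2) / tau.
  rewrite /u /c; field; rewrite gt_eqF//= ?pnatr_eq0//.
have mu_ : measurable_fun setT u.
  apply: measurable_funM => //; apply: measurable_funM => //.
  apply: measurable_funB => //; apply: (measurableT_comp (f := cos)).
    by apply: continuous_measurable_fun; exact: continuous_cos.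
  exact: measurable_funB.
have mq n : measurable_fun setT (q n).
  by apply: measurable_funX; apply: measurable_funB => //; exact: measurable_funX.
have q01 n y : 0 <= q n y <= 1 by exact: step_poly_ge0.
have mi : measurable_fun setT (arc_indic a x) by apply: measurable_indic.
have fq n : cint (fun y => f y * (q n y)%:C) = 0.
  have [h1 h2] := zero_coef_step x0 c n (k ^ n) f0.
  rewrite -(h2 0); congr cintegral; apply/funext => y.
  by rewrite mul0r expi0 mulr1.
have cvq : \forall y \ae mu, f y = 0 \/ (fun n => q n y) @ \oo --> arc_indic a x y.
  exists [set a; x]; split.
  - by apply: measurableU.
  - apply: countable_lebesgue_measure0; exact/finite_set_countable.
  move=> y /= H; have [->|ya] := eqVneq y a; first by left.
  have [->|yx] := eqVneq y x; first by right.
  exfalso; apply: H.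
  have [yin|yout] := boolP (a <= y < a + 2 * pi); last by left; apply: fs; exact/negP.
  right; case/andP: yin => ay ya2; have {ay}ay : a < y by rewrite lt_def ya.
  have [yx'|yx'] := ltP y x.
    rewrite /arc_indic indicE mem_set/= ?in_itv/= ?ay//.
    apply: step_poly_cvg1 => //; rewrite kuE ltr_pdivrMr// mul1r.
    have : cos d < cos (y - x0) by apply: cos_gt_arc; rewrite ?ay.
    by rewrite /tau => h; rewrite ltr_pM2r// ltrD2l ltrN2.
  have xy : x < y by rewrite lt_def yx.
  rewrite /arc_indic indicE memNset/= ?in_itv/= ?ay/=; last by rewrite ltNge (ltW xy).
  apply: step_poly_cvg0 => //; rewrite kuE ltr_pdivlMr// mul1r.
  have : cos (y - x0) < cos d by apply: cos_lt_arc; rewrite ?xy.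
  by rewrite /tau => h; rewrite ltr_pM2r// ltrD2l ltrN2.
have [[fr fi] _] := f0.
split; apply: (@zero_integral_lim _ q) => //.
- apply: ae_imp cvq => y [->|h]; first by rewrite Re0 mul0r; under eq_fun do rewrite mul0r; exact: cvg_cst.
  by apply: cvgM => //; exact: cvg_cst.
- by move=> n; have := congr1 (@complex.Re R) (fq n); rewrite /cintegral/=; under eq_Rintegral do rewrite !ReImE mulr0 subr0.
- apply: ae_imp cvq => y [->|h]; first by rewrite Im0 mul0r; under eq_fun do rewrite mul0r; exact: cvg_cst.
  by apply: cvgM => //; exact: cvg_cst.
- by move=> n; have := congr1 (@complex.Im R) (fq n); rewrite /cintegral/=; under eq_Rintegral do rewrite !ReImE mulr0 add0r.
Qed.
End Arcs.

Section ArcUniqueness.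
Variable R : realType.
Local Notation mu := (@lebesgue_measure R).
Local Notation cint := (cintegral setT).
Implicit Types f : R -> R[i].

(** By Lebesgue's differentiation theorem g is almost everywhere the derivative of its indefinite
    integral, which vanishes on ]a, b[. *)
Lemma ae_eq0_of_arcs (g : R -> R) (a b : R) : mu.-integrable setT (EFin \o g) ->
  (forall x, a < x < b -> \int[mu]_y (g y * arc_indic a x y) = 0) ->
  \forall x \ae mu, a < x < b -> g x = 0.
Proof.
move=> gi g0.
have := lebesgue_differentiation (open_integrable_locally openT gi).
apply: ae_imp => x lx /andP[ax xb].
have bi : mu.-integrable [set` Interval (BRight a) (BRight b)] (EFin \o g).
  exact: integrableS gi.
have [_ <-] := FTC1_lebesgue_pt xb bi (ax : (BRight a < BRight x)%E) lx.
rewrite derive1E -[RHS](derive_cst (V := R^o) (W := R^o) (0 : R) x 1).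
apply: near_eq_derive.
have : \forall y \near x, y \in `]a, b[.
  by apply: near_in_itvoo; rewrite in_itv/= ax.
apply: filterS => y; rewrite in_itv/= => aby; rewrite -Rintegral_itv_bndo_bndc; last first.
  exact: integrableS gi.
rewrite Rintegral_mkcond -[RHS](g0 y aby); apply: eq_Rintegral => t _.
by rewrite patchE /arc_indic indicE; case: ifPn; rewrite ?mulr1 ?mulr0.
Qed.

Lemma zero_coef_eq0 (a : R) f : (forall y, ~ (a <= y < a + 2 * pi) -> f y = 0) ->
  zero_coef f -> \forall x \ae mu, f x = 0.
Proof.
move=> fs f0; have [[fr fi] _] := f0.
have hr := ae_eq0_of_arcs fr (fun x axb => (zero_coef_arc axb fs f0).1).
have hi := ae_eq0_of_arcs fi (fun x axb => (zero_coef_arc axb fs f0).2).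
have hs : \forall x \ae mu, x != a.
  exists [set a]; split => //; first exact: lebesgue_measure_set1.
  by move=> x /= /negP; rewrite negbK => /eqP.
apply: ae_imp3 hr hi hs => x h1 h2 xa.
have [xin|xout] := boolP (a <= x < a + 2 * pi); last by apply: fs; exact/negP.
have ab : a < x < a + 2 * pi by case/andP: xin => ax ->; rewrite lt_def xa ax.
by apply: complexP; [exact: h1|exact: h2].
Qed.

Lemma integral_of_derivative (f F : R -> R) (a b : R) : a < b -> continuous f ->
  (forall x : R, is_derive x 1 F (f x)) -> \int[mu]_(x in `[a, b]) f x = F b - F a.
Proof.
move=> ab cf dF.
have cF (x : R) : {for x, continuous F}.
  by apply: differentiable_continuous; apply/derivable1_diffP; exact: ex_derive.
rewrite /Rintegral (@continuous_FTC2 _ f F)//.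
- exact: continuous_subspaceT.
- split; first by move=> x _; exact: ex_derive.
    by apply: cvg_at_right_filter; exact: cF.
  by apply: cvg_at_left_filter; exact: cF.
- by move=> x _; rewrite derive1E; exact: derive_val.
Qed.

Definition period_indic (a : R) : R -> R := \1_(`[a, a + 2 * pi[%classic).

Lemma measurable_period_indic a : measurable_fun setT (period_indic a).
Proof. exact: measurable_indic. Qed.

Lemma period_indicE a x : period_indic a x = ((a <= x < a + 2 * pi)%R)%:R.
Proof. by rewrite /period_indic indicE mem_setE in_itv. Qed.

Lemma period_indic_idem a x :
  (period_indic a x)%:C * (period_indic a x)%:C = (period_indic a x)%:C :> R[i].
Proof. by rewrite -rmorphM period_indicE -natrM mulnb andbb. Qed.

Lemma integral_period (a : R) : (\int[mu]_x (period_indic a x)%:E = (2 * pi)%:E)%E.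
Proof.
rewrite /period_indic integral_indic// setIT; etransitivity; first exact: lebesgue_measure_itv.
rewrite /= lte_fin ltrDl mulr_gt0 ?pi_gt0//.
by rewrite -EFinD addrC addKr.
Qed.

Lemma integrable_period (a : R) : mu.-integrable setT (fun x => (period_indic a x)%:E).
Proof.
apply/integrableP; split; first by apply/measurable_EFinP; exact: measurable_period_indic.
under eq_integral => x _ do rewrite gee0_abs ?lee_fin//.
by rewrite integral_period ltry.
Qed.

Lemma cintegrable_period_expi (a c : R) :
  cintegrable (fun x => (period_indic a x)%:C * expi (c * x)).
Proof.
apply: cintegrable_expiM; split; first exact: integrable_period.
exact: integrable0.
Qed.

Lemma cint_period_expi (a : R) (k : int) :
  cint (fun x => (period_indic a x)%:C * expi (k%:~R * x)) = ((2 * pi)%:C *+ (k == 0)).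
Proof.
have red (h : R -> R) : mu.-integrable setT (fun x => (period_indic a x * h x)%:E) ->
    \int[mu]_x (period_indic a x * h x) = \int[mu]_(x in `[a, a + 2 * pi]) h x.
  move=> hi; rewrite -Rintegral_itv_bndo_bndc; last first.
    apply: eq_integrable (integrableS measurableT _ _ hi) => // x.
    by rewrite inE/= in_itv/= => xi /=; rewrite period_indicE xi mul1r.
  rewrite [RHS]Rintegral_mkcond; apply: eq_Rintegral => x _.
  rewrite patchE /period_indic indicE; case: ifPn; rewrite ?mul1r ?mul0r//.
have [ir ii] := cintegrable_period_expi a k%:~R.
have a2 : a < a + 2 * pi by rewrite ltrDl mulr_gt0 ?pi_gt0.
have reE x : complex.Re ((period_indic a x)%:C * expi (k%:~R * x)) = period_indic a x * cos (k%:~R * x).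
  by rewrite !ReImE /expi/= mul0r subr0.
have imE x : complex.Im ((period_indic a x)%:C * expi (k%:~R * x)) = period_indic a x * sin (k%:~R * x).
  by rewrite !ReImE /expi/= mul0r addr0.
have cc (c : R) : continuous (fun x : R => cos (c * x)).
  by move=> x; apply: continuous_comp; [exact: mulrl_continuous|exact: continuous_cos].
have cs (c : R) : continuous (fun x : R => sin (c * x)).
  by move=> x; apply: continuous_comp; [exact: mulrl_continuous|exact: continuous_sin].
have kper : expi (k%:~R * (a + 2 * pi)) = expi (k%:~R * a) :> R[i].
  by rewrite mulrDr expiD mulrCA mulrA expi_2piz mulr1.
have [k0|k0] := eqVneq k 0.
  have e x : period_indic a x = complex.Re ((period_indic a x)%:C * expi (k%:~R * x)).
    by rewrite reE k0 mul0r cos0 mulr1.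
  rewrite mulr1n; apply: complexP; rewrite /cintegral/=.
    under eq_Rintegral do rewrite -[X in X - _]/(_ * cos _) mul0r subr0 k0 mul0r cos0 mulr1.
    by rewrite /Rintegral integral_period.
  by rewrite /Rintegral integral0_eq// => x _; rewrite mul0r addr0 k0 mul0r sin0 mulr0.
have k0' : k%:~R != 0 :> R by rewrite intr_eq0.
rewrite mulr0n; apply: complexP; rewrite /cintegral/=.
  under eq_Rintegral do rewrite mul0r subr0.
  rewrite red; last by apply: eq_integrable ir => // x _; rewrite reE.
  have dF (x : R) : is_derive x 1 (fun x => k%:~R^-1 * sin (k%:~R * x)) (cos (k%:~R * x)).
    by apply: is_derive_eq; rewrite /GRing.scale/= mulr1; field.
  rewrite (integral_of_derivative a2 (cc _) dF).
  by move/(congr1 (@complex.Im R)): kper => /= ->; rewrite subrr.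
under eq_Rintegral do rewrite mul0r addr0.
rewrite red; last by apply: eq_integrable ii => // x _; rewrite imE.
have dF (x : R) : is_derive x 1 (fun x => - k%:~R^-1 * cos (k%:~R * x)) (sin (k%:~R * x)).
  by apply: is_derive_eq; rewrite /GRing.scale/= mulr1; field.
rewrite (integral_of_derivative a2 (cs _) dF).
by move/(congr1 (@complex.Re R)): kper => /= ->; rewrite subrr.
Qed.
End ArcUniqueness.

(** The enumeration 0, -1, 1, -2, 2, ..., by which sums over the integers become series. *)
Definition zenum (n : nat) : int := if odd n then Negz n./2 else Posz n./2.
Definition zrank (k : int) : nat := match k with Posz n => n.*2 | Negz n => n.*2.+1 end.

Lemma zenumK : cancel zenum zrank.
Proof.
move=> n; rewrite /zenum; case: ifP => /= on.
  by rewrite -[RHS](odd_double_half n) on add1n.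
by rewrite -[RHS](odd_double_half n) on add0n.
Qed.

Lemma zrankK : cancel zrank zenum.
Proof.
case=> n; rewrite /zenum /=; first by rewrite odd_double doubleK.
by rewrite odd_double/= uphalf_double.
Qed.

(** * Expansions along an orthonormal sequence *)

Section HilbertExpansion.
Variables (R : realType) (V : lmodType R[i]) (dot : V -> V -> R[i]) (e : nat -> V).
Hypotheses (dotP : inner_product dot) (eP : forall k l, dot (e k) (e l) = (k == l)%:R).

Lemma hcvg_unique (u : nat -> V) x y : hcvg dot u x -> hcvg dot u y -> x = y.
Proof.
move=> ux uy; apply/eqP; rewrite -subr_eq0; apply/eqP; apply: (inorm0_eq0 dotP).
apply/eqP; rewrite eq_le inorm_ge0 andbT; apply/ler_addgt0Pl => d d0; rewrite addr0.
have d2 : 0 < d / 2 by rewrite divr_gt0.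
have [m hm] := ux _ d2; have [n hn] := uy _ d2.
apply: le_trans (le_inorm_dist dotP _ (u (maxn m n)) _) _; rewrite [d]splitr.
apply: lerD; apply/ltW; first by rewrite (inormBC dotP) hm// leq_maxl.
by rewrite hn// leq_maxr.
Qed.

Lemma dot_fourier_sum K x j : (j < K)%N -> dot (fourier_sum dot e K x) (e j) = dot x (e j).
Proof. by move=> jK; rewrite (dot_comb dotP eP _ (Ordinal jK)). Qed.

(** The squared distance of two partial sums is a difference of partial sums of the series of |<x,
    e_j>|^2, which Bessel's inequality bounds. *)
Lemma hcauchy_fourier_sum x : hcauchy dot (fun K => fourier_sum dot e K x).
Proof.
pose s K := \sum_(j < K) normc (dot x (e j)) ^+ 2.
have snd : {homo s : m n / (m <= n)%N >-> m <= n}.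
  move=> m n mn; rewrite /s -!(big_mkord xpredT (fun j => normc (dot x (e j)) ^+ 2)).
  rewrite [leRHS](big_cat_nat _ mn)//= lerDl.
  by apply: sumr_ge0 => j _; exact: sqr_ge0.
have scv : cvgn s.
  apply: nondecreasing_is_cvgn => //; exists (inorm dot x ^+ 2) => _ [n _ <-].
  exact: (bessel dotP eP).
have dist m n : (m <= n)%N ->
    inorm dot (fourier_sum dot e n x - fourier_sum dot e m x) ^+ 2 = s n - s m.
  move=> mn; have -> : fourier_sum dot e m x = fourier_sum dot e m (fourier_sum dot e n x).
    by apply: eq_bigr => j _; rewrite dot_fourier_sum// (leq_trans _ mn).
  rewrite (sqr_inorm_sub_fourier_sum dotP eP) (sqr_inorm_fourier_sum dotP eP); congr (_ - _).
  by apply: eq_bigr => j _; rewrite dot_fourier_sum// (leq_trans _ mn).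
move=> d d0; have d2 : 0 < d ^+ 2 by rewrite exprn_gt0.
have [N _ hN] := (cvgrPdist_lt _ _).1 scv _ d2.
have lim_ge n : s n <= limn s.
  by apply: nondecreasing_cvgn_le.
have close m n : (N <= m)%N -> (m <= n)%N ->
    inorm dot (fourier_sum dot e n x - fourier_sum dot e m x) < d.
  move=> Nm mn; rewrite -(@ltr_pXn2r _ 2)// ?nnegrE ?inorm_ge0 ?(ltW d0)// dist//.
  have := hN m Nm; rewrite /= ger0_norm ?subr_ge0//; have := lim_ge n; lra.
exists N => m n Nm Nn; case: (leqP m n) => [mn|/ltnW nm]; last exact: close.
by rewrite (inormBC dotP); exact: close.
Qed.

Lemma hcvg_dot (u : nat -> V) l y c : hcvg dot u l ->
  (exists N, forall n, (N <= n)%N -> dot (u n) y = c) -> dot l y = c.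
Proof.
move=> ul [N hN]; apply/eqP; rewrite -subr_eq0 -normr_eq0 normrcE -(rmorph0 (real_complex R)).
rewrite (inj_eq (@complexI R)) eq_le normc_ge0 andbT; apply/ler_addgt0Pl => d d0; rewrite addr0.
have y1 : 0 < inorm dot y + 1 by rewrite ltr_wpDl ?inorm_ge0.
have [M hM] := ul _ (divr_gt0 d0 y1); have hm := hM (maxn M N) (leq_maxl _ _).
rewrite -(hN (maxn M N)) ?leq_maxr// -(idotBl dotP).
apply: le_trans (cauchy_schwarz dotP _ _) _; rewrite (inormBC dotP).
apply: (@le_trans _ _ (d / (inorm dot y + 1) * (inorm dot y + 1))).
  by rewrite ler_pM ?inorm_ge0 ?(ltW hm)// lerDl.
by rewrite divfK// gt_eqF.
Qed.

Lemma parseval_of_hcvg x : hcvg dot (fun K => fourier_sum dot e K x) x ->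
  (\sum_(0 <= j <oo) (normc (dot x (e j)) ^+ 2)%:E = (inorm dot x ^+ 2)%:E)%E.
Proof.
move=> cx; apply/cvg_lim => //.
have -> : (fun n => \sum_(0 <= j < n) (normc (dot x (e j)) ^+ 2)%:E)%E =
    EFin \o (fun n => inorm dot x ^+ 2 - inorm dot (x - fourier_sum dot e n x) ^+ 2).
  apply/funext => n /=; rewrite (sqr_inorm_sub_fourier_sum dotP eP) opprB addrC subrK.
  by rewrite big_mkord sumEFin.
apply: cvg_EFin; first exact: nearW.
rewrite -[X in _ --> X]subr0; apply: cvgB; first exact: cvg_cst.
have cv : (fun n => inorm dot (x - fourier_sum dot e n x)) @ \oo --> (0 : R).
  apply/cvgrPdist_lt => d d0; have [N hN] := cx d d0; exists N => // n Nn.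
  by rewrite /= sub0r normrN ger0_norm ?inorm_ge0// (inormBC dotP) hN.
by have h := cvgM cv cv; rewrite mulr0 in h; exact: h.
Qed.
End HilbertExpansion.

(** * Parseval's identity on a period *)

Section Parseval.
Variable R : realType.
Local Notation mu := (@lebesgue_measure R).
Local Notation cint := (cintegral setT).
Implicit Types f : R -> R[i].

Definition supported (a : R) f := forall x, ~ (a <= x < a + 2 * pi) -> f x = 0.

Lemma supported_mul_indic a f x : supported a f -> f x * (period_indic a x)%:C = f x.
Proof.
move=> fs; rewrite period_indicE; case: (boolP (a <= x < a + 2 * pi)) => xin.
  by rewrite mulr1.
by rewrite fs ?mul0r//; exact/negP.
Qed.

Definition trig (a : R) (j : nat) (x : R) : R[i] :=
  ((Num.sqrt (2 * pi))^-1)%:C * ((period_indic a x)%:C * expi ((zenum j)%:~R * x)).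

Lemma sqrt2pi_gt0 : 0 < Num.sqrt (2 * pi) :> R.
Proof. by rewrite sqrtr_gt0 mulr_gt0 ?pi_gt0. Qed.

Lemma cLfun2_period_expi a (h : R -> R) : measurable_fun setT h ->
  (fun x => (period_indic a x)%:C * expi (h x) : R[i]) \in cLfun 2%:E.
Proof.
move=> mh; apply/cLfun2P; split.
  apply: cmeasurableM; last exact: cmeasurable_expi.
  by apply: cmeasurableC; exact: measurable_period_indic.
rewrite /sqnorm; under eq_integral => x _.
  rewrite normcM normc_expi mulr1 normcC period_indicE normr_nat -natrX -mulnn mulnb andbb -period_indicE.
  over.
by rewrite integral_period ltry.
Qed.

Lemma cLfun2_trig a j : trig a j \in cLfun 2%:E.
Proof. by apply: cLfun2Z; apply: cLfun2_period_expi; exact: measurable_funM. Qed.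

Lemma trig_orthonormal a k l : L2dot (mkL2 (trig a k)) (mkL2 (trig a l)) = (k == l)%:R.
Proof.
rewrite L2dot_mkL2 ?cLfun2_trig//.
have -> : (fun x => trig a k x * (trig a l x)^*) = (fun x => ((2 * pi)^-1)%:C *
    ((period_indic a x)%:C * expi ((zenum k - zenum l)%:~R * x))).
  apply/funext => x; rewrite /trig conjCE !conjcM !conjc_real expiJ intrB mulrBl expiD.
  have -> : ((2 * pi)^-1)%:C = ((Num.sqrt (2 * pi))^-1)%:C * ((Num.sqrt (2 * pi))^-1)%:C :> R[i].
    by rewrite -rmorphM -invfM -expr2 sqr_sqrtr// mulr_ge0 ?pi_ge0.
  by rewrite -[in RHS]period_indic_idem; ring.
rewrite cintZ; last exact: cintegrable_period_expi.
rewrite cint_period_expi subr_eq0 (inj_eq (can_inj zenumK)).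
case: eqP => _; rewrite ?mulr0//= mulr1n -rmorphM mulVf// gt_eqF// mulr_gt0 ?pi_gt0//.
Qed.

Lemma dot_trig a f j : f \in cLfun 2%:E -> supported a f ->
  L2dot (mkL2 f) (mkL2 (trig a j)) =
  ((Num.sqrt (2 * pi))^-1)%:C * cint (fun x => f x * expi (- ((zenum j)%:~R * x))).
Proof.
move=> fL fs; have fe x := supported_mul_indic x fs.
have fe' : (fun x => f x * expi (- ((zenum j)%:~R * x))) =
    (fun x => f x * ((period_indic a x)%:C * expi (- ((zenum j)%:~R * x)))).
  by apply/funext => x; rewrite mulrA fe.
rewrite L2dot_mkL2 ?cLfun2_trig// fe' -cintZ; last first.
  apply: cLfun2_mul => //; apply: cLfun2_period_expi.
  by apply: measurableT_comp => //; exact: measurable_funM.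
congr cintegral; apply/funext => x; rewrite /trig conjCE !conjcM !conjc_real expiJ mulrCA.
by [].
Qed.

Lemma period_cut a (g : L2 R) :
  (fun x => (period_indic a x)%:C * g x) \in cLfun 2%:E.
Proof.
apply: (@cLfun2_bounded _ _ _ 1); first exact: L2_fun.
  by apply: cmeasurableC; exact: measurable_period_indic.
by apply: aeW => x; rewrite normcC period_indicE; case: (_ <= _ < _); rewrite ?normr1 ?normr0.
Qed.

(** The partial sums have some limit l with the same coefficients as f. To apply the uniqueness
    theorem to f - l, the limit has to be supported by the period too. *)
Lemma trig_complete a f : f \in cLfun 2%:E -> supported a f ->
  hcvg (@L2dot R) (fun K => fourier_sum (@L2dot R) (fun j => mkL2 (trig a j)) K (mkL2 f)) (mkL2 f).
Proof.
move=> fL fs; have IP := L2dot_inner R; have eP := trig_orthonormal a.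
pose e j := mkL2 (trig a j).
have [l0 hl0] := L2_complete (hcauchy_fourier_sum IP eP (mkL2 f)); pose l : L2 R := l0.
have hl : hcvg (@L2dot R) (fun K => fourier_sum (@L2dot R) e K (mkL2 f)) l := hl0.
have le j : L2dot l (e j) = L2dot (mkL2 f) (e j).
  apply: (hcvg_dot IP hl); exists j.+1 => n jn.
  exact: (dot_fourier_sum IP eP).
suff lf : l = mkL2 f by rewrite -[X in hcvg _ _ X]lf; exact: hl.
pose lc x := (period_indic a x)%:C * l x.
have lcL : lc \in cLfun 2%:E by exact: period_cut.
have lcs : supported a lc by move=> x; rewrite /lc period_indicE; case: (_ <= _ < _) => //; rewrite mul0r.
(* The partial sums are supported by the period, so cutting l down to it does not increase its
   distance to them; the cut function is a limit as well. *)
have lE : mkL2 lc = l.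
  apply: (hcvg_unique IP _ hl) => d d0; have [N hN] := hl d d0; exists N => n Nn.
  apply: le_lt_trans (hN n Nn).
  set S : L2 R := fourier_sum _ _ _ _.
  have SE : \forall x \ae mu, S x = (period_indic a x)%:C * S x.
    have h1 := L2_sumE (index_enum _) (fun j : 'I_n => L2dot (mkL2 f) (e j) *: e j).
    have h2 : \forall x \ae mu, forall j : 'I_n, (L2dot (mkL2 f) (e j) *: e j : L2 R) x =
        L2dot (mkL2 f) (e j) * trig a j x.
      apply: ae_forall => j; apply: ae_imp2 (L2ZE (L2dot (mkL2 f) (e j)) (e j)) (mkL2E (cLfun2_trig a j)) => x -> ->.
      by [].
    apply: ae_imp2 h1 h2 => x -> h2; rewrite mulr_sumr; apply: eq_bigr => j _.
    by rewrite h2 /trig -[in LHS]period_indic_idem; ring.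
  rewrite -(@ler_pXn2r _ 2)// ?nnegrE ?inorm_ge0// -lee_fin.
  rewrite -!sqnorm_L2; apply: ae_le_sqnorm; try exact: L2_cmeasurable.
  apply: ae_imp3 (L2BE S (mkL2 lc)) (L2BE S l) _; last first.
    by apply: ae_imp2 SE (mkL2E lcL) => x h1 h2; exact: (conj h1 h2).
  move=> x -> -> [h1 ->]; rewrite {1}h1 /lc -mulrBr normcM normcC ler_piMl ?normc_ge0//.
  by rewrite period_indicE; case: (_ <= _ < _); rewrite ?normr1 ?normr0.
rewrite -lE; apply/esym; pose g x := f x - lc x.
have gL : g \in cLfun 2%:E by exact: cLfun2B.
have gs : supported a g by move=> x xo; rewrite /g fs// lcs// subr0.
(* g equals its product with the indicator of the period, written here with the factor [expi 0] = 1;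
   a product of two functions of L^2 is integrable. *)
have gi : cintegrable g.
  have := cLfun2_mul gL (cLfun2_period_expi a (@measurable_cst _ _ _ _ _ (0 : R))).
  congr cintegrable; apply/funext => x; by rewrite expi0 mulr1 supported_mul_indic.
have gE : mkL2 g = mkL2 f - l by rewrite /g mkL2B// lE.
have g0 : \forall x \ae mu, g x = 0.
  apply: (zero_coef_eq0 gs); split => // k.
  have := dot_trig (zrank (- k)) gL gs; rewrite gE (idotBl IP) le subrr zrankK.
  move=> /esym/eqP; rewrite mulf_eq0 => /orP[|/eqP].
    by rewrite -(rmorph0 (real_complex R)) (inj_eq (@complexI R)) invr_eq0 (gt_eqF sqrt2pi_gt0).
  by move=> h; rewrite -[RHS]h; congr cintegral; apply/funext => x; rewrite intrN mulNr opprK.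
by apply: mkL2_eq => //; apply: ae_imp g0 => x /eqP; rewrite subr_eq0 => /eqP.
Qed.

Lemma parseval_period a f : f \in cLfun 2%:E -> supported a f ->
  (\sum_(0 <= j <oo) (normc (cint (fun x => f x * expi (- ((zenum j)%:~R * x)))) ^+ 2)%:E
   = (2 * pi)%:E * sqnorm f)%E.
Proof.
move=> fL fs.
have := parseval_of_hcvg (L2dot_inner R) (trig_orthonormal a) (trig_complete fL fs).
rewrite L2norm_mkL2// => <-.
have pi2 : 0 <= 2 * pi :> R by rewrite mulr_ge0 ?pi_ge0.
rewrite -nneseriesZl; last by move=> j _; rewrite lee_fin sqr_ge0.
apply: eq_eseriesr => j _; rewrite dot_trig// normcM exprMn normcC real_normK ?num_real// -EFinM exprVn.
have e (t : R) : t = 2 * pi * (Num.sqrt (2 * pi) ^- 2 * t).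
  by rewrite sqr_sqrtr// mulrA divff ?mul1r// gt_eqF// mulr_gt0 ?pi_gt0.
by rewrite -e.
Qed.
End Parseval.

(** * The Fourier transform *)

Section Periodization.
Variable R : realType.
Local Notation mu := (@lebesgue_measure R).
Local Open Scope ereal_scope.

Let cell (a T : R) (j : nat) : set R :=
  `[(a + T * (zenum j)%:~R)%R, (a + T * (zenum j)%:~R + T)%R[%classic.

Lemma cover_cells (a T : R) : (0 < T)%R -> \bigcup_j cell a T j = setT.
Proof.
move=> T0; apply/seteqP; split => // x _.
exists (zrank (Num.floor ((x - a) / T))) => //; rewrite /cell/= zrankK in_itv/=.
have := floor_le_tmp ((x - a) / T); have := floorD1_gt ((x - a) / T).
rewrite intrD; set k := _%:~R; rewrite ltr_pdivrMr// ler_pdivlMr//.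
by move=> h1 h2; apply/andP; split; nra.
Qed.

Lemma trivIset_cells (a T : R) : (0 < T)%R -> trivIset setT (cell a T).
Proof.
move=> T0; apply/trivIsetP => i j _ _ ij; apply/seteqP; split => // x []; rewrite /cell /= !in_itv/= => /andP[h1 h2] /andP[h3 h4].
have ab : (T * (zenum i)%:~R < T * ((zenum j)%:~R + 1) :> R)%R by lra.
have ba : (T * (zenum j)%:~R < T * ((zenum i)%:~R + 1) :> R)%R by lra.
rewrite !ltr_pM2l// -!(intrD _ _ 1) !ltr_int in ab ba.
have /(can_inj zenumK) e : zenum i = zenum j by lia.
by rewrite e eqxx in ij.
Qed.

(** The line is cut into the translates of [a, a + T[, and each piece is moved back onto [a, a +
    T[. *)
Lemma periodization (g : R -> \bar R) (a T : R) : (0 < T)%R ->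
  measurable_fun setT g -> (forall x, 0 <= g x) ->
  \int[mu]_x g x =
  \int[mu]_(x in `[a, (a + T)%R[) (\sum_(0 <= j <oo) g (x + T * (zenum j)%:~R)%R).
Proof.
move=> T0 mg g0; rewrite -(cover_cells a T0).
rewrite ge0_integral_bigcup//; first last.
- exact: trivIset_cells.
- by rewrite cover_cells.
- by move=> k; exact: measurable_itv.
have mg' (b : R) : measurable_fun setT (fun x : R => g (x + b)%R).
  by apply: (measurableT_comp mg); exact: measurable_funD.
rewrite integral_nneseries//; last by move=> n; apply: measurable_funTS; exact: mg'.
apply: eq_eseriesr => j _; rewrite [RHS]integral_mkcond [LHS]integral_mkcond.
transitivity (\int[mu]_x (g \_ (cell a T j)) (1 * x + T * (zenum j)%:~R)%R).
  rewrite (@ge0_integral_affine _ (g \_ (cell a T j))) ?invr1 ?mul1e//.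
  - apply/(measurable_restrictT _ _).1; first exact: measurable_itv.
    exact: measurable_funTS.
  - by move=> x; rewrite patchE; case: ifPn.
apply: eq_integral => x _; rewrite !patchE mul1r; congr (if _ then _ else _).
apply/idP/idP; rewrite !inE /cell/= !in_itv/= => /andP[h1 h2]; apply/andP; split; lra.
Qed.
End Periodization.

(** * Fourier integrals of functions with bounded support *)

Section FourierIntegral.
Variable R : realType.
Local Notation mu := (@lebesgue_measure R).
Local Notation cint := (cintegral setT).
Implicit Types f h : R -> R[i].

(** Tonelli's theorem applies to the positive and negative parts, so the sections of F may fail to
    be integrable. *)
Lemma measurable_Rintegral_param (F : R * R -> R) : measurable_fun setT F ->
  measurable_fun setT (fun xi => \int[mu]_x F (xi, x)).
Proof.
move=> mF; rewrite /Rintegral.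
apply: (measurableT_comp (fine_measurable measurableT)).
have mE : measurable_fun setT (EFin \o F) by exact/measurable_EFinP.
have -> : (fun xi => \int[mu]_x (F (xi, x))%:E)%E =
    (fun xi => \int[mu]_x ((EFin \o F)^\+ (xi, x)) - \int[mu]_x ((EFin \o F)^\- (xi, x)))%E.
  apply/funext => xi; rewrite integralE.
  by f_equal; [|f_equal]; apply: eq_integral => x _; rewrite ?funeposE ?funenegE.
apply: emeasurable_funB.
  by apply: (@measurable_fun_fubini_tonelli_F _ _ _ _ _ mu) => //; exact: measurable_funepos.
by apply: (@measurable_fun_fubini_tonelli_F _ _ _ _ _ mu) => //; exact: measurable_funeneg.
Qed.

Lemma cmeasurable_param (F : R * R -> R[i]) : cmeasurable F ->
  cmeasurable (fun xi => cint (fun x => F (xi, x))).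
Proof.
move=> [mr mi]; split => /=.
  exact: (@measurable_Rintegral_param (fun p => complex.Re (F p)) mr).
exact: (@measurable_Rintegral_param (fun p => complex.Im (F p)) mi).
Qed.

Definition ft f (xi : R) : R[i] := cint (fun x => f x * expi (- (xi * x))).

Lemma cmeasurable_ftkernel f : cmeasurable f ->
  cmeasurable (fun p : R * R => f p.2 * expi (- (p.1 * p.2))).
Proof.
move=> mf; apply: cmeasurableM; first exact: (cmeasurable_comp mf).
by apply: cmeasurable_expi; apply: measurableT_comp => //; exact: measurable_funM.
Qed.

Lemma cmeasurable_ft f : cmeasurable f -> cmeasurable (ft f).
Proof. by move=> mf; exact: (cmeasurable_param (cmeasurable_ftkernel mf)). Qed.

Lemma cintegrable_ft f (xi : R) : cintegrable f ->
  cintegrable (fun x => f x * expi (- (xi * x))).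
Proof. by move=> /(cintegrable_expiM (- xi)); under eq_fun do rewrite mulNr. Qed.

Lemma ft_lin (a : R[i]) f h xi : cintegrable f -> cintegrable h ->
  ft (fun x => a * f x + h x) xi = a * ft f xi + ft h xi.
Proof.
move=> fi hi; rewrite /ft -cintZ; last exact: cintegrable_ft.
rewrite -cintD; [|by apply: cintegrableZ; exact: cintegrable_ft|exact: cintegrable_ft].
by congr cintegral; apply/funext => x; rewrite mulrDl mulrA.
Qed.

(* Parseval's identity for e^{-itx} h, integrated over t in [0, 1). *)
Lemma plancherel_period a h : h \in cLfun 2%:E -> supported a h ->
  sqnorm (ft h) = ((2 * pi)%:E * sqnorm h)%E.
Proof.
move=> hL hs; case/cLfun2P: (hL) => mh _.
rewrite /sqnorm (@periodization _ _ 0 1)//; first last.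
- by move=> x; rewrite lee_fin sqr_ge0.
- by apply: measurable_sqnorm; exact: cmeasurable_ft.
transitivity (\int[mu]_(t in `[0%R, (0 + 1)%R[) ((2 * pi)%:E * sqnorm h))%E; last first.
  rewrite integral_cst//=; rewrite [X in (_ * X)%E](_ : _ = 1%E) ?mule1//.
  by etransitivity; [exact: lebesgue_measure_itv|rewrite /= lte_fin add0r ltr01 sube0].
apply: eq_integral => t _.
have hLt : (fun x => expi (- (t * x)) * h x) \in cLfun 2%:E.
  apply: (@cLfun2_bounded _ _ _ 1) => //.
    by apply: cmeasurable_expi; apply: measurableT_comp => //; exact: measurable_funM.
  by apply: aeW => x; rewrite normc_expi.
have hst : supported a (fun x => expi (- (t * x)) * h x).
  by move=> x xo; rewrite hs ?mulr0.
rewrite [in RHS](_ : sqnorm h = sqnorm (fun x => expi (- (t * x)) * h x)); last first.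
  by apply: eq_integral => x _; rewrite normcM normc_expi mul1r.
rewrite -(parseval_period hLt hst); apply: eq_eseriesr => j _.
congr (_ ^+ 2)%:E; congr normc; congr cintegral; apply/funext => x.
rewrite [in RHS](mulrC (expi _)) -mulrA -expiD mul1r; congr (_ * expi _); ring.
Qed.

Lemma ft_scale (L : R) f xi : 0 < L -> cintegrable f ->
  ft (fun x => f (L * x)) (L * xi) = (L^-1)%:C * ft f xi.
Proof.
move=> L0 fi; rewrite /ft -(cint_affine 0 L0 (cintegrable_ft xi fi)).2.
congr cintegral; apply/funext => x; rewrite addr0; congr (_ * expi _); ring.
Qed.

Lemma bounded_support_cintegrable (A : R) f : f \in cLfun 2%:E ->
  (forall x, A < `|x| -> f x = 0) -> cintegrable f.
Proof.
move=> fL fA; pose D : set R := `[- A, A]%classic.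
have iL : (fun x => (\1_D x)%:C : R[i]) \in cLfun 2%:E.
  apply/cLfun2P; split; first by apply: cmeasurable_indic; exact: measurable_itv.
  rewrite /sqnorm; under eq_integral => x _.
    rewrite normcC indicE normr_nat -natrX -mulnn mulnb andbb -indicE; over.
  rewrite integral_indic//; last exact: measurable_itv.
  rewrite setIT; apply: le_lt_trans (ltry (`|A| + `|A|)).
  rewrite [leLHS](_ : _ = mu D)// lebesgue_measure_itv/=; case: ifP => _.
    by rewrite -EFinD lee_fin opprK lerD// ler_norm.
  by rewrite lee_fin addr_ge0.
have := cLfun2_mul fL iL; congr cintegrable; apply/funext => x.
rewrite indicE; have [xD|xD] := boolP (x \in D); first by rewrite mulr1.
rewrite mulr0 fA// ltNge; apply: contra xD => xA; rewrite inE /D/= in_itv/=.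
by rewrite -ler_norml.
Qed.

(** Dilation by L = |A| + 1 moves the support into [-1, 1], which is inside the period that starts
    at -1; the powers of L cancel. *)
Lemma plancherel_bounded (A : R) f : f \in cLfun 2%:E ->
  (forall x, A < `|x| -> f x = 0) -> sqnorm (ft f) = ((2 * pi)%:E * sqnorm f)%E.
Proof.
move=> fL fA; pose L := `|A| + 1; have L0 : 0 < L by rewrite ltr_wpDl.
have fi := bounded_support_cintegrable fL fA.
pose h x := f (L * x).
have hL : h \in cLfun 2%:E.
  by have := cLfun2_affine 0 L0 fL; under eq_fun do rewrite addr0.
have hs : supported (-1) h.
  move=> x xo; apply: fA; rewrite normrM (gtr0_norm L0); apply: le_lt_trans (ler_norm A) _.
  rewrite -[X in X < _]addr0; have x1 : 1 <= `|x|.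
    rewrite leNgt; apply/negP; rewrite ltr_norml => /andP[x1 x2]; apply: xo.
    by have := pi_ge2 R => pi2; apply/andP; split; lra.
  apply: (@lt_le_trans _ _ L); first by rewrite addr0 ltrDl.
  by rewrite ler_peMr ?(ltW L0).
have ftE xi : ft f xi = L%:C * ft h (L * xi).
  rewrite ft_scale// mulrA -rmorphM divff ?mul1r// gt_eqF//.
have mh := (cLfun2P h).1 hL; have mf := (cLfun2P f).1 fL.
have -> : sqnorm (ft f) = sqnorm (fun xi => L%:C * ft h (L * xi + 0)).
  by apply: eq_integral => xi _; rewrite ftE addr0.
have mft : cmeasurable (ft h) by apply: cmeasurable_ft; case: mh.
rewrite sqnormZ; last first.
  by apply: cmeasurable_comp => //; apply: measurable_funD => //; exact: measurable_funM.
rewrite sqnorm_affine// (plancherel_period hL hs).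
have -> : sqnorm h = (L^-1%:E * sqnorm f)%E.
  rewrite -(sqnorm_affine 0 L0); last by case: mf.
  by apply: eq_integral => x _; rewrite addr0.
rewrite normcC gtr0_norm//.
have fin : sqnorm f \is a fin_num by rewrite ge0_fin_numE ?sqnorm_ge0; case: mf.
rewrite -(fineK fin) -!EFinM; congr EFin; field; exact: lt0r_neq0.
Qed.
End FourierIntegral.

Section Cutoff.
Variable R : realType.
Local Notation mu := (@lebesgue_measure R).
Implicit Types f : R -> R[i].

Definition cutoff (A : set R) f (x : R) : R[i] := (\1_A x)%:C * f x.

Lemma cutoffE A f x : cutoff A f x = if x \in A then f x else 0.
Proof. by rewrite /cutoff indicE; case: (x \in A); rewrite ?mul1r ?mul0r. Qed.

Lemma normc_cutoff_le A f x : normc (cutoff A f x) <= normc (f x).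
Proof. by rewrite cutoffE; case: ifP => // _; rewrite normc0 normc_ge0. Qed.

Lemma cmeasurable_cutoff A f : measurable A -> cmeasurable f -> cmeasurable (cutoff A f).
Proof. by move=> mA mf; apply: cmeasurableM => //; exact: cmeasurable_indic. Qed.

Lemma cLfun2_cutoff A f : measurable A -> f \in cLfun 2%:E -> cutoff A f \in cLfun 2%:E.
Proof.
move=> mA fL; case/cLfun2P: (fL) => mf _.
apply: cLfun2_le fL _; first exact: cmeasurable_cutoff.
by apply: aeW => x; exact: normc_cutoff_le.
Qed.

Lemma dominated_vanish (F : nat -> R -> \bar R) (G : R -> \bar R) :
  (forall n, measurable_fun setT (F n)) -> mu.-integrable setT G ->
  (forall n x, (0 <= F n x <= G x)%E) ->
  (\forall x \ae mu, (fun n => F n x) @ \oo --> 0%E) ->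
  forall e : R, 0 < e -> exists N, forall n, (N <= n)%N -> (\int[mu]_x F n x < e%:E)%E.
Proof.
move=> mF Gi FG F0 e e0.
have Fpos n x : (0 <= F n x)%E by have /andP[] := FG n x.
have [| | | | | _ _ h] := @dominated_convergence _ _ _ mu setT measurableT F (cst 0%E) G.
- exact: mF.
- exact: measurable_cst.
- by apply: ae_imp F0 => x ? _.
- exact: Gi.
- by apply: aeW => x n _; rewrite gee0_abs//; have /andP[] := FG n x.
rewrite integral0_eq// in h.
have {h}[[M _ hM] /cvgrPdist_lt/(_ e e0)[N _ hN]] :=
  (fine_cvgP (fun n => \int[mu]_x F n x)%E 0).1 h.
exists (maxn M N) => n; rewrite geq_max => /andP[Mn Nn].
rewrite -(fineK (hM n Mn)) lte_fin; have := hN n Nn.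
by rewrite /= sub0r normrN ger0_norm// fine_ge0// integral_ge0.
Qed.

Lemma cutoff_cvg (A : nat -> set R) (f : L2 R) : (forall n, measurable (A n)) ->
  (\forall x \ae mu, exists N, forall n, (N <= n)%N -> A n x) ->
  hcvg (@L2dot R) (fun n => mkL2 (cutoff (A n) f)) f.
Proof.
move=> mA hA; have fL := L2_fun f; have mf := L2_cmeasurable f.
pose F n x := (normc (f x - cutoff (A n) f x) ^+ 2)%:E.
have mF n : measurable_fun setT (F n).
  apply: (@measurable_sqnorm _ (fun x => f x - cutoff (A n) f x)).
  by apply: cmeasurableB => //; exact: cmeasurable_cutoff.
have Fle n x : (`|F n x| <= (normc (f x) ^+ 2)%:E)%E.
  rewrite gee0_abs ?lee_fin ?sqr_ge0// lerXn2r ?nnegrE ?normc_ge0// cutoffE.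
  by case: ifP => _; rewrite ?subrr ?normc0 ?normc_ge0// subr0.
have fi : mu.-integrable setT (fun x => (normc (f x) ^+ 2)%:E).
  apply/integrableP; split; first exact: measurable_sqnorm.
  apply: le_lt_trans (L2_sqnorm_lty f); rewrite /sqnorm; under eq_integral => x _.
    rewrite gee0_abs ?lee_fin ?sqr_ge0//; over.
  by [].
move=> e e0; have e2 : 0 < e ^+ 2 by rewrite exprn_gt0.
have [||N hN] := dominated_vanish mF fi _ _ e2.
- by move=> n x; apply/andP; split; [rewrite lee_fin sqr_ge0|apply: le_trans (Fle n x); exact: lee_abs].
- apply: ae_imp hA => x [N hN]; apply: cvg_near_cst; exists N => // n /= Nn.
  by rewrite /F cutoffE mem_set; [rewrite subrr normc0 expr0n|exact: hN].
exists N => n Nn.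

rewrite (inormBC (L2dot_inner R)) -(@ltr_pXn2r _ 2)// ?nnegrE ?inorm_ge0 ?(ltW e0)//.
rewrite -lte_fin L2norm_mkL2B; first exact: hN.
exact: cLfun2_cutoff.
Qed.
End Cutoff.

Section HilbertLimits.
Variables (R : realType) (V : lmodType R[i]) (dot : V -> V -> R[i]).
Hypothesis dotP : inner_product dot.

Lemma hcvg_lin (a : R[i]) (u v : nat -> V) x y : hcvg dot u x -> hcvg dot v y ->
  hcvg dot (fun n => a *: u n + v n) (a *: x + y).
Proof.
move=> ux vy e e0; pose c := normc a + 1.
have c0 : 0 < c by rewrite ltr_wpDl ?normc_ge0.
have [N hN] := ux _ (divr_gt0 (divr_gt0 e0 (ltr0n R 2)) c0).
have [M hM] := vy _ (divr_gt0 e0 (ltr0n R 2)).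
exists (maxn N M) => n; rewrite geq_max => /andP[Nn Mn].
rewrite opprD addrACA -scalerBr [e]splitr.
apply: le_lt_trans (le_inormD dotP _ _) _; apply: ler_ltD; last exact: hM.
rewrite (inormZ dotP); apply: (@le_trans _ _ (c * inorm dot (u n - x))).
  by rewrite ler_wpM2r ?inorm_ge0// lerDl.
by rewrite mulrC -ler_pdivlMr// ltW// hN.
Qed.

Lemma hcvg_sub (u : nat -> V) x (s : nat -> nat) : (forall n, (n <= s n)%N) ->
  hcvg dot u x -> hcvg dot (u \o s) x.
Proof.
move=> sn ux e e0; have [N hN] := ux e e0; exists N => n Nn /=.
by apply: hN; exact: leq_trans (sn n).
Qed.

Lemma hcvg_isometry (W : lmodType R[i]) (dW : W -> W -> R[i]) (u : nat -> V) x
    (v : nat -> W) y (c : R) : inner_product dW -> 0 <= c ->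
  (forall n, inorm dW (v n - y) ^+ 2 = c * inorm dot (u n - x) ^+ 2) ->
  hcvg dot u x -> hcvg dW v y.
Proof.
move=> dWP c0 h ux e e0.
have c1 : 0 < Num.sqrt c + 1 by rewrite ltr_wpDl ?sqrtr_ge0.
have [N hN] := ux _ (divr_gt0 e0 c1); exists N => n Nn.
rewrite -(@ltr_pXn2r _ 2)// ?nnegrE ?inorm_ge0 ?(ltW e0)// h.
rewrite -[c]sqr_sqrtr// -exprMn ltr_pXn2r// ?nnegrE ?mulr_ge0 ?inorm_ge0 ?sqrtr_ge0 ?(ltW e0)//.
have := hN n Nn; rewrite ltr_pdivlMr// => /(le_lt_trans _); apply.
by rewrite mulrC ler_wpM2l ?inorm_ge0// lerDl.
Qed.

Lemma hcvg_norm (u : nat -> V) x : hcvg dot u x ->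
  (fun n => inorm dot (u n)) @ \oo --> inorm dot x.
Proof.
move=> ux; apply/cvgrPdist_lt => e e0; have [N hN] := ux e e0; exists N => // n Nn.
apply: le_lt_trans (hN n Nn); rewrite ler_norml lerNl opprB (ler_inorm_sub dotP)/=.
by rewrite (inormBC dotP) (ler_inorm_sub dotP).
Qed.

Lemma hcvg_dotl (u : nat -> V) x y : hcvg dot u x ->
  (forall e : R, 0 < e -> exists N, forall n, (N <= n)%N -> normc (dot (u n) y - dot x y) < e).
Proof.
move=> ux e e0; have c0 : 0 < inorm dot y + 1 by rewrite ltr_wpDl ?inorm_ge0.
have [N hN] := ux _ (divr_gt0 e0 c0); exists N => n Nn.
rewrite -(idotBl dotP); apply: le_lt_trans (cauchy_schwarz dotP _ _) _.
have := hN n Nn; rewrite ltr_pdivlMr// => /(le_lt_trans _); apply.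
by rewrite ler_wpM2l ?inorm_ge0// lerDl.
Qed.

Lemma hcauchy_hcvg (u : nat -> V) x : hcvg dot u x -> hcauchy dot u.
Proof.
move=> ux e e0; have [N hN] := ux _ (divr_gt0 e0 (ltr0n R 2)); exists N => m n Nm Nn.
apply: le_lt_trans (le_inorm_dist dotP _ x _) _; rewrite [e]splitr ltrD ?hN//.
by rewrite (inormBC dotP) hN.
Qed.
End HilbertLimits.

Lemma sqr_lim (R : realType) (a b : nat -> R) (c x y : R) :
  (forall n, a n ^+ 2 = c * b n ^+ 2) -> a @ \oo --> x -> b @ \oo --> y ->
  x ^+ 2 = c * y ^+ 2.
Proof.
move=> e ax bY; have h1 : (fun n => a n ^+ 2) @ \oo --> x ^+ 2 by exact: cvgM.
have h2 : (fun n => a n ^+ 2) @ \oo --> c * y ^+ 2.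
  rewrite (funext e); apply: cvgM; first exact: cvg_cst.
  exact: cvgM.
exact: (cvg_unique (@Rhausdorff R) h1 h2).
Qed.

(** * The Fourier transform on L^2 *)

Section FourierTransform.
Variable R : realType.
Local Notation IP := (L2dot_inner R).
Implicit Types f g h : L2 R.

Definition window (n : nat) : set R := `[- n%:R, n%:R]%classic.

Lemma measurable_window n : measurable (window n : set R).
Proof. exact: measurable_itv. Qed.

Definition wcut n f := cutoff (window n) f.

Lemma cLfun2_wcut n f : wcut n f \in cLfun 2%:E.
Proof. by apply: cLfun2_cutoff; [exact: measurable_window|exact: L2_fun]. Qed.

Lemma wcut_support n f x : n%:R < `|x| -> wcut n f x = 0.
Proof.
move=> nx; rewrite /wcut cutoffE memNset// /window/= in_itv/= -ler_norml; apply/negP.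
by rewrite -ltNge.
Qed.

Lemma wcut_cvg f : hcvg (@L2dot R) (fun n => mkL2 (wcut n f)) f.
Proof.
apply: cutoff_cvg => [n|]; first exact: measurable_window.
apply: aeW => x; exists (Num.Def.archi_bound `|x|) => n xn /=.
rewrite /window/= in_itv/= -ler_norml ltW//.
by apply: lt_le_trans (archi_boundP _) _ => //; rewrite ler_nat.
Qed.

Lemma cintegrable_wcut n f : cintegrable (wcut n f).
Proof.
by apply: (bounded_support_cintegrable (cLfun2_wcut n f)) => x; exact: wcut_support.
Qed.

Lemma truncated_fourierE f n : truncated_fourier f n = ft (wcut n f).
Proof.
apply/funext => xi; rewrite /truncated_fourier /ft /cintegral; congr (_ +i* _).
  rewrite Rintegral_mkcond; apply: eq_Rintegral => x _.
  by rewrite patchE /wcut cutoffE /window; case: ifP => //; rewrite mul0r.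
rewrite Rintegral_mkcond; apply: eq_Rintegral => x _.
by rewrite patchE /wcut cutoffE /window; case: ifP => //; rewrite mul0r.
Qed.

Lemma cLfun2_truncated_fourier f n : truncated_fourier f n \in cLfun 2%:E.
Proof.
rewrite truncated_fourierE; have [mf fo] := (cLfun2P _).1 (cLfun2_wcut n f).
apply/cLfun2P; split; first exact: cmeasurable_ft.
rewrite (plancherel_bounded (cLfun2_wcut n f) (@wcut_support n f)).
by rewrite lte_mul_pinfty// lee_fin mulr_ge0 ?pi_ge0.
Qed.

Definition TF n f : L2 R := mkL2 (truncated_fourier f n).

Lemma is_fourierP f g : is_fourier f g <-> hcvg (@L2dot R) (fun n => TF n f) g.
Proof.
have e n : sqnorm (fun xi => g xi - truncated_fourier f n xi) = (L2norm (TF n f - g) ^+ 2)%:E.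
  by rewrite (inormBC IP) L2norm_mkL2B// cLfun2_truncated_fourier.
rewrite /is_fourier; under eq_fun do rewrite e; split.
- move=> /fine_cvg /cvgrPdist_lt h d d0; have d2 : 0 < d ^+ 2 by rewrite exprn_gt0.
  have [N _ hN] := h _ d2; exists N => n Nn; have := hN n Nn.
  rewrite /= sub0r normrN ger0_norm ?sqr_ge0//.
  by rewrite ltr_pXn2r// ?nnegrE ?inorm_ge0 ?(ltW d0).
- move=> h; apply: cvg_EFin; first exact: nearW.
  have cv : (fun n => L2norm (TF n f - g)) @ \oo --> (0 : R).
    apply/cvgrPdist_lt => d d0; have [N hN] := h d d0; exists N => // n Nn.
    by rewrite /= sub0r normrN ger0_norm ?inorm_ge0// hN.
  by have h2 := cvgM cv cv; rewrite mulr0 in h2; exact: h2.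
Qed.

(** A difference of truncations has bounded support, so Plancherel's formula applies before the
    transform is known to exist. It gives the existence of the limit and then, in the limit,
    [fourier_norm]. *)
Lemma TF_dist n m f g : L2norm (TF n f - TF m g) ^+ 2 =
  2 * pi * L2norm (mkL2 (wcut n f) - mkL2 (wcut m g)) ^+ 2.
Proof.
pose d x := wcut n f x - wcut m g x.
have dL : d \in cLfun 2%:E by apply: cLfun2B; exact: cLfun2_wcut.
have ds x : (maxn n m)%:R < `|x| -> d x = 0.
  by move=> mx; rewrite /d !wcut_support ?subrr//; apply: le_lt_trans mx; rewrite ler_nat ?leq_maxl ?leq_maxr.
have e : (fun xi => truncated_fourier f n xi - truncated_fourier g m xi) = ft d.
  rewrite !truncated_fourierE; apply/funext => xi.
  rewrite [RHS](_ : _ = ft (fun x => -1 * wcut m g x + wcut n f x) xi); last first.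
    by congr (ft _ xi); apply/funext => x; rewrite mulN1r addrC.
  by rewrite ft_lin ?mulN1r 1?addrC//; exact: cintegrable_wcut.
have h1 : TF n f - TF m g = mkL2 (ft d).
  by rewrite -e mkL2B//; exact: cLfun2_truncated_fourier.
have h2 : mkL2 (wcut n f) - mkL2 (wcut m g) = mkL2 d.
  by rewrite -mkL2B//; exact: cLfun2_wcut.
have fL : ft d \in cLfun 2%:E.
  by rewrite -e; apply: cLfun2B; exact: cLfun2_truncated_fourier.
rewrite h1 h2; apply: EFin_inj; rewrite (L2norm_mkL2 fL) (plancherel_bounded dL ds).
by rewrite -(L2norm_mkL2 dL).
Qed.

Let pi2_ge0 : 0 <= 2 * pi :> R. Proof. by rewrite mulr_ge0 ?pi_ge0. Qed.

Lemma fourier_exists f : exists g, is_fourier f g.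
Proof.
have : hcauchy (@L2dot R) (fun n => TF n f).
  have := hcauchy_hcvg IP (wcut_cvg f) => hc e e0.
  have c1 : 0 < Num.sqrt (2 * pi) + 1 :> R by rewrite ltr_wpDl ?sqrtr_ge0.
  have [N hN] := hc _ (divr_gt0 e0 c1); exists N => m n Nm Nn.
  rewrite -(@ltr_pXn2r _ 2)// ?nnegrE ?inorm_ge0 ?(ltW e0)// TF_dist.
  rewrite -[2 * pi]sqr_sqrtr// -exprMn ltr_pXn2r// ?nnegrE ?mulr_ge0 ?inorm_ge0 ?sqrtr_ge0 ?(ltW e0)//.
  have := hN m n Nm Nn; rewrite ltr_pdivlMr// => /(le_lt_trans _); apply.
  by rewrite mulrC ler_wpM2l ?inorm_ge0// lerDl.
by move=> /L2_complete[g hg]; exists g; apply/is_fourierP.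
Qed.

Lemma fourier_cvg f : hcvg (@L2dot R) (fun n => TF n f) (fourier f).
Proof.
apply/is_fourierP; have [g hg] := fourier_exists f.
exact: (xgetPex 0 (ex_intro _ g hg)).
Qed.

Lemma fourier_unique f g : hcvg (@L2dot R) (fun n => TF n f) g -> g = fourier f.
Proof. by move=> h; exact: (hcvg_unique IP h (fourier_cvg f)). Qed.

Lemma TF_lin n a f g : TF n (a *: f + g) = a *: TF n f + TF n g.
Proof.
rewrite /TF -mkL2_lin ?cLfun2_truncated_fourier//; congr mkL2; apply/funext => xi.
rewrite !truncated_fourierE -ft_lin; [|exact: cintegrable_wcut..].
have mw h : cmeasurable (fun x => wcut n h x * expi (- (xi * x))).
  by case: (cintegrable_ft xi (cintegrable_wcut n h)) => /measurable_int/measurable_EFinP ? /measurable_int/measurable_EFinP ?.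
rewrite /ft; apply: ae_eq_cint => //.
  apply: cintegrable_cmeasurable; apply: cintegrable_ft; apply: cintegrableD; [apply: cintegrableZ|];
    exact: cintegrable_wcut.
apply: ae_imp2 (L2DE (a *: f) g) (L2ZE a f) => x e1 e2.
by rewrite /wcut /cutoff e1 e2; ring.
Qed.

Lemma fourier_lin a f g : fourier (a *: f + g) = a *: fourier f + fourier g.
Proof.
apply/esym/fourier_unique.
have e : (fun n => TF n (a *: f + g)) = (fun n => a *: TF n f + TF n g).
  by apply/funext => n; exact: TF_lin.
by rewrite e; exact: (hcvg_lin IP a (fourier_cvg f) (fourier_cvg g)).
Qed.

Lemma fourier0 : fourier (0 : L2 R) = 0.
Proof.
by apply: (addrI (fourier 0)); have := fourier_lin 1 0 0; rewrite !scale1r !addr0 => {3}->.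
Qed.

Lemma fourierB f g : fourier (f - g) = fourier f - fourier g.
Proof. by rewrite addrC -scaleN1r fourier_lin scaleN1r addrC. Qed.

Lemma fourierZ a f : fourier (a *: f) = a *: fourier f.
Proof. by have := fourier_lin a f 0; rewrite fourier0 !addr0. Qed.

Lemma fourier_norm f : L2norm (fourier f) ^+ 2 = 2 * pi * L2norm f ^+ 2.
Proof.
have cv1 := hcvg_norm IP (fourier_cvg f); have cv2 := hcvg_norm IP (wcut_cvg f).
have e n : L2norm (TF n f) ^+ 2 = 2 * pi * L2norm (mkL2 (wcut n f)) ^+ 2.
  have tz : TF n 0 = 0 by have := TF_lin n (-1) f f; rewrite !scaleN1r !addNr.
  have wz : mkL2 (wcut n 0) = 0.
    apply/L2_eqP; apply: ae_imp2 (mkL2E (cLfun2_wcut n 0)) (L20E R) => x -> e1.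
    by rewrite e1 /wcut /cutoff e1 mulr0.
  have h1 : TF n f - TF n 0 = TF n f by rewrite tz subr0.
  have h2 : mkL2 (wcut n f) - mkL2 (wcut n 0) = mkL2 (wcut n f) by rewrite wz subr0.
  by rewrite -[in LHS]h1 -[in RHS]h2; exact: TF_dist.
exact: (sqr_lim e cv1 cv2).
Qed.

Lemma fourier_dot f g : L2dot (fourier f) (fourier g) = (2 * pi)%:C * L2dot f g.
Proof. exact: (polarization IP IP fourier_lin fourier_norm). Qed.

Lemma fourier_inj : injective (@fourier R).
Proof.
move=> f g fg; apply/eqP; rewrite -subr_eq0; apply/eqP; apply: (inorm0_eq0 IP).
have := fourier_norm (f - g); rewrite fourierB fg subrr (inorm0 IP) expr0n/= => /esym/eqP.
by rewrite mulf_eq0 mulf_eq0 pnatr_eq0/= (gt_eqF (pi_gt0 R)) sqrf_eq0/= => /eqP.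
Qed.
End FourierTransform.

(** * Multiplication formula, surjectivity and dilations *)

Section Inversion.
Variable R : realType.
Local Notation mu := (@lebesgue_measure R).
Local Notation cint := (cintegral setT).
Local Notation IP := (L2dot_inner R).
Implicit Types f g h : L2 R.

Lemma hcvg_dot_eq (V W : lmodType R[i]) (dV : V -> V -> R[i]) (dW : W -> W -> R[i])
    (u : nat -> V) x y (u' : nat -> W) x' y' :
  inner_product dV -> inner_product dW -> hcvg dV u x -> hcvg dW u' x' ->
  (forall n, dV (u n) y = dW (u' n) y') -> dV x y = dW x' y'.
Proof.
move=> pV pW ux ux' e; apply/eqP; rewrite -subr_eq0; apply/eqP/eq0_normc.
apply/eqP; rewrite eq_le normc_ge0 andbT; apply/ler_addgt0Pl => d d0; rewrite addr0.
have [N hN] := hcvg_dotl pV y ux (divr_gt0 d0 (ltr0n R 2)).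
have [M hM] := hcvg_dotl pW y' ux' (divr_gt0 d0 (ltr0n R 2)).
have h1 := hN (maxn N M) (leq_maxl _ _); have h2 := hM (maxn N M) (leq_maxr _ _).
rewrite -e in h2; rewrite -(subrKA (dV (u (maxn N M)) y)) [d]splitr.
apply: le_trans (le_normcD _ _) _; rewrite lerD// ltW//.
by rewrite -normcN opprB.
Qed.

(** Pairing with [cj v] expresses the bilinear form, the integral of u v, through the inner
    product. *)
Definition cj f : L2 R := mkL2 (fun x => conjc (f x)).

Lemma cjE f : \forall x \ae mu, cj f x = conjc (f x).
Proof. by apply: mkL2E; apply: cLfun2J; exact: L2_fun. Qed.

Lemma cjK f : cj (cj f) = f.
Proof. by apply/L2_eqP; apply: ae_imp2 (cjE (cj f)) (cjE f) => x -> ->; rewrite conjcK. Qed.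

Lemma cj_norm f : L2norm (cj f) = L2norm f.
Proof.
apply/eqP; rewrite -(@eqrXn2 _ 2)// ?inorm_ge0//; apply/eqP/EFin_inj.
rewrite -!sqnorm_L2 (@ae_eq_sqnorm _ (cj f) (fun x => conjc (f x))).
- by apply: eq_integral => x _; rewrite normcJ'.
- exact: L2_cmeasurable.
- by apply: cmeasurableJ; exact: L2_cmeasurable.
- exact: cjE.
Qed.

Lemma cjB f g : cj (f - g) = cj f - cj g.
Proof.
apply/L2_eqP; apply: ae_imp3 (cjE (f - g)) (L2BE f g) _; last first.
  by apply: ae_imp3 (L2BE (cj f) (cj g)) (cjE f) (cjE g) => x h1 h2 h3; exact: (conj h1 (conj h2 h3)).
by move=> x -> -> [-> [-> ->]]; rewrite conjcB.
Qed.

Lemma hcvg_cj (u : nat -> L2 R) f : hcvg (@L2dot R) u f -> hcvg (@L2dot R) (fun n => cj (u n)) (cj f).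
Proof.
by move=> uf e e0; have [N hN] := uf e e0; exists N => n Nn; rewrite -cjB cj_norm hN.
Qed.

Lemma cfubini (F : R * R -> R[i]) : cmeasurable F ->
  (\int[mu]_x \int[mu]_y (normc (F (x, y)))%:E < +oo)%E ->
  (forall x, cintegrable (fun y => F (x, y))) -> (forall y, cintegrable (fun x => F (x, y))) ->
  cint (fun x => cint (fun y => F (x, y))) = cint (fun y => cint (fun x => F (x, y))).
Proof.
move=> [mr mi] Foo h1 h2.
have key (T : R[i] -> R) : measurable_fun setT (fun p => T (F p)) ->
    (forall z, `|T z| <= normc z) ->
    (forall x, mu.-integrable setT (fun y => (T (F (x, y)))%:E)) ->
    (forall y, mu.-integrable setT (fun x => (T (F (x, y)))%:E)) ->
    \int[mu]_x \int[mu]_y T (F (x, y)) = \int[mu]_y \int[mu]_x T (F (x, y)).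
  move=> mT Tn T1 T2.
  have mTE : measurable_fun setT (fun p => (T (F p))%:E) by exact/measurable_EFinP.
  have Fi : (mu \x mu)%E.-integrable setT (fun p => (T (F p))%:E).
    apply/(integrable12ltyP mu mu mTE); apply: le_lt_trans Foo.
    have mn : measurable_fun setT (fun p => (normc (F p))%:E).
      by apply/measurable_EFinP; exact: measurable_normc.
    apply: ge0_le_integral => //.
    - by move=> x _; apply: integral_ge0.
    - by apply: (@measurable_fun_fubini_tonelli_F _ _ _ _ _ mu (fun p => `|(T (F p))%:E|%E)) => //;
        exact: measurableT_comp.
    - apply: (@measurable_fun_fubini_tonelli_F _ _ _ _ _ mu (fun p => (normc (F p))%:E)) => //.
      by move=> p; rewrite lee_fin normc_ge0.
    move=> x _; apply: ge0_le_integral => //.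
    - by apply: measurableT_comp => //; exact: measurable_int (T1 x).
    - by apply/measurable_EFinP; apply: measurable_normc; exact: cintegrable_cmeasurable.
    - by move=> y _; rewrite lee_fin.
  rewrite /Rintegral; congr fine.
  under eq_integral => x _ do rewrite fineK ?integrable_fin_num//.
  rewrite (Fubini Fi); apply: eq_integral => y _.
  by rewrite fineK// integrable_fin_num.
apply: complexP => /=.
  apply: (key (@complex.Re R)) => //; first exact: ler_normr_Re.
    by move=> x; case: (h1 x).
  by move=> y; case: (h2 y).
apply: (key (@complex.Im R)) => //; first exact: ler_normr_Im.
  by move=> x; case: (h1 x).
by move=> y; case: (h2 y).
Qed.

(** The kernel e^{-i xi x} is symmetric in x and xi and of modulus 1, so Fubini's theorem exchanges
    the roles of u and v. *)
Lemma ft_mul (u v : R -> R[i]) : cintegrable u -> cintegrable v ->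
  cint (fun xi => ft u xi * v xi) = cint (fun x => u x * ft v x).
Proof.
move=> ui vi; have mu_ := cintegrable_cmeasurable ui; have mv := cintegrable_cmeasurable vi.
pose F (p : R * R) := v p.1 * (u p.2 * expi (- (p.1 * p.2))).
have mF : cmeasurable F.
  apply: cmeasurableM; first exact: (cmeasurable_comp mv).
  exact: cmeasurable_ftkernel.
have F1 xi : cintegrable (fun x => F (xi, x)).
  exact: (cintegrableZ (v xi) (cintegrable_ft xi ui)).
have FE xi x : F (xi, x) = u x * (v xi * expi (- (x * xi))).
  by rewrite /F/= mulrCA (mulrC xi).
have F2 x : cintegrable (fun xi => F (xi, x)).
  by under eq_fun do rewrite FE; exact: (cintegrableZ (u x) (cintegrable_ft x vi)).
transitivity (cint (fun xi => cint (fun x => F (xi, x)))).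
  congr cintegral; apply/funext => xi; rewrite /ft mulrC -cintZ//.
  exact: cintegrable_ft.
rewrite cfubini//; last first.
  have nn w : (forall x, 0 <= (normc (w x : R[i]))%:E)%E by move=> x; rewrite lee_fin normc_ge0.
  have mnu : measurable_fun setT (fun x => (normc (u x))%:E).
    by apply/measurable_EFinP; exact: measurable_normc.
  have mnv : measurable_fun setT (fun x => (normc (v x))%:E).
    by apply/measurable_EFinP; exact: measurable_normc.
  have uoo : (\int[mu]_x (normc (u x))%:E < +oo)%E.
    have /integrableP[_] := cintegrable_normc ui.
    by under eq_integral => x _ do rewrite gee0_abs ?lee_fin ?normc_ge0//.
  have voo : (\int[mu]_x (normc (v x))%:E < +oo)%E.
    have /integrableP[_] := cintegrable_normc vi.
    by under eq_integral => x _ do rewrite gee0_abs ?lee_fin ?normc_ge0//.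
  have e : (\int[mu]_x \int[mu]_y (normc (F (x, y)))%:E =
      \int[mu]_xi ((\int[mu]_x (normc (u x))%:E) * (normc (v xi))%:E))%E.
    apply: eq_integral => xi _; rewrite muleC -ge0_integralZl_EFin ?normc_ge0//.
    by apply: eq_integral => x _; rewrite /F/= !normcM normc_expi mulr1 EFinM.
  rewrite e.
  rewrite ge0_integralZl//; last by apply: integral_ge0.
  by rewrite lte_mul_pinfty ?integral_ge0// ge0_fin_numE ?integral_ge0.
congr cintegral; apply/funext => x; rewrite /ft -cintZ; last exact: cintegrable_ft.
by congr cintegral; apply/funext => xi; rewrite FE.
Qed.

Lemma L2dot_cj (u v : R -> R[i]) : u \in cLfun 2%:E -> v \in cLfun 2%:E ->
  L2dot (mkL2 u) (cj (mkL2 v)) = cint (fun x => u x * v x).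
Proof.
move=> uL vL; have -> : cj (mkL2 v) = mkL2 (fun x => conjc (v x)).
  apply/L2_eqP; apply: ae_imp3 (cjE (mkL2 v)) (mkL2E vL) (mkL2E (cLfun2J vL)) => x -> ->.
  by move=> ->.
rewrite L2dot_mkL2//; last exact: cLfun2J.
by congr cintegral; apply/funext => x; rewrite conjCE conjcK.
Qed.

(** [ft_mul] gives the identity for truncations; the limit is taken in f first and then in h. *)
Lemma fourier_mul f h : L2dot (fourier f) (cj h) = L2dot f (cj (fourier h)).
Proof.
have step n m : L2dot (TF n f) (cj (mkL2 (wcut m h))) = L2dot (mkL2 (wcut n f)) (cj (TF m h)).
  rewrite !L2dot_cj ?cLfun2_wcut ?cLfun2_truncated_fourier//.
  by rewrite !truncated_fourierE ft_mul//; exact: cintegrable_wcut.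
have step2 m : L2dot (fourier f) (cj (mkL2 (wcut m h))) = L2dot f (cj (TF m h)).
  exact: (hcvg_dot_eq IP IP (fourier_cvg f) (wcut_cvg f) (step^~ m)).
rewrite (inner_herm IP) [RHS](inner_herm IP); congr conjc.
apply: (hcvg_dot_eq IP IP (hcvg_cj (wcut_cvg h)) (hcvg_cj (fourier_cvg h))) => m.
by rewrite (inner_herm IP) [RHS](inner_herm IP) step2.
Qed.

(* F G = 2 pi g for G = conj (F (conj g)): both sides have the same norm, and
   equality holds in the Cauchy-Schwarz inequality. *)
Lemma fourier_surj g : exists f, fourier f = g.
Proof.
pose G := cj (fourier (cj g)); pose c : R := 2 * pi.
have c0 : 0 < c by rewrite mulr_gt0 ?pi_gt0.
have GN : L2norm G ^+ 2 = c * L2norm g ^+ 2 by rewrite cj_norm fourier_norm cj_norm.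
have FG : L2dot (fourier G) g = (c * L2norm g ^+ 2)%:C.
  by rewrite -{1}(cjK g) fourier_mul -/G (idotxx IP) GN.
exists (c^-1%:C *: G); rewrite fourierZ.
have -> : fourier G = c%:C *: g.
  apply/eqP; rewrite -subr_eq0; apply/eqP; apply: (inorm0_eq0 IP); apply/eqP.
  rewrite -sqrf_eq0 (sqr_inormD IP) (inormN IP) (inormZ IP) fourier_norm GN normcC gtr0_norm//.
  rewrite (idotNr IP) (idotZr IP) FG conjCE conjc_real -rmorphM -rmorphN/=.
  by rewrite -/c; apply/eqP; ring.
by rewrite scalerA -rmorphM mulVf ?scale1r// gt_eqF.
Qed.

(** By surjectivity of [fourier] the set from which [fourier_multiplier] chooses is inhabited, so
    its value is not the default 0. *)
Lemma fourier_multiplierE (h : R[i] -> R[i]) (M : R) f : cmeasurable (pullback h) ->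
  (forall t : R, normc (pullback h t) <= M) ->
  \forall xi \ae mu, fourier (fourier_multiplier h f) xi = pullback h xi * fourier f xi.
Proof.
move=> mh hM; have hL : (fun xi => pullback h xi * fourier f xi) \in cLfun 2%:E.
  by apply: (@cLfun2_bounded _ _ _ M); [exact: L2_fun| |exact: aeW].
have [g hg] := fourier_surj (mkL2 (fun xi => pullback h xi * fourier f xi)).
have e : fourier (fourier_multiplier h f) = mkL2 (fun xi => pullback h xi * fourier f xi).
  exact: (@xgetPex _ 0 [set g | fourier g = mkL2 (fun xi => pullback h xi * fourier f xi)]
    (ex_intro _ g hg)).
by rewrite e; exact: mkL2E hL.
Qed.

Section Dilation.
Variable N : nat.
Hypothesis N_gt0 : (0 < N)%N.

Let n0 : 0 < N%:R :> R. Proof. by rewrite ltr0n. Qed.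
Let s0 : 0 < Num.sqrt N%:R :> R. Proof. by rewrite sqrtr_gt0. Qed.

Lemma cLfun2_dilation f : (fun x => ((Num.sqrt N%:R)^-1)%:C * f (x / N%:R)) \in cLfun 2%:E.
Proof.
apply: cLfun2Z; have := @cLfun2_affine _ _ N%:R^-1 0 _ (L2_fun f).
by rewrite invr_gt0 n0 => /(_ isT); under eq_fun do rewrite addr0 mulrC.
Qed.

Lemma cLfun2_codilation f : (fun x => (Num.sqrt N%:R)%:C * f (N%:R * x)) \in cLfun 2%:E.
Proof.
apply: cLfun2Z; have := cLfun2_affine 0 n0 (L2_fun f).
by under eq_fun do rewrite addr0.
Qed.

Definition codilation f : L2 R := mkL2 (fun x => (Num.sqrt N%:R)%:C * f (N%:R * x)).

Lemma codilationE f : \forall x \ae mu, codilation f x = (Num.sqrt N%:R)%:C * f (N%:R * x).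
Proof. exact: mkL2E (cLfun2_codilation f). Qed.

Lemma codilation_norm f : L2norm (codilation f) = L2norm f.
Proof.
apply/eqP; rewrite -(@eqrXn2 _ 2)// ?inorm_ge0//; apply/eqP/EFin_inj.
rewrite (L2norm_mkL2 (cLfun2_codilation f)) -sqnorm_L2.
have -> : sqnorm (fun x => (Num.sqrt N%:R)%:C * f (N%:R * x)) =
    sqnorm (fun x => (Num.sqrt N%:R)%:C * f (N%:R * x + 0)).
  by apply: eq_integral => x _; rewrite addr0.
have mf := L2_cmeasurable f; rewrite sqnormZ; last first.
  by apply: cmeasurable_comp => //; apply: measurable_funD => //; exact: measurable_funM.
rewrite sqnorm_affine// normcC gtr0_norm// sqr_sqrtr ?(ltW n0)//.
by rewrite muleA -EFinM divff ?mul1e// gt_eqF.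
Qed.

Lemma codilation_lin a f g : codilation (a *: f + g) = a *: codilation f + codilation g.
Proof.
have sc h (P Q : R -> R[i]) : (\forall x \ae mu, P x = Q x) ->
    \forall x \ae mu, P (N%:R * x) = Q (N%:R * x).
  by move=> PQ; apply: ae_imp (ae_affine 0 n0 PQ) => x; rewrite addr0.
apply/L2_eqP; apply: ae_imp3 (codilationE (a *: f + g)) (sc f _ _ (L2DE (a *: f) g)) _; last first.
  apply: ae_imp3 (sc f _ _ (L2ZE a f)) (L2DE (a *: codilation f) (codilation g)) _; last first.
    apply: ae_imp3 (L2ZE a (codilation f)) (codilationE f) (codilationE g) => x h1 h2 h3.
    exact: (conj h1 (conj h2 h3)).
  by move=> x h1 h2 h3; exact: (conj h1 (conj h2 h3)).
by move=> x -> -> [-> [-> [-> [-> ->]]]]; ring.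
Qed.

Lemma codilationB f g : codilation (f - g) = codilation f - codilation g.
Proof. by rewrite addrC -scaleN1r codilation_lin scaleN1r addrC. Qed.

(** The dilation carries the window [-n, n] to [-N n, N n], hence the two different truncation
    indices. *)
Lemma TF_dilation n f : TF (N * n) (dilation N f) = codilation (TF n f).
Proof.
apply/L2_eqP.
have h1 : \forall xi \ae mu, TF n f (N%:R * xi) = truncated_fourier f n (N%:R * xi).
  by apply: ae_imp (ae_affine 0 n0 (mkL2E (cLfun2_truncated_fourier f n))) => x; rewrite addr0.
apply: ae_imp3 (mkL2E (cLfun2_truncated_fourier (dilation N f) (N * n)))
  (codilationE (TF n f)) h1 => xi -> -> ->.
rewrite !truncated_fourierE.
pose k y := wcut n f y * expi (- (N%:R * xi * y)).
have ki : cintegrable k by apply: cintegrable_ft; exact: cintegrable_wcut.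
have Ni : 0 < N%:R^-1 :> R by rewrite invr_gt0.
have [kai kae] := cint_affine 0 Ni ki; rewrite invrK in kae.
transitivity (cint (fun x => ((Num.sqrt N%:R)^-1)%:C * k (N%:R^-1 * x + 0))).
  rewrite /ft; apply: ae_eq_cint.
  - by apply: cintegrable_cmeasurable; apply: cintegrable_ft; exact: cintegrable_wcut.
  - by apply: cintegrable_cmeasurable; apply: cintegrableZ.
  apply: ae_imp (mkL2E (cLfun2_dilation f)) => x dx.
  have iE : \1_(window (N * n)) x = \1_(window n) (N%:R^-1 * x) :> R.
    rewrite !indicE; congr (_%:R); congr nat_of_bool.
    apply/idP/idP; rewrite !inE /window/= !in_itv/= -!ler_norml normrM (gtr0_norm Ni) natrM.
      by move=> h; rewrite mulrC ler_pdivrMr// mulrC.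
    by rewrite mulrC ler_pdivrMr// mulrC.
  have xE : N%:R * xi * (N%:R^-1 * x) = xi * x by field; rewrite gt_eqF.
  rewrite /wcut /cutoff dx /k addr0 /wcut /cutoff iE xE (mulrC x); ring.
rewrite cintZ// kae mulrA -rmorphM; congr (_%:C * _).
by rewrite -{2}[N%:R]sqr_sqrtr ?(ltW n0)// expr2 mulrA mulVf ?mul1r// gt_eqF.
Qed.

Lemma fourier_dilation f : fourier (dilation N f) = codilation (fourier f).
Proof.
have h1 : hcvg (@L2dot R) (fun n => codilation (TF n f)) (codilation (fourier f)).
  apply: (hcvg_isometry (u := fun n => TF n f) (x := fourier f) (c := 1) IP) => //.
  - by move=> n; rewrite mul1r -codilationB codilation_norm.
  - exact: fourier_cvg.
(* Only truncations of index N n are matched; this subsequence determines the limit. *)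
have h2 : hcvg (@L2dot R) ((fun n => TF n (dilation N f)) \o muln N) (fourier (dilation N f)).
  apply: hcvg_sub => [n|]; last exact: fourier_cvg.
  by rewrite leq_pmull.
have e : (fun n => codilation (TF n f)) = (fun n => TF n (dilation N f)) \o muln N.
  by apply/funext => n /=; rewrite TF_dilation.
by rewrite e in h1; exact: (hcvg_unique IP h2 h1).
Qed.
End Dilation.
End Inversion.

(** * Multiresolution analyses *)

Section Spans.
Variables (R : realType) (W : wavelet_rep R).
Local Notation H := (wspace W).
Local Notation dot := (@wdot R W).
Hypothesis dotP : inner_product dot.

Lemma hclosureP (A : set H) x : hclosure A x <->
  forall e : R, 0 < e -> exists2 y, A y & inorm dot (x - y) < e.
Proof. by split => h e e0; have [y Ay xy] := h e e0; exists y => //; rewrite -?hnormE// hnormE. Qed.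

Lemma hclosure_sub (A : set H) : A `<=` hclosure A.
Proof. by move=> x Ax; apply/hclosureP => e e0; exists x; rewrite // subrr (inorm0 dotP). Qed.

Section Span.
Variables (e : int -> H) (c : nat -> int) (r : int -> nat).
Hypotheses (rK : cancel c r) (cK : cancel r c).
Hypothesis eP : forall k l, dot (e k) (e l) = (k == l)%:R.

Let en j := e (c j).

Lemma enumerated_orthonormal i j : dot (en i) (en j) = (i == j)%:R.
Proof. by rewrite eP (inj_eq (can_inj rK)). Qed.

Let enP := enumerated_orthonormal.

Lemma fourier_sum_lin K a x y :
  fourier_sum dot en K (a *: x + y) = a *: fourier_sum dot en K x + fourier_sum dot en K y.
Proof.
rewrite /fourier_sum scaler_sumr -big_split/=; apply: eq_bigr => j _.
by rewrite (inner_lin dotP) scalerDl scalerA.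
Qed.

Lemma fourier_sum0 K : fourier_sum dot en K 0 = 0.
Proof. by rewrite /fourier_sum big1// => j _; rewrite (idot0l dotP) scale0r. Qed.

Lemma fourier_sum_en K j : (j < K)%N -> fourier_sum dot en K (en j) = en j.
Proof.
move=> jK; rewrite /fourier_sum (bigD1 (Ordinal jK))//= enP eqxx scale1r big1 ?addr0//.
move=> i ij; rewrite enP; case: eqP => [ji|]; last by rewrite scale0r.
by rewrite -(inj_eq val_inj)/= ji eqxx in ij.
Qed.

Lemma lin_span_fourier_sum y : lin_span e y ->
  exists K0, forall K, (K0 <= K)%N -> fourier_sum dot en K y = y.
Proof.
move=> [s ->]; elim: s => [|[a k] s [K0 IH]].
  by exists 0%N => K _; rewrite big_nil fourier_sum0.
exists (maxn K0 (r k).+1) => K; rewrite geq_max => /andP[K0K kK].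
rewrite big_cons/= fourier_sum_lin IH//; congr (_ *: _ + _).
by rewrite -[e k]/(e k) -(cK k) -/(en (r k)) fourier_sum_en.
Qed.

Lemma fourier_sum_lin_span K x : lin_span e (fourier_sum dot en K x).
Proof.
exists [seq (dot x (en j), c j) | j <- iota 0 K].
by rewrite big_map /fourier_sum -(big_mkord xpredT (fun j => dot x (en j) *: en j)) /index_iota subn0.
Qed.

(** Partial sums are best approximations and eventually fix every element of the span. The
    enumeration c of the integers is left general: it is used both as [zenum] and as its
    opposite. *)
Lemma hclosure_lin_spanP x : hclosure (lin_span e) x <->
  hcvg dot (fun K => fourier_sum dot en K x) x.
Proof.
split=> [/hclosureP h d d0|h].
  have [y /lin_span_fourier_sum[K0 hK] xy] := h d d0.
  exists K0 => K /hK yE; rewrite (inormBC dotP); apply: le_lt_trans xy.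
  by rewrite -[y in leRHS]yE; exact: (fourier_sum_best dotP enP).
apply/hclosureP => d d0; have [K hK] := h d d0.
exists (fourier_sum dot en K x); first exact: fourier_sum_lin_span.
by rewrite (inormBC dotP) hK.
Qed.

Lemma hcvg_fourier_sum_lin a x y : hcvg dot (fun K => fourier_sum dot en K x) x ->
  hcvg dot (fun K => fourier_sum dot en K y) y ->
  hcvg dot (fun K => fourier_sum dot en K (a *: x + y)) (a *: x + y).
Proof.
move=> hx hy.
have -> : (fun K => fourier_sum dot en K (a *: x + y)) =
    (fun K => a *: fourier_sum dot en K x + fourier_sum dot en K y).
  by apply/funext => K; exact: fourier_sum_lin.
exact: hcvg_lin.
Qed.

Lemma hcvg_fourier_sum_closed x :
  (forall d : R, 0 < d -> exists2 y, hcvg dot (fun K => fourier_sum dot en K y) y &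
    inorm dot (x - y) < d) ->
  hcvg dot (fun K => fourier_sum dot en K x) x.
Proof.
move=> h; apply/hclosure_lin_spanP/hclosureP => d d0.
have d2 : 0 < d / 2 by rewrite divr_gt0.
have [y /hclosure_lin_spanP/hclosureP hy xy] := h _ d2.
have [z hz yz] := hy _ d2; exists z => //.
by apply: le_lt_trans (le_inorm_dist dotP _ y _) _; rewrite [d]splitr ltrD.
Qed.
End Span.
End Spans.

Section Bijections.
Variables (T : Type) (f : T -> T) (d : T).
Hypotheses (fI : injective f) (fS : forall y, exists x, f x = y).

Lemma pinvE x : 'pinv_(fun=> d) setT f (f x) = x.
Proof. by rewrite pinvKV ?in_setE// => ? ? _ _; exact: fI. Qed.

Lemma pinv_right y : f ('pinv_(fun=> d) setT f y) = y.
Proof. by have [x <-] := fS y; rewrite pinvE. Qed.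
End Bijections.

(** * Invariance of scaling vectors under unitary equivalence *)

Section Transport.
Variables (R : realType) (W1 W2 : wavelet_rep R) (F : wspace W1 -> wspace W2).
Hypotheses (P1 : inner_product (@wdot R W1)) (P2 : inner_product (@wdot R W2)).
Hypothesis F_lin : forall a x y, F (a *: x + y) = a *: F x + F y.
Hypothesis F_surj : forall y, exists x, F x = y.
Hypothesis F_dot : forall x y, wdot (F x) (F y) = wdot x y.
Hypothesis F_U : forall x, F (wU x) = wU (F x).
Hypothesis F_T : forall x, F (wT x) = wT (F x).
Hypotheses (T1_inj : injective (@wT R W1)) (T1_surj : forall y, exists x, @wT R W1 x = y).

Let F0 : F 0 = 0.
Proof. by apply: (addrI (F 0)); have := F_lin 1 0 0; rewrite !scale1r !addr0 => {3}->. Qed.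

Let FB x y : F (x - y) = F x - F y.
Proof. by rewrite addrC -scaleN1r F_lin scaleN1r addrC. Qed.

Let F_norm x : inorm (@wdot R W2) (F x) = inorm (@wdot R W1) x.
Proof.
by apply/eqP; rewrite -(@eqrXn2 _ 2)// ?inorm_ge0// (sqr_inorm P1) (sqr_inorm P2) F_dot.
Qed.

Lemma transport_inj : injective F.
Proof.
move=> x y xy; apply/eqP; rewrite -subr_eq0; apply/eqP/(inorm0_eq0 P1).
by rewrite -F_norm FB xy subrr (inorm0 P2).
Qed.

Let T2_inj : injective (@wT R W2).
Proof.
move=> x y; have [x' <-] := F_surj x; have [y' <-] := F_surj y.
by rewrite -!F_T => /transport_inj/T1_inj ->.
Qed.

Let T2_surj y : exists x, @wT R W2 x = y.
Proof. by have [y' <-] := F_surj y; have [x <-] := T1_surj y'; exists (F x); rewrite F_T. Qed.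

(** For negative k the iterates use [pinv], which is a true inverse because T is bijective on both
    sides. *)
Lemma transport_iterz k x : F (iterz (@wT R W1) k x) = iterz (@wT R W2) k (F x).
Proof.
case: k => n /=.
  by elim: n x => [|n IH] x //=; rewrite F_T IH.
have step y : F ('pinv_(fun=> 0) setT (@wT R W1) y) = 'pinv_(fun=> 0) setT (@wT R W2) (F y).
  by apply: T2_inj; rewrite -F_T (pinv_right _ T1_inj T1_surj) (pinv_right _ T2_inj T2_surj).
by rewrite step; congr ('pinv_ _ _ _ _); elim: n => //= n IH; rewrite step IH.
Qed.

Let image_mem (A : set (wspace W1)) x : (F @` A) (F x) = A x.
Proof.
by rewrite propeqE; split => [[y Ay /transport_inj <-]//|Ax]; exists x.
Qed.

Let image_ext (A B : set (wspace W2)) : (forall x, A (F x) <-> B (F x)) -> A = B.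
Proof. by move=> AB; apply/seteqP; split => y; have [x <-] := F_surj y; apply AB. Qed.

Lemma transport_hclosure (A : set (wspace W1)) : hclosure (F @` A) = F @` hclosure A.
Proof.
apply: image_ext => x; rewrite image_mem; split.
  move=> /hclosureP h; apply/hclosureP => e e0; have [_ [y Ay <-] xy] := h e e0.
  by exists y => //; rewrite -F_norm FB.
move=> /hclosureP h; apply/hclosureP => e e0; have [y Ay xy] := h e e0.
by exists (F y); [exists y|rewrite -FB F_norm].
Qed.

Lemma transport_lin_span e : lin_span (F \o e) = F @` lin_span e.
Proof.
have Fs (s : seq (R[i] * int)) : F (\sum_(ck <- s) ck.1 *: e ck.2) = \sum_(ck <- s) ck.1 *: F (e ck.2).
  by elim: s => [|ck s IH]; rewrite ?big_nil ?F0// !big_cons F_lin IH.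
apply/seteqP; split => [y [s ->]|_ [x [s ->] <-]].
  by exists (\sum_(ck <- s) ck.1 *: e ck.2); [exists s|rewrite Fs].
by exists s; rewrite Fs.
Qed.

Lemma transport_scaling_vector phi : @orthogonal_scaling_vector R W1 phi ->
  @orthogonal_scaling_vector R W2 (F phi).
Proof.
have sv V psi : scaling_vector_of V psi -> scaling_vector_of (fun n => F @` V n) (F psi).
  move=> [V0 [on cl]]; split; first by exists psi.
  have e : (fun k => iterz (@wT R W2) k (F psi)) = F \o (fun k => iterz (@wT R W1) k psi).
    by apply/funext => k /=; rewrite transport_iterz.
  rewrite e; split => [k l|]; first by rewrite /= F_dot.
  by rewrite transport_lin_span transport_hclosure cl.
move=> [V M Vphi]; exists (fun n => F @` V n); last exact: sv.
case: M => sub nest dense sep scal [psi hpsi]; split.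
- move=> n; have [z l c] := sub n; split.
  + by exists 0.
  + by move=> a _ _ [x Vx <-] [y Vy <-]; rewrite -F_lin; exists (a *: x + y) => //; exact: l.
  + by rewrite transport_hclosure => _ [x cx <-]; exists x => //; exact: c.
- by move=> n _ [x Vx <-]; exists x => //; exact: nest.
- rewrite -image_bigcup transport_hclosure dense.
  by apply: image_ext => x; rewrite image_mem.
- apply: image_ext => x; split => [h|/= ->].
    have : (\bigcap_n V n) x by move=> n _; rewrite -(image_mem (V n)); exact: h.
    by rewrite sep => /= ->; rewrite F0.
  by move=> n _; exists 0 => //; case: (sub n).
- move=> n; rewrite -scal; apply/seteqP; split => [_ [_ [x Vx <-] <-]|_ [_ [x Vx <-] <-]].
    by exists (wU x); [exists x|rewrite F_U].
  by exists (F x); [exists x|rewrite F_U].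
- by exists (F psi); exact: sv.
Qed.
End Transport.

(** The backward implication is the forward one for the inverse of F; bijectivity of T on the second
    space is pulled back to the first. *)
Lemma transport_scaling_vectorE (R : realType) (W1 W2 : wavelet_rep R)
    (F : wspace W1 -> wspace W2) phi :
  inner_product (@wdot R W1) -> inner_product (@wdot R W2) ->
  (forall a x y, F (a *: x + y) = a *: F x + F y) -> (forall y, exists x, F x = y) ->
  (forall x y, wdot (F x) (F y) = wdot x y) ->
  (forall x, F (wU x) = wU (F x)) -> (forall x, F (wT x) = wT (F x)) ->
  injective (@wT R W2) -> (forall y, exists x, @wT R W2 x = y) ->
  @orthogonal_scaling_vector R W1 phi <-> @orthogonal_scaling_vector R W2 (F phi).
Proof.
move=> P1 P2 Fl Fs Fd FU FT Ti Ts.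
have Fi : injective F by exact: (transport_inj P1 P2 Fl Fd).
have [G FG] := choice Fs; have GF x : G (F x) = x by apply: Fi.
split.
  apply: transport_scaling_vector => //.
    by move=> x y xy; apply: Fi; apply: Ti; rewrite -!FT xy.
  move=> y; have [z hz] := Ts (F y); have [x hx] := Fs z; exists x; apply: Fi.
  by rewrite FT hx.
rewrite -{2}[phi]GF; apply: transport_scaling_vector => //.
- by move=> a x y; apply: Fi; rewrite Fl !FG.
- by move=> y; exists (F y).
- by move=> x y; rewrite -Fd !FG.
- by move=> x; apply: Fi; rewrite FU !FG.
- by move=> x; apply: Fi; rewrite FT !FG.
Qed.

(** * Multiresolution analyses in terms of V_0 alone *)

Section Resolution.
Variables (R : realType) (W : wavelet_rep R).
Local Notation H := (wspace W).
Local Notation dot := (@wdot R W).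
Local Notation U := (@wU R W).
Hypothesis dotP : inner_product dot.
Hypothesis U_lin : forall a x y, U (a *: x + y) = a *: U x + U y.
Hypothesis U_surj : forall y, exists x, U x = y.
Hypothesis U_norm : forall x, inorm dot (U x) = inorm dot x.

Lemma isometryB x y : U (x - y) = U x - U y.
Proof. by rewrite addrC -scaleN1r U_lin scaleN1r addrC. Qed.

Lemma isometry_inj : injective U.
Proof.
move=> x y xy; apply/eqP; rewrite -subr_eq0; apply/eqP/(inorm0_eq0 dotP).
by rewrite -U_norm isometryB xy subrr (inorm0 dotP).
Qed.

Lemma iter_isometryB n x y : iter n U (x - y) = iter n U x - iter n U y.
Proof. by elim: n => // n IH; rewrite !iterS IH isometryB. Qed.

Lemma iter_isometry_norm n x : inorm dot (iter n U x) = inorm dot x.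
Proof. by elim: n => // n IH; rewrite iterS U_norm. Qed.

Lemma iter_isometry_surj n y : exists x, iter n U x = y.
Proof.
elim: n y => [|n IH] y; first by exists y.
by have [z <-] := U_surj y; have [x <-] := IH z; exists x.
Qed.

Local Notation Z := (iterz U).
Local Notation g := ('pinv_(fun=> 0) setT U).

Let gU x : g (U x) = x. Proof. exact: (pinvE _ isometry_inj). Qed.
Let Ug x : U (g x) = x. Proof. exact: (pinv_right _ isometry_inj U_surj). Qed.

Lemma iterzS k x : Z (k + 1) x = U (Z k x).
Proof.
case: k => n; first by rewrite addrC -intS.
case: n => [|n]; first by rewrite NegzE addNr /= Ug.
have -> : Negz n.+1 + 1 = Negz n by rewrite !NegzE; lia.
by rewrite /= Ug.
Qed.

Lemma iterzSr k x : Z (k + 1) x = Z k (U x).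
Proof.
case: k => n; first by rewrite addrC -intS /= -iterSr.
case: n => [|n]; first by rewrite NegzE addNr /= gU.
have -> : Negz n.+1 + 1 = Negz n by rewrite !NegzE; lia.
by rewrite [LHS]/= [RHS]/= -!iterS [in RHS]iterSr gU.
Qed.

Let g_lin a x y : g (a *: x + y) = a *: g x + g y.
Proof. by apply: isometry_inj; rewrite U_lin !Ug. Qed.

Let g_norm x : inorm dot (g x) = inorm dot x.
Proof. by rewrite -U_norm Ug. Qed.

Lemma iterz_lin k a x y : Z k (a *: x + y) = a *: Z k x + Z k y.
Proof.
case: k => n /=; first by elim: n => // n IH; rewrite !iterS IH U_lin.
by rewrite -!iterS; elim: n.+1 => // m IH; rewrite !iterS IH g_lin.
Qed.

Lemma iterz_norm k x : inorm dot (Z k x) = inorm dot x.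
Proof.
case: k => n; first exact: iter_isometry_norm.
by rewrite /Z; elim: n.+1 => // m IH; rewrite iterS g_norm.
Qed.

Lemma iterz_lin_norm k x y : inorm dot (Z k x - Z k y) = inorm dot (x - y).
Proof.
by rewrite -(iterz_norm k (x - y)); congr inorm; rewrite addrC -scaleN1r -iterz_lin scaleN1r addrC.
Qed.

Variable phi : H.
Let e k := iterz (@wT R W) k phi.
Let V0 := hclosure (lin_span e).

Let rK : cancel zenum zrank := zenumK.
Let cK : cancel zrank zenum := zrankK.

Lemma span_closed_subspace : (forall k l, dot (e k) (e l) = (k == l)%:R) -> closed_subspace V0.
Proof.
move=> eP; split.
- by apply: hclosure_sub => //; exists [::]; rewrite big_nil.
- move=> a x y; rewrite /V0 !(hclosure_lin_spanP dotP rK cK eP).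
  exact: (hcvg_fourier_sum_lin dotP).
- move=> x /hclosureP hx; apply/(hclosure_lin_spanP dotP rK cK eP).
  apply: (hcvg_fourier_sum_closed dotP rK cK eP) => d /hx [y V0y xy]; exists y => //.
  exact/(hclosure_lin_spanP dotP rK cK eP).
Qed.

(* The multiresolution analysis generated by [phi] is forced to be V_k = U^{-k} V_0. *)
Lemma orthogonal_scaling_vectorP : orthogonal_scaling_vector phi <->
  [/\ forall k l, dot (e k) (e l) = (k == l)%:R,
      forall v, V0 v -> V0 (U v),
      forall y (d : R), 0 < d -> exists n v, V0 v /\ inorm dot (iter n U y - v) < d &
      forall y, (forall n, exists2 v, V0 v & y = iter n U v) -> y = 0].
Proof.
split=> [[V [sub nest dense sep scal _] [_ [eP V0E]]]|[eP V0U dense sep]].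
  have UV k x : V k (U x) <-> V (k + 1) x.
    rewrite -{1}[k](addrK 1) -scal; split => [[x' Vx' /isometry_inj <-]//|Vx].
    by exists x.
  have UVn n x : V 0 (iter n U x) <-> V n%:Z x.
    elim: n x => // n IH x; rewrite iterSr IH UV.
    by have -> : Posz n + 1 = n.+1 by lia.
  have V0V : V0 = V 0 by [].
  split => //.
  - by move=> v; rewrite V0V => /nest; rewrite -UV.
  - move=> y d d0; have : hclosure (\bigcup_n V n) y by rewrite dense.
    move=> /hclosureP/(_ _ d0) [x [k _ Vx] xy].
    (* The index k may be negative; by nestedness it is replaced by |k|, so that only nonnegative
       powers of U occur. *)
    have Vk : V `|k|%N x.
      suff [m <-] : exists m : nat, k + m%:Z = `|k|%N.
        elim: m Vx => [|m IH] Vx; first by rewrite addr0.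
        by have -> : k + m.+1%:Z = k + m%:Z + 1; [lia|exact/nest/IH].
      by exists (absz ((absz k)%:Z - k)); lia.
    exists `|k|%N, (iter `|k|%N U x); rewrite V0V UVn; split => //.
    by rewrite -iter_isometryB iter_isometry_norm.
  (* For each k, y lies in U^|k| V_0 = V_{-|k|}, which is contained in V_k. *)
  - move=> y hy; have : (\bigcap_n V n) y.
      move=> k _; have [v] := hy `|k|%N; rewrite V0V => Vv ->.
      have h m : V (- m%:Z) (iter m U v).
        elim: m => // m IH; rewrite iterS UV.
        by have -> : - m.+1%:Z + 1 = - m%:Z by lia.
      have := h (absz k); move: (iter _ _ _) => w hw.
      suff [m <-] : exists m : nat, - `|k|%N%:Z + m%:Z = k.
        move: (absz k) hw => l hw; elim: m => [|m IH]; first by rewrite addr0.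
        by have -> : - l%:Z + m.+1%:Z = - l%:Z + m%:Z + 1; [lia|exact/nest].
      by exists (absz ((absz k)%:Z + k)); lia.
    by rewrite sep.
have [z l c] := span_closed_subspace eP.
exists (fun k => [set y | V0 (Z k y)]); last first.
  split; last by [].
  apply: hclosure_sub => //; exists [:: (1, 0)]; rewrite big_seq1 scale1r; exact: erefl.
split.
- move=> k; split => [|a x y|x /hclosureP hx] /=.
  + suff -> : Z k 0 = 0 by [].
    by apply: (inorm0_eq0 dotP); rewrite iterz_norm (inorm0 dotP).
  + by rewrite iterz_lin => Vx Vy; exact: l.
  + apply/c/hclosureP => d /hx [y Vy xy]; exists (Z k y) => //.
    by rewrite iterz_lin_norm.
- by move=> k x /=; rewrite iterzS; exact: V0U.
- apply/seteqP; split => // y _; apply/hclosureP => d d0.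
  have [n [v [Vv yv]]] := dense y _ d0; have [x xv] := iter_isometry_surj n v.
  exists x; first by exists n => //=; rewrite xv.
  by rewrite -(iter_isometry_norm n) iter_isometryB xv.
- apply/seteqP; split => [y Vy|_ -> k _] /=; last first.
    suff -> : Z k 0 = 0 by [].
    by apply: (inorm0_eq0 dotP); rewrite iterz_norm (inorm0 dotP).
  apply: sep => n; exists (Z (- n%:Z) y); first exact: Vy.
  suff -> : iter n U (Z (- n%:Z) y) = Z (- n%:Z + n%:Z) y by rewrite addNr.
  suff h m : iter m U (Z (- n%:Z) y) = Z (- n%:Z + m%:Z) y by exact: h.
  elim: m => [|m IH]; first by rewrite addr0.
  by have -> : - n%:Z + m.+1%:Z = - n%:Z + m%:Z + 1 ; [lia|rewrite iterzS -IH].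
- move=> k; apply/seteqP; split => [_ [x Vx <-] /=|y Vy].
    by rewrite -iterzSr subrK.
  by have [x xy] := U_surj y; exists x => //=; rewrite -[k](subrK 1) iterzSr xy.
- exists phi; split; last by [].
  apply: hclosure_sub => //; exists [:: (1, 0)]; rewrite big_seq1 scale1r; exact: erefl.
Qed.
End Resolution.

(** * Periodized products *)

Section FourierSide.
Variables (R : realType) (I : finType) (N : nat) (sg : I -> I) (theta : I -> R).
Variable alpha : I -> R[i].
Local Notation mu := (@lebesgue_measure R).
Local Notation cint := (cintegral setT).
Local Notation IP := (L2dot_inner R).
Local Notation K := (I -> L2 R).

(* Normalized so that the Fourier transform is an isometry. *)
Definition kdot (y z : K) : R[i] := ((2 * pi)^-1)%:C * \sum_s L2dot (y s) (z s).

Definition kU (y : K) : K := fun s => alpha s *: codilation N (y (sg s)).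

Definition kpow (k : int) (y : K) : K := fun s =>
  mkL2 (fun xi => expi (- (k%:~R * (theta s + xi))) * y s xi).

(** Since [wT] is [wrep idfun], T is here the multiplication of component s by e^{-i (theta_s +
    xi)}. *)
Definition fourier_rep : wavelet_rep R := @WaveletRep R K kdot kU (fun _ => kpow 1).

Lemma pi2_gt0 : 0 < 2 * pi :> R. Proof. by rewrite mulr_gt0 ?pi_gt0. Qed.

Lemma kdot_inner : inner_product kdot.
Proof.
split.
- move=> a x y z; rewrite /kdot mulrCA -mulrDr; congr (_ * _).
  by rewrite mulr_sumr -big_split/=; apply: eq_bigr => s _; rewrite fctE (inner_lin IP).
- move=> x y; rewrite /kdot conjcM conjc_real; congr (_ * _).
  by rewrite rmorph_sum; apply: eq_bigr => s _; rewrite (inner_herm IP).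
- move=> x; rewrite /kdot !ReImE mul0r subr0 mulr_ge0 ?invr_ge0 ?(ltW pi2_gt0)//.
  by rewrite Re_sum sumr_ge0// => s _; exact: (inner_ge0 IP).
- move=> x; rewrite /kdot !ReImE mul0r subr0 Re_sum => /eqP.
  rewrite mulf_eq0 invr_eq0 (gt_eqF pi2_gt0)/= psumr_eq0; last first.
    by move=> s _; exact: (inner_ge0 IP).
  move=> /allP h; apply/funext => s; apply: (inner_eq0 IP); apply/eqP.
  by apply: h; rewrite mem_index_enum.
Qed.

Local Notation KP := kdot_inner.
Local Notation knorm := (inorm kdot).

Lemma sqr_knorm (y : K) : (knorm y ^+ 2)%:E = (((2 * pi)^-1)%:E * \sum_s sqnorm (y s))%E.
Proof.
rewrite (sqr_inorm KP) /kdot !ReImE mul0r subr0 EFinM Re_sum -sumEFin; congr (_ * _)%E.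
by apply: eq_bigr => s _; rewrite sqnorm_L2 (sqr_inorm IP).
Qed.

Lemma cLfun2_phase (h : R -> R) (f : L2 R) : measurable_fun setT h ->
  (fun xi => expi (h xi) * f xi) \in cLfun 2%:E.
Proof.
move=> mh; apply: (@cLfun2_bounded _ _ _ 1); first exact: L2_fun.
  exact: cmeasurable_expi.
by apply: aeW => x; rewrite normc_expi.
Qed.

Lemma measurable_kphase (k : int) s :
  measurable_fun setT (fun xi : R => - (k%:~R * (theta s + xi))).
Proof.
by apply: measurableT_comp => //; apply: measurable_funM => //; exact: measurable_funD.
Qed.

Lemma kpowE k y s : \forall xi \ae mu,
  kpow k y s xi = expi (- (k%:~R * (theta s + xi))) * y s xi.
Proof. by apply: mkL2E; apply: cLfun2_phase; exact: measurable_kphase. Qed.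

Lemma kpowD k l y : kpow k (kpow l y) = kpow (k + l) y.
Proof.
apply/funext => s; apply/L2_eqP.
apply: ae_imp3 (kpowE k (kpow l y) s) (kpowE l y s) (kpowE (k + l) y s) => x -> -> ->.
by rewrite mulrA -expiD intrD; congr (expi _ * _); ring.
Qed.

Lemma kpow0 y : kpow 0 y = y.
Proof.
apply/funext => s; apply/L2_eqP; apply: ae_imp (kpowE 0 y s) => x ->.
by rewrite mul0r oppr0 expi0 mul1r.
Qed.

Lemma kpow_inj k : injective (kpow k).
Proof. by move=> x y /(congr1 (kpow (- k))); rewrite !kpowD addNr !kpow0. Qed.

Lemma iterz_kpow k (y : K) : iterz (@wT R fourier_rep) k y = kpow k y.
Proof.
have T1 : @wT R fourier_rep = kpow 1 by [].
have Ts (z : K) : exists x, kpow 1 x = z.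
  by exists (kpow (- 1) z); rewrite kpowD subrr kpow0.
have Ti z : 'pinv_(fun=> 0) setT (kpow 1) z = kpow (- 1) z.
  by apply: (@kpow_inj 1); rewrite (pinv_right _ (@kpow_inj 1) Ts) kpowD subrr kpow0.
rewrite /iterz T1; case: k => n.
  elim: n => [|n IH] /=; first by rewrite kpow0.
  by rewrite IH kpowD; congr kpow; rewrite intS.
rewrite NegzE; elim: n => [|n IH]; first by rewrite /= Ti.
by rewrite iterS IH Ti kpowD; congr kpow; lia.
Qed.

Lemma kdot_fun (y z : K) (u v : I -> R -> R[i]) :
  (forall s, cmeasurable (u s)) -> (forall s, cmeasurable (v s)) ->
  (forall s, \forall xi \ae mu, y s xi = u s xi) ->
  (forall s, \forall xi \ae mu, z s xi = v s xi) ->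
  kdot y z = ((2 * pi)^-1)%:C * \sum_s cint (fun xi => u s xi * conjc (v s xi)).
Proof.
move=> mu_ mv yu zv; congr (_ * _); apply: eq_bigr => s _; apply: ae_eq_cint.
- by apply: cmeasurableM (cmeasurableJ _); exact: L2_cmeasurable.
- by apply: cmeasurableM => //; exact: cmeasurableJ.
- by apply: ae_imp2 (yu s) (zv s) => xi -> ->.
Qed.
End FourierSide.

Section PeriodSums.
Variables (R : realType) (I : finType) (theta : I -> R) (phi : I -> L2 R).
Local Notation mu := (@lebesgue_measure R).

Lemma PerE (g : R -> R) xi : (forall x, 0 <= g x) ->
  (Per g xi = \sum_(0 <= j <oo) (g (xi + 2 * pi * (zenum j)%:~R))%:E)%E.
Proof.
move=> g0; have bij : set_bij setT setT zenum.
  split => //; first by move=> a b _ _; exact: (can_inj zenumK).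
  by move=> k _; exists (zrank k) => //; exact: zrankK.
rewrite nneseries_esumT; last by move=> j; rewrite lee_fin.
rewrite /Per (reindex_esum _ _ _ _ bij)//.
by apply: eq_esum => j _; congr (g _)%:E; ring.
Qed.

Let dens s (t : R) : R := normc (phi s t) ^+ 2.
Let dens0 s t : 0 <= dens s t. Proof. exact: sqr_ge0. Qed.
Let mdens s : measurable_fun setT (dens s).
Proof. by apply: measurable_sqr_normc; exact: L2_cmeasurable. Qed.

(* The left-hand side of condition (i). *)
Definition bracket (eta : R) : \bar R := (\sum_s Per (dens s) (eta - theta s)%R)%E.

Let mterm s j : measurable_fun setT (fun eta : R => (dens s (eta - theta s + 2 * pi * (zenum j)%:~R))%:E).
Proof.
apply/measurable_EFinP; apply: (measurableT_comp (mdens s)).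
by apply: measurable_funD => //; exact: measurable_funB.
Qed.

Lemma measurable_bracket : measurable_fun setT bracket.
Proof.
apply: emeasurable_sum => s; under eq_fun do rewrite (PerE _ (dens0 s)).
by apply: (@ge0_emeasurable_sum _ _ _ setT _ xpredT) => [j x _ _|j _]; [rewrite lee_fin|exact: mterm].
Qed.

Lemma bracket_ge0 eta : (0 <= bracket eta)%E.
Proof. by apply: sume_ge0 => s _; apply: esum_ge0 => k _; rewrite lee_fin dens0. Qed.

(** Component s is translated by theta_s and folded onto one period; the periodic weight w factors
    out of the folded sum. With w = |m|^2 this computes the norm of [synthesis m], with
    trigonometric weights the coefficients of the bracket. *)
Lemma periodize_bracket (w : R -> R) : measurable_fun setT w -> (forall x, 0 <= w x) ->
  (forall x (k : int), w (x + 2 * pi * k%:~R) = w x) ->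
  (\sum_s \int[mu]_xi (w (xi + theta s)%R * dens s xi)%:E =
   \int[mu]_(eta in `[0%R, (0 + 2 * pi)%R[) ((w eta)%:E * bracket eta))%E.
Proof.
move=> mw w0 wper.
transitivity (\sum_s \int[mu]_(eta in `[0%R, (0 + 2 * pi)%R[)
    ((w eta)%:E * Per (dens s) (eta - theta s)%R))%E; last first.
  rewrite -ge0_integral_sum//.
  - apply: eq_integral => eta _; rewrite /bracket ge0_sume_distrr// => s _.
    by apply: esum_ge0 => k _; rewrite lee_fin dens0.
  - move=> s; apply: measurable_funTS; apply: emeasurable_funM; first exact/measurable_EFinP.
    under eq_fun do rewrite (PerE _ (dens0 s)).
    by apply: (@ge0_emeasurable_sum _ _ _ setT _ xpredT) => [j x _ _|j _]; [rewrite lee_fin|exact: mterm].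
  - by move=> s eta _; rewrite mule_ge0 ?lee_fin//; apply: esum_ge0 => k _; rewrite lee_fin dens0.
apply: eq_bigr => s _; pose h eta := (w eta * dens s (eta - theta s))%:E.
have h0 x : (0 <= h x)%E by rewrite lee_fin mulr_ge0.
have mh : measurable_fun setT h.
  apply/measurable_EFinP; apply: measurable_funM => //.
  by apply: (measurableT_comp (mdens s)); exact: measurable_funB.
transitivity (\int[mu]_x h (1 * x + theta s)%R)%E.
  by apply: eq_integral => x _; rewrite /h mul1r addrK.
rewrite (ge0_integral_affine _ ltr01 mh h0) invr1 mul1e.
rewrite (periodization 0 (pi2_gt0 R) mh h0); apply: eq_integral => eta _.
rewrite (PerE _ (dens0 s)) -nneseriesZl; last by move=> j _; rewrite lee_fin dens0.
apply: eq_eseriesr => j _; rewrite /h wper EFinM; congr (_ * (dens s _)%:E)%E.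
by rewrite addrAC.
Qed.
End PeriodSums.

Section Bracket.
Variables (R : realType) (I : finType) (theta : I -> R) (phi : I -> L2 R).
Local Notation mu := (@lebesgue_measure R).
Local Notation cint := (cintegral setT).
Local Notation G := (bracket theta phi).
Local Notation K := (I -> L2 R).

Lemma Per_period (g : R -> R) xi (k : int) : Per g (xi + 2 * pi * k%:~R) = Per g xi.
Proof.
have bij : set_bij setT setT (fun l : int => l - k).
  by split => // [a b _ _ /addIr//|l _]; exists (l + k) => //; rewrite addrK.
rewrite /Per (reindex_esum _ _ _ _ bij); apply: eq_esum => l _.
by congr (g _)%:E; rewrite intrB; ring.
Qed.

Lemma bracket_period eta (k : int) : G (eta + 2 * pi * k%:~R) = G eta.
Proof. by apply: eq_bigr => s _; rewrite -[RHS](Per_period _ _ k) addrAC. Qed.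

Lemma int_translate (x : R) : exists k : int, 0 <= x + 2 * pi * k%:~R < 2 * pi.
Proof.
have p0 := pi2_gt0 R; exists (- Num.floor (x / (2 * pi))).
have /andP[h1 h2] := floor_itv (x / (2 * pi)).
rewrite rmorphN; apply/andP; split.
  by move: h1; rewrite ler_pdivlMr// mulrC; lra.
by move: h2; rewrite ltr_pdivrMr// rmorphD/= mulrDl mul1r mulrC; lra.
Qed.

Lemma ae_of_period (P : R -> Prop) : (forall x (k : int), P (x + 2 * pi * k%:~R) -> P x) ->
  (\forall x \ae mu, 0 <= x < 2 * pi -> P x) -> \forall x \ae mu, P x.
Proof.
move=> Pper h.
have hk (k : int) : \forall x \ae mu,
    0 <= 1 * x + 2 * pi * k%:~R < 2 * pi -> P (1 * x + 2 * pi * k%:~R).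
  exact: (ae_affine _ ltr01 h).
apply: ae_imp (ae_forall hk) => x {}hk; have [k xk] := int_translate x.
by apply: (Pper x k); have := hk k; rewrite mul1r => /(_ xk).
Qed.

Let dens s (t : R) : R := normc (phi s t) ^+ 2.
Local Notation ind := (@period_indic R 0).

(** The total mass is finite, so the extended-valued bracket is finite almost everywhere and may be
    replaced by its [fine] part. *)
Lemma bracket_mass : (\int[mu]_(eta in `[0%R, (0 + 2 * pi)%R[) G eta = \sum_s sqnorm (phi s))%E.
Proof.
have := @periodize_bracket R I theta phi (fun=> 1).
move=> /(_ (measurable_cst _) (fun=> ler01) (fun _ _ => erefl)).
under [X in _ = X -> _]eq_integral do rewrite mul1e.
by move=> <-; apply: eq_bigr => s _; apply: eq_integral => x _; rewrite mul1r.
Qed.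

Lemma integrable_bracket : mu.-integrable `[0%R, (0 + 2 * pi)%R[ G.
Proof.
apply/integrableP; split.
  by apply: measurable_funTS; exact: measurable_bracket.
under eq_integral do rewrite gee0_abs ?bracket_ge0//.
by rewrite bracket_mass; apply: lte_sum_pinfty => s _; exact: L2_sqnorm_lty.
Qed.

Lemma bracket_fin_num : \forall eta \ae mu, 0 <= eta < 2 * pi -> G eta \is a fin_num.
Proof.
have := @integrable_ae _ _ _ _ _ _ _ integrable_bracket; move=> /(_ (measurable_itv _)).
by apply: ae_imp => x h x0; apply: h; rewrite /= in_itv/= add0r.
Qed.

Lemma measurable_fine_bracket : measurable_fun setT (fun eta => fine (G eta)).
Proof. by apply: measurableT_comp => //; exact: measurable_bracket. Qed.

Lemma bracket_integral (w : R -> R) : measurable_fun setT w -> (forall x, 0 <= w x) ->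
  (forall x (k : int), w (x + 2 * pi * k%:~R) = w x) ->
  (\int[mu]_eta (w eta * (ind eta * fine (G eta)))%:E =
   \sum_s \int[mu]_xi (w (xi + theta s) * dens s xi)%R%:E)%E.
Proof.
move=> mw w0 wper; rewrite (periodize_bracket theta phi mw w0 wper).
rewrite [RHS]integral_mkcond; apply: ae_eq_integral => //.
- apply/measurable_EFinP; apply: measurable_funM => //.
  apply: measurable_funM; [exact: measurable_period_indic|exact: measurable_fine_bracket].
- apply/(measurable_restrict _ (measurable_itv _) measurableT).
  rewrite setTI; apply: measurable_funTS.
  by apply: emeasurable_funM; [exact/measurable_EFinP|exact: measurable_bracket].
apply: ae_imp bracket_fin_num => x fin _; rewrite patchE period_indicE add0r.
rewrite mem_setE in_itv/=; case: ifP => [/fin fx|_]; last by rewrite mul0r mulr0.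
by rewrite mul1r EFinM fineK.
Qed.

Lemma integrable_bracketM (w : R -> R) (M : R) : measurable_fun setT w ->
  (forall x, `|w x| <= M) -> mu.-integrable setT (fun eta => (w eta * (ind eta * fine (G eta)))%:E).
Proof.
move=> mw wM.
have i1 : mu.-integrable setT (fun eta => (ind eta * fine (G eta))%:E).
  apply/integrableP; split.
    apply/measurable_EFinP; apply: measurable_funM; [exact: measurable_period_indic|].
    exact: measurable_fine_bracket.
  have := @bracket_integral (fun=> 1) (measurable_cst _) (fun=> ler01) (fun _ _ => erefl).
  move=> e; apply: (@le_lt_trans _ _ (\sum_s sqnorm (phi s))%E); last first.
    by apply: lte_sum_pinfty => s _; exact: L2_sqnorm_lty.
  rewrite le_eqVlt; apply/orP; left; apply/eqP; transitivity
    (\int[mu]_eta (1 * (ind eta * fine (G eta)))%:E)%E.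
    apply: eq_integral => x _; rewrite mul1r gee0_abs// lee_fin mulr_ge0//.
    by rewrite fine_ge0// bracket_ge0.
  by rewrite e; apply: eq_bigr => s _; apply: eq_integral => x _; rewrite mul1r.
apply: (le_integrable measurableT _ _ (integrableZl measurableT M i1)).
  apply/measurable_EFinP; apply: measurable_funM => //.
  apply: measurable_funM; [exact: measurable_period_indic|exact: measurable_fine_bracket].
move=> x _; rewrite !abse_EFin lee_fin !normrM ler_wpM2r//.
by rewrite (le_trans (wM x))// ler_norm.
Qed.

(** A weight of variable sign is written (1 + w) - 1, a difference of two nonnegative periodic
    weights. *)
Lemma bracket_Rintegral (w : R -> R) : measurable_fun setT w -> (forall x, `|w x| <= 1) ->
  (forall x (k : int), w (x + 2 * pi * k%:~R) = w x) ->
  \int[mu]_eta (w eta * (ind eta * fine (G eta))) =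
  \sum_s \int[mu]_xi (w (xi + theta s) * dens s xi).
Proof.
move=> mw w1 wper; pose v x := 1 + w x.
have mv : measurable_fun setT v by exact: measurable_funD.
have v0 x : 0 <= v x by have := w1 x; rewrite /v ler_norml => /andP[]; lra.
have v2 x : `|v x| <= 2 by have := w1 x; rewrite !ler_norml /v => /andP[]; lra.
have id s : mu.-integrable setT (fun xi => (dens s xi)%:E).
  apply/integrableP; split; first exact: (measurable_sqnorm (L2_cmeasurable _)).
  under eq_integral do rewrite gee0_abs ?lee_fin ?sqr_ge0//.
  exact: (L2_sqnorm_lty (phi s)).
have iu (u : R -> R) s (M : R) : measurable_fun setT u -> (forall x, `|u x| <= M) ->
    mu.-integrable setT (fun xi => (u (xi + theta s) * dens s xi)%:E).
  move=> um uM; apply: (le_integrable measurableT _ _ (integrableZl measurableT M (id s))).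
    apply/measurable_EFinP; apply: measurable_funM.
      by apply: (measurableT_comp um); exact: measurable_funD.
    by apply/measurable_EFinP; exact: (measurable_sqnorm (L2_cmeasurable _)).
  move=> x _; rewrite !abse_EFin lee_fin !normrM ler_wpM2r//.
  by rewrite (le_trans (uM _))// ler_norm.
have key (u : R -> R) (M : R) : measurable_fun setT u -> (forall x, 0 <= u x) ->
    (forall x, `|u x| <= M) -> (forall x (k : int), u (x + 2 * pi * k%:~R) = u x) ->
    \int[mu]_eta (u eta * (ind eta * fine (G eta))) = \sum_s \int[mu]_xi (u (xi + theta s) * dens s xi).
  move=> um u0 uM uper; rewrite /Rintegral bracket_integral//.
  by rewrite -sum_fine// => s _; apply: integrable_fin_num => //; exact: iu uM.
have one_le (x : R) : `|1 : R| <= 1 by rewrite normr1.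
have k1 := key (fun _ : R => 1 : R) 1 (measurable_cst _) (fun _ : R => ler01) one_le (fun _ _ => erefl).
have kv := key v 2 mv v0 v2 (fun x k => congr1 (+%R 1) (wper x k)).
transitivity (\int[mu]_eta (v eta * (ind eta * fine (G eta)) - 1 * (ind eta * fine (G eta)))).
  by apply: eq_Rintegral => x _; rewrite -mulrBl /v addrC addKr.
rewrite RintegralB//; last 2 first.
- exact: integrable_bracketM v2.
- exact: (integrable_bracketM (measurable_cst _) one_le).
rewrite kv k1 -sumrB; apply: eq_bigr => s _; rewrite -RintegralB//; last 2 first.
- exact: iu v2.
- exact: (iu _ _ _ (measurable_cst _) one_le).
by apply: eq_Rintegral => x _; rewrite -mulrBl /v addrC addKr.
Qed.

Local Notation gram := (fun eta => (ind eta * fine (G eta))%:C).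

Lemma cintegrable_gram : cintegrable gram.
Proof.
have one_le (x : R) : `|1 : R| <= 1 by rewrite normr1.
have i1 := @integrable_bracketM (fun=> 1) 1 (measurable_cst _) one_le.
split; last exact: integrable0.
by under eq_fun do rewrite /= -[_ * _]mul1r.
Qed.

(** The real and imaginary parts are integrals against cos (m x) and sin (m x), which are admissible
    weights in [bracket_Rintegral]. *)
Lemma bracket_coef (m : int) :
  cint (fun eta => gram eta * expi (m%:~R * eta)) = (2 * pi)%:C * kdot (kpow theta (- m) phi) phi.
Proof.
pose u s xi := expi (m%:~R * (theta s + xi)) * phi s xi.
have mph s : cmeasurable (phi s) by exact: L2_cmeasurable.
have mm (c : R) : measurable_fun setT (fun x : R => m%:~R * (c + x)).
  by apply: measurable_funM => //; exact: measurable_funD.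
have mu_ s : cmeasurable (u s).
  by apply: cmeasurableM => //; exact: cmeasurable_expi.
rewrite (kdot_fun (u := u) (v := phi))//; last 2 first.
- move=> s; apply: ae_imp (kpowE theta (- m) phi s) => x ->.
  by rewrite intrN mulNr opprK.
- by move=> s; exact: aeW.
rewrite mulrA -rmorphM mulfV ?gt_eqF ?pi2_gt0// mul1r.
have per (x : R) (k : int) : m%:~R * (x + 2 * pi * k%:~R) = m%:~R * x + 2 * (m * k)%:~R * pi.
  by rewrite intrM; ring.
have e s xi : u s xi * conjc (phi s xi) = (dens s xi)%:C * expi (m%:~R * (xi + theta s)).
  by rewrite /u -mulrA mulJc mulrC addrC.
have eper x (k : int) : expi (m%:~R * (x + 2 * pi * k%:~R)) = expi (m%:~R * x) :> R[i].
  by rewrite per expiD expi_2piz mulr1.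
have mx : measurable_fun setT (fun x : R => m%:~R * x) by exact: measurable_funM.
apply: complexP.
- rewrite Re_sum /=.
  have := @bracket_Rintegral (fun x => cos (m%:~R * x)).
  have -> : (fun x => complex.Re (gram x * expi (m%:~R * x))) =
      (fun x => cos (m%:~R * x) * (ind x * fine (G x))).
    by apply/funext => x; rewrite ReM ReC ImC mul0r subr0 mulrC.
  move=> ->.
  + by apply: eq_bigr => s _; apply: eq_Rintegral => x _; rewrite e ReM ReC ImC mul0r subr0 mulrC.
  + exact: (cmeasurable_expi mx).1.
  + by move=> x; rewrite ler_norml cos_le1 cos_geN1.
  + by move=> x k; have [] := eper x k.
- rewrite Im_sum /=.
  have := @bracket_Rintegral (fun x => sin (m%:~R * x)).
  have -> : (fun x => complex.Im (gram x * expi (m%:~R * x))) =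
      (fun x => sin (m%:~R * x) * (ind x * fine (G x))).
    by apply/funext => x; rewrite ImM ReC ImC mul0r addr0 mulrC.
  move=> ->.
  + by apply: eq_bigr => s _; apply: eq_Rintegral => x _; rewrite e ImM ReC ImC mul0r addr0 mulrC.
  + exact: (cmeasurable_expi mx).2.
  + by move=> x; rewrite ler_norml sin_le1 sin_geN1.
  + by move=> x k; have [] := eper x k.
Qed.

Lemma kdot_kpow (k l : int) (y z : K) :
  kdot (kpow theta k y) (kpow theta l z) = kdot (kpow theta (k - l) y) z.
Proof.
pose u k s xi := expi (- (k%:~R * (theta s + xi))) : R[i].
have mu_ j s : cmeasurable (u j s).
  by apply: cmeasurable_expi; exact: measurable_kphase.
rewrite (kdot_fun (u := fun s xi => u k s xi * y s xi) (v := fun s xi => u l s xi * z s xi)).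
rewrite (kdot_fun (u := fun s xi => u (k - l) s xi * y s xi) (v := z)).
congr (_ * _); apply: eq_bigr => s _; congr cintegral; apply/funext => xi.
- rewrite conjcM expiJ opprK /u mulrACA -expiD mulrA -!mulrA; congr (expi _ * _).
  by rewrite intrB; ring.
- by move=> s; apply: cmeasurableM => //; exact: L2_cmeasurable.
- by move=> s; exact: L2_cmeasurable.
- by move=> s; exact: kpowE.
- by move=> s; exact: aeW.
- by move=> s; apply: cmeasurableM => //; exact: L2_cmeasurable.
- by move=> s; apply: cmeasurableM => //; exact: L2_cmeasurable.
- by move=> s; exact: kpowE.
- by move=> s; exact: kpowE.
Qed.

Lemma orthonormal_bracketP :
  (forall k l, kdot (kpow theta k phi) (kpow theta l phi) = (k == l)%:R) <->
  \forall eta \ae mu, G eta = 1%E.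
Proof.
have p0 := pi2_gt0 R.
split=> [h|G1 k l]; last first.
  rewrite kdot_kpow -[k - l]opprK opprB.
  apply: (@mulfI _ (2 * pi)%:C); first by rewrite fmorph_eq0 gt_eqF.
  rewrite -bracket_coef (@ae_eq_cint _ _ (fun x => (ind x)%:C * expi ((l - k)%:~R * x))).
  - rewrite cint_period_expi subr_eq0 [l == k]eq_sym.
    by case: (k == l); rewrite ?mulr1n ?mulr0n ?mulr1 ?mulr0.
  - apply: cmeasurableM; first exact: cintegrable_cmeasurable cintegrable_gram.
    by apply: cmeasurable_expi; exact: measurable_funM.
  - apply: cmeasurableM; first by apply: cmeasurableC; exact: measurable_period_indic.
    by apply: cmeasurable_expi; exact: measurable_funM.
  - by apply: ae_imp G1 => x ->; rewrite mulr1.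
pose f eta := gram eta - (ind eta)%:C.
have ii : cintegrable (fun x => (ind x)%:C : R[i]).
  by split; [exact: integrable_period|exact: integrable0].
have fi : cintegrable f.
  have := cintegrableD cintegrable_gram (cintegrableZ (-1) ii).
  by under [in X in X -> _]eq_fun do rewrite mulN1r.
have f0 : zero_coef f.
  split=> // k; under [in LHS]eq_fun do rewrite mulrBl.
  rewrite cintB ?bracket_coef ?cint_period_expi; last 2 first.
  - have := cintegrable_expiM k%:~R cintegrable_gram; exact.
  - exact: cintegrable_period_expi.
  rewrite -[X in kdot _ X](kpow0 theta) h oppr_eq0.
  by case: (k == 0); rewrite ?mulr1n ?mulr0n ?mulr1 ?mulr0 subrr.
have : \forall x \ae mu, f x = 0.
  apply: (@zero_coef_eq0 _ 0) => // y hy; rewrite /f period_indicE.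
  by move/negP/negbTE: hy => ->; rewrite mul0r subrr.
move=> fz; apply: ae_of_period => [x k|]; first by rewrite bracket_period.
apply: ae_imp2 fz bracket_fin_num => x fx fin x0.
move: fx; rewrite /f period_indicE add0r x0 mul1r => /subr0_eq [] e.
by rewrite -(fineK (fin x0)) e.
Qed.
End Bracket.

Section Periodic.
Variable R : realType.

Definition periodic (T : Type) (m : R -> T) := forall x (k : int), m (x + 2 * pi * k%:~R) = m x.

Definition to_period (x : R) : R := x - 2 * pi * (Num.floor (x / (2 * pi)))%:~R.

Lemma measurable_to_period : measurable_fun setT to_period.
Proof.
apply: measurable_funB => //; apply: measurable_funM => //.
apply: nondecreasing_measurable => // x y xy; rewrite ler_int.
by apply: le_floor; rewrite ler_pM2r// invr_gt0 pi2_gt0.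
Qed.

Lemma to_period_periodic : periodic to_period.
Proof.
move=> x k; have p0 : 2 * pi != 0 :> R by rewrite gt_eqF ?pi2_gt0.
rewrite /to_period (_ : (x + 2 * pi * k%:~R) / (2 * pi) = x / (2 * pi) + k%:~R).
  by rewrite floorDrz ?intr_int// intrKfloor rmorphD/=; ring.
by rewrite mulrDl [2 * pi * _]mulrC mulfK.
Qed.

Lemma to_period_id x : 0 <= x < 2 * pi -> to_period x = x.
Proof.
move=> /andP[x0 x1]; rewrite /to_period.
have -> : Num.floor (x / (2 * pi)) = 0; last by rewrite mulr0 subr0.
apply: floor_def; apply/andP; split.
  by rewrite mulr0z; apply: divr_ge0 => //; exact/ltW/pi2_gt0.
by rewrite add0r mulr1z ltr_pdivrMr ?pi2_gt0// mul1r.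
Qed.

Lemma Per_ge (g : R -> R) xi (k : int) : (forall x, 0 <= g x) ->
  ((g (xi + 2 * k%:~R * pi)%R)%:E <= Per g xi)%E.
Proof.
move=> g0; apply: esum_ge; exists [set k].
  by split => //; exact: finite_set1.
by rewrite fsbig_set1.
Qed.
End Periodic.

Section ShiftSpan.
Variables (R : realType) (I : finType) (N : nat) (sg : I -> I) (alpha : I -> R[i]).
Variables (theta : I -> R) (phi : I -> L2 R).
Local Notation KP := (@kdot_inner R I).
Local Notation W := (fourier_rep N sg theta alpha).
Local Notation V0 := (@hclosure R W (@lin_span R W (fun k => kpow theta k phi))).
Local Notation E := (fun j => kpow theta (- zenum j) phi).
Hypothesis EP : forall k l, kdot (kpow theta k phi) (kpow theta l phi) = (k == l)%:R.

(** With this sign, [kpow theta (c j)] multiplies by e^{i (zenum j) (theta_s + xi)}, in agreement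
    with the characters of [trig]. *)
Let c j := - zenum j.
Let r k := zrank (- k).
Let rK : cancel c r. Proof. by move=> j; rewrite /r /c opprK zenumK. Qed.
Let cK : cancel r c. Proof. by move=> k; rewrite /r /c zrankK opprK. Qed.

Lemma shift_orthonormal i j : kdot (E i) (E j) = (i == j)%:R.
Proof. by rewrite EP (inj_eq (can_inj rK)). Qed.

Lemma shift_spanP y : V0 y <-> hcvg (@kdot R I) (fun n => fourier_sum (@kdot R I) E n y) y.
Proof. exact: (@hclosure_lin_spanP _ W KP (fun k => kpow theta k phi) c r rK cK EP). Qed.

Lemma shift_span_fourier_sum n y : V0 (fourier_sum (@kdot R I) E n y).
Proof.
apply: (@hclosure_sub _ W KP).
exact: (@fourier_sum_lin_span _ W (fun k => kpow theta k phi) c n y).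
Qed.
End ShiftSpan.

(** * The closed span of the translates *)

Section Synthesis.
Variables (R : realType) (I : finType) (N : nat) (sg : I -> I) (alpha : I -> R[i]).
Variables (theta : I -> R) (phi : I -> L2 R).
Local Notation mu := (@lebesgue_measure R).
Local Notation G := (bracket theta phi).
Local Notation K := (I -> L2 R).
Local Notation KP := (@kdot_inner R I).
Local Notation knorm := (inorm (@kdot R I)).
Local Notation ind := (@period_indic R 0).
Implicit Types m : R -> R[i].
Hypothesis G1 : \forall eta \ae mu, G eta = 1%E.

Let dens s (t : R) : R := normc (phi s t) ^+ 2.

(** |phi_s (xi)|^2 is the term of index s and k = 0 of the bracket at theta_s + xi, a sum of
    nonnegative terms equal to 1. *)
Lemma normc_le1_of_bracket s : \forall xi \ae mu, normc (phi s xi) <= 1.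
Proof.
have := ae_affine (theta s) ltr01 G1; apply: ae_imp => xi; rewrite mul1r => h.
rewrite -(@ler_pXn2r _ 2)// ?nnegrE ?normc_ge0// expr1n -lee_fin -h /bracket.
rewrite (bigD1 s)//= addrK; apply: le_trans (leeDl _ _); last first.
  by apply: sume_ge0 => t _; apply: esum_ge0 => k _; rewrite lee_fin sqr_ge0.
have := @Per_ge R (dens s) xi 0 (fun x => sqr_ge0 _).
by rewrite mulr0 mul0r addr0.
Qed.

Definition synthesis m : K := fun s => mkL2 (fun xi => m (theta s + xi) * phi s xi).

Lemma cmeasurable_synthesis m s : cmeasurable m -> cmeasurable (fun xi => m (theta s + xi) * phi s xi).
Proof.
move=> mm; apply: cmeasurableM; last exact: L2_cmeasurable.
by apply: (cmeasurable_comp mm); exact: measurable_funD.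
Qed.

Lemma cmeasurable_period_cut m : cmeasurable m -> cmeasurable (fun x => (ind x)%:C * m x).
Proof.
by apply: cmeasurableM; apply: cmeasurableC; exact: measurable_period_indic.
Qed.

(** [periodize_bracket] with the weight |m|^2 and bracket 1: up to a constant factor, [synthesis] is
    an isometry from L^2 of a period. *)
Lemma sqnorm_synthesis m : cmeasurable m -> periodic m ->
  (\sum_s sqnorm (fun xi => m (theta s + xi) * phi s xi)%R = sqnorm (fun eta => (ind eta)%:C * m eta)%R)%E.
Proof.
move=> mm mper; pose w x := normc (m x) ^+ 2.
have mw : measurable_fun setT w by exact: measurable_sqr_normc.
have := @periodize_bracket R I theta phi w mw (fun x => sqr_ge0 _).
move=> /(_ (fun x k => congr1 (fun z => normc z ^+ 2) (mper x k))) h.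
transitivity (\sum_s \int[mu]_xi (w (xi + theta s) * dens s xi)%R%:E)%E.
  apply: eq_bigr => s _; apply: eq_integral => xi _.
  by rewrite normcM exprMn addrC.
rewrite h integral_mkcond; apply: ae_eq_integral => //.
- apply/(measurable_restrict _ (measurable_itv _) measurableT).
  rewrite setTI; apply: measurable_funTS.
  by apply: emeasurable_funM; [exact/measurable_EFinP|exact: measurable_bracket].
- by apply: measurable_sqnorm; exact: cmeasurable_period_cut.
apply: ae_imp G1 => x Gx _; rewrite patchE period_indicE mem_setE in_itv/= Gx mule1.
by case: ifP => _; rewrite ?mul1r// mul0r normc0 expr0n.
Qed.

Lemma cLfun2_synthesis m s : cmeasurable m -> periodic m ->
  (fun x => (ind x)%:C * m x) \in cLfun 2%:E ->
  (fun xi => m (theta s + xi) * phi s xi) \in cLfun 2%:E.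
Proof.
move=> mm mper /cLfun2P [_ fin]; apply/cLfun2P; split; first exact: cmeasurable_synthesis.
apply: le_lt_trans fin; rewrite -sqnorm_synthesis// (bigD1 s)//=.
by rewrite leeDl// sume_ge0// => t _; exact: sqnorm_ge0.
Qed.

Lemma synthesisE m s : cmeasurable m -> periodic m ->
  (fun x => (ind x)%:C * m x) \in cLfun 2%:E ->
  \forall xi \ae mu, synthesis m s xi = m (theta s + xi) * phi s xi.
Proof. by move=> *; apply: mkL2E; exact: cLfun2_synthesis. Qed.

Lemma synthesis_norm m : cmeasurable m -> periodic m ->
  (fun x => (ind x)%:C * m x) \in cLfun 2%:E ->
  knorm (synthesis m) ^+ 2 = (2 * pi)^-1 * L2norm (mkL2 (fun x => (ind x)%:C * m x)) ^+ 2.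
Proof.
move=> mm mper mL; apply: EFin_inj; rewrite sqr_knorm EFinM L2norm_mkL2//.
rewrite -sqnorm_synthesis//; congr (_ * _)%E; apply: eq_bigr => s _.
rewrite sqnorm_L2; apply/esym/sqnorm_L2_eq; first exact: cmeasurable_synthesis.
exact: synthesisE.
Qed.

Lemma synthesis_dist m m' : cmeasurable m -> periodic m ->
  (fun x => (ind x)%:C * m x) \in cLfun 2%:E -> cmeasurable m' -> periodic m' ->
  (fun x => (ind x)%:C * m' x) \in cLfun 2%:E ->
  knorm (synthesis m - synthesis m') ^+ 2 = (2 * pi)^-1 *
    L2norm (mkL2 (fun x => (ind x)%:C * m x) - mkL2 (fun x => (ind x)%:C * m' x)) ^+ 2.
Proof.
move=> mm mper mL mm' mper' mL'.
have e : (fun x => (ind x)%:C * (m x - m' x)) = (fun x => (ind x)%:C * m x - (ind x)%:C * m' x).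
  by apply/funext => x; rewrite mulrBr.
have dL : (fun x => (ind x)%:C * (m x - m' x)) \in cLfun 2%:E by rewrite e; exact: cLfun2B.
have dm : cmeasurable (fun x => m x - m' x) by exact: cmeasurableB.
have dper : periodic (fun x => m x - m' x) by move=> x k; rewrite mper mper'.
rewrite -mkL2B// -e -synthesis_norm//; congr (inorm _ _ ^+ 2).
apply/funext => s; apply/L2_eqP.
apply: ae_imp3 (L2BE (synthesis m s) (synthesis m' s)) (synthesisE s mm mper mL) _; last first.
  by apply: ae_imp2 (synthesisE s mm' mper' mL') (synthesisE s dm dper dL) => x h1 h2; exact: (conj h1 h2).
by move=> x e1 e2 [e3 ->]; rewrite mulrBl -e2 -e3.
Qed.

Definition trigpoly (c : nat -> R[i]) n (x : R) : R[i] :=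
  \sum_(j < n) c j * expi ((zenum j)%:~R * x).

Lemma cmeasurable_trigpoly c n : cmeasurable (trigpoly c n).
Proof.
apply: cmeasurable_sum => j; apply: cmeasurableM; first exact: cmeasurable_cst.
by apply: cmeasurable_expi; exact: measurable_funM.
Qed.

Lemma periodic_trigpoly c n : periodic (trigpoly c n).
Proof.
move=> x k; apply: eq_bigr => j _; congr (_ * _).
rewrite (_ : _ * (x + _) = (zenum j)%:~R * x + 2 * (zenum j * k)%:~R * pi).
  by rewrite expiD expi_2piz mulr1.
by rewrite intrM; ring.
Qed.

Lemma cLfun2_trigpoly c n : (fun x => (ind x)%:C * trigpoly c n x) \in cLfun 2%:E.
Proof.
have -> : (fun x => (ind x)%:C * trigpoly c n x) =
    (fun x => \sum_(j < n) c j * ((ind x)%:C * expi ((zenum j)%:~R * x))).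
  by apply/funext => x; rewrite mulr_sumr; apply: eq_bigr => j _; rewrite mulrCA.
apply: cLfun2_sum => j; apply: cLfun2Z; apply: cLfun2_period_expi.
exact: measurable_funM.
Qed.

Local Notation E j := (kpow theta (- zenum j) phi).

Lemma synthesis_trigpoly c n : synthesis (trigpoly c n) = \sum_(j < n) c j *: (E j : K).
Proof.
apply/funext => s; rewrite fct_sumE; apply/L2_eqP.
have h1 := L2_sumE (index_enum _) (fun j : 'I_n => c j *: E j s).
have h2 : \forall x \ae mu, forall j : 'I_n,
    (c j *: E j s : L2 R) x = c j * (expi ((zenum j)%:~R * (theta s + x)) * phi s x).
  apply: ae_forall => j; apply: ae_imp2 (L2ZE (c j) (E j s)) (kpowE theta (- zenum j) phi s) => x -> ->.
  by rewrite intrN mulNr opprK.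
apply: ae_imp3 h1 h2 (synthesisE s (cmeasurable_trigpoly c n) (periodic_trigpoly c n) (cLfun2_trigpoly c n)).
move=> x e1 h -> /=; rewrite e1 mulr_suml; apply: eq_bigr => j _.
by rewrite h mulrA.
Qed.

Hypothesis EP : forall k l, kdot (kpow theta k phi) (kpow theta l phi) = (k == l)%:R.
Local Notation W := (fourier_rep N sg theta alpha).
Local Notation V0 := (@hclosure R W (@lin_span R W (fun k => kpow theta k phi))).

Let V0P := @shift_spanP R I N sg alpha theta phi EP.

Lemma span_coef_cvg y : V0 y ->
  hcvg (@kdot R I) (fun n => synthesis (trigpoly (fun j => kdot y (E j)) n)) y.
Proof. by move=> /V0P h d d0; have [n0 h0] := h d d0; exists n0 => n /h0; rewrite synthesis_trigpoly. Qed.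

Lemma synthesis_span m : cmeasurable m -> periodic m ->
  (fun x => (ind x)%:C * m x) \in cLfun 2%:E -> V0 (synthesis m).
Proof.
move=> mm mper mL; apply/hclosureP => d d0.
have ms : supported 0 (fun x => (ind x)%:C * m x).
  by move=> x /negP/negbTE hx; rewrite period_indicE hx mul0r.
have := trig_complete mL ms => h.
have d1 : 0 < d * Num.sqrt (2 * pi) by rewrite mulr_gt0// sqrt2pi_gt0.
have [n hn] := h _ d1; have {}hn := hn n (leqnn n).
pose f := mkL2 (fun x => (ind x)%:C * m x).
pose b j := L2dot f (mkL2 (trig 0 j)) * ((Num.sqrt (2 * pi))^-1)%:C.
exists (synthesis (trigpoly b n)).
  exists [seq (b (val j), - zenum (val j)) | j <- enum 'I_n].
  by rewrite big_map synthesis_trigpoly big_enum.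
have e : mkL2 (fun x => (ind x)%:C * trigpoly b n x) =
    fourier_sum (@L2dot R) (fun j => mkL2 (trig 0 j)) n f.
  apply/L2_eqP.
  have h1 := L2_sumE (index_enum _) (fun j : 'I_n => L2dot f (mkL2 (trig 0 j)) *: mkL2 (trig 0 j)).
  have h2 : \forall x \ae mu, forall j : 'I_n,
      (L2dot f (mkL2 (trig 0 j)) *: mkL2 (trig 0 j) : L2 R) x = L2dot f (mkL2 (trig 0 j)) * trig 0 j x.
    by apply: ae_forall => j; apply: ae_imp2 (L2ZE (L2dot f (mkL2 (trig 0 j))) (mkL2 (trig 0 j)))
      (mkL2E (cLfun2_trig 0 j)) => x -> ->.
  apply: ae_imp3 h1 h2 (mkL2E (cLfun2_trigpoly b n)) => x -> h2' ->.
  rewrite mulr_sumr; apply: eq_bigr => j _; rewrite h2' /trig /b; ring.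
rewrite -(@ltr_pXn2r _ 2)// ?nnegrE ?inorm_ge0 ?(ltW d0)//.
rewrite synthesis_dist//; [|exact: cmeasurable_trigpoly|exact: periodic_trigpoly|exact: cLfun2_trigpoly].
rewrite e (inormBC (L2dot_inner R)) mulrC ltr_pdivrMr ?pi2_gt0//.
move: hn; rewrite -(@ltr_pXn2r _ 2)// ?nnegrE ?inorm_ge0 ?(ltW d1)//.
by rewrite exprMn (@sqr_sqrtr _ (2 * pi))// ltW ?pi2_gt0.
Qed.

(** The partial sums of y are synthesized from trigonometric polynomials. By the isometry these form
    a Cauchy sequence in L^2 of a period, and m is the periodic extension of their limit. *)
Lemma span_synthesis y : V0 y -> exists m, [/\ cmeasurable m, periodic m,
  (fun x => (ind x)%:C * m x) \in cLfun 2%:E & y = synthesis m].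
Proof.
move=> V0y; pose a j := kdot y (E j).
pose u n := mkL2 (fun x => (ind x)%:C * trigpoly a n x).
have hy := span_coef_cvg V0y.
have p0 := pi2_gt0 R.
have dist i n : L2norm (u i - u n) ^+ 2 =
    2 * pi * knorm (synthesis (trigpoly a i) - synthesis (trigpoly a n)) ^+ 2.
  rewrite synthesis_dist; try by [exact: cmeasurable_trigpoly|exact: periodic_trigpoly|exact: cLfun2_trigpoly].
  by rewrite mulrA mulfV ?gt_eqF// mul1r.
have cu : hcauchy (@L2dot R) u.
  move=> d d0; have d1 : 0 < d / Num.sqrt (2 * pi) by rewrite divr_gt0// sqrt2pi_gt0.
  have [n0 h0] := hcauchy_hcvg KP hy d1; exists n0 => i n hi hn.
  have := h0 _ _ hi hn.
  rewrite -(@ltr_pXn2r _ 2)// ?nnegrE ?inorm_ge0 ?(ltW d1)// => h.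
  rewrite -(@ltr_pXn2r _ 2)// ?nnegrE ?inorm_ge0 ?(ltW d0)// dist mulrC -ltr_pdivlMr//.
  by rewrite (lt_le_trans h)// expr_div_n (@sqr_sqrtr _ (2 * pi))// ltW.
have [l0 hl0] := L2_complete cu; pose l : L2 R := l0.
have hl : hcvg (@L2dot R) u l := hl0.
pose m x := l (to_period x).
have mm : cmeasurable m by apply: (cmeasurable_comp (L2_cmeasurable l)); exact: measurable_to_period.
have mper : periodic m by move=> x k; rewrite /m to_period_periodic.
have e : (fun x => (ind x)%:C * m x) = (fun x => (ind x)%:C * l x).
  apply/funext => x; rewrite period_indicE add0r; case: (boolP (0 <= x < _)) => x0; last by rewrite !mul0r.
  by rewrite /m to_period_id.
have mL : (fun x => (ind x)%:C * m x) \in cLfun 2%:E by rewrite e; exact: period_cut.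
exists m; split => //; apply: (hcvg_unique KP hy) => d d0.
have d1 : 0 < d * Num.sqrt (2 * pi) by rewrite mulr_gt0// sqrt2pi_gt0.
have [n0 h0] := hl _ d1; exists n0 => n /h0.
rewrite -(@ltr_pXn2r _ 2)// ?nnegrE ?inorm_ge0 ?(ltW d1)// => h.
rewrite -(@ltr_pXn2r _ 2)// ?nnegrE ?inorm_ge0 ?(ltW d0)//.
rewrite synthesis_dist//; [|exact: cmeasurable_trigpoly|exact: periodic_trigpoly|exact: cLfun2_trigpoly].
rewrite mulrC ltr_pdivrMr//; move: h; rewrite exprMn (@sqr_sqrtr _ (2 * pi)) ?(ltW p0)//.
(* The functions [u n] vanish off the period, so restricting l to the period does not increase its
   distance to them. *)
apply: le_lt_trans; rewrite -lee_fin -!sqnorm_L2.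
apply: ae_le_sqnorm; try exact: L2_cmeasurable.
apply: ae_imp3 (L2BE (u n) (mkL2 (fun x => (ind x)%:C * m x))) (L2BE (u n) l) _; last first.
  by apply: ae_imp2 (mkL2E (cLfun2_trigpoly a n)) (mkL2E mL) => x h1 h2; exact: (conj h1 h2).
move=> x -> -> [-> ->]; have := congr1 (@^~ x) e; rewrite /= => ->.
rewrite period_indicE; case: (0 <= x < _); first by rewrite !mul1r.
by rewrite !mul0r subrr normc0 normc_ge0.
Qed.
End Synthesis.

Section Circle.
Variable R : realType.

Lemma expi_eq1 (t : R) : expi t = 1 -> exists k : int, t = 2 * pi * k%:~R.
Proof.
pose k := Num.floor (t / (2 * pi)); move=> t1; exists k; apply/eqP; rewrite -subr_eq0.
have /andP[u0 u1] : 0 <= t - 2 * pi * k%:~R < 2 * pi.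
  have p0 := pi2_gt0 R; have /andP[h1 h2] := floor_itv (t / (2 * pi)).
  apply/andP; split; first by move: h1; rewrite ler_pdivlMr// mulrC -/k; lra.
  by move: h2; rewrite ltr_pdivrMr// rmorphD/= mulrDl mul1r mulrC -/k; lra.
have : expi (t - 2 * pi * k%:~R) = 1.
  by rewrite expiD t1 mul1r expiNV mulrAC expi_2piz invr1.
move: (t - _) u0 u1 => u u0 u1 [c1 s0]; apply/eqP; case: (ltgtP u pi) => up.
- move: u0; rewrite le_eqVlt => /orP[/eqP <-//|u0].
  by have := @sin_gt0_pi R u; rewrite s0 u0 up => /(_ erefl); rewrite ltxx.
- have := @sin_gt0_pi R (u - pi); have := sinDpi (u - pi).
  rewrite subrK s0 => /esym/eqP; rewrite oppr_eq0 => /eqP ->.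
  by rewrite ltxx subr_gt0 up ltrBlDr -mulr2n -mulr_natl u1 => /(_ erefl).
- by move: c1; rewrite up cospi; lra.
Qed.

Lemma expi_eq (a b : R) : expi a = expi b -> exists k : int, a = b + 2 * pi * k%:~R.
Proof.
move=> ab; have [k hk] : exists k : int, a - b = 2 * pi * k%:~R.
  by apply: expi_eq1; rewrite expiD ab -expiD subrr expi0.
by exists k; rewrite -hk addrC subrK.
Qed.
End Circle.

Section PerSub.
Variable R : realType.
Lemma PerZ (c : R) (g : R -> R) xi : 0 <= c -> (forall x, 0 <= g x) ->
  (Per (fun t => c * g t)%R xi = c%:E * Per g xi)%E.
Proof.
move=> c0 g0; rewrite !PerE//; last by move=> x; exact: mulr_ge0.
by rewrite -nneseriesZl// => j _; rewrite lee_fin.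
Qed.

(** The left-hand side keeps only the terms of the periodization whose index is congruent to q
    modulo N. *)
Lemma Per_dilate (g : R -> R) x (N : nat) (q : int) : (0 < N)%N -> (forall x, 0 <= g x) ->
  (\esum_(k in [set: int]) (g (x + 2 * (N%:Z * k + q)%:~R * pi))%:E <= Per g x)%E.
Proof.
move=> N0 g0; pose e (k : int) := N%:Z * k + q.
have bij : set_bij setT (range e) e.
  split=> // a b _ _ /addIr/mulfI; apply; lia.
rewrite -(reindex_esum _ _ _ (fun k => (g (x + 2 * k%:~R * pi))%:E) bij).
rewrite esum_mkcond /Per; apply: le_esum => k _.
by case: ifP => _; rewrite ?lee_fin.
Qed.
End PerSub.

(** * The dilation operator and the refinement equation *)

Section Scaling.
Variables (R : realType) (I : finType) (N : nat) (sg tau : I -> I) (alpha : I -> R[i]).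
Variables (theta : I -> R).
Hypotheses (N_gt0 : (0 < N)%N) (sgK : cancel sg tau) (tauK : cancel tau sg).
Hypothesis alpha1 : forall s, normc (alpha s) = 1.
Hypothesis thetaN : forall s, expi (N%:R * theta s) = expi (theta (sg s)).
Local Notation mu := (@lebesgue_measure R).
Local Notation K := (I -> L2 R).
Local Notation knorm := (inorm (@kdot R I)).
Local Notation ind := (@period_indic R 0).
Local Notation U := (@kU R I N sg alpha).
Local Notation rN := (Num.sqrt N%:R : R).
Implicit Types (m : R -> R[i]) (y : K).

Let n0 : 0 < N%:R :> R. Proof. by rewrite ltr0n. Qed.
Let r0 : 0 < rN. Proof. by rewrite sqrtr_gt0. Qed.
Let rr : rN ^+ 2 = N%:R. Proof. by rewrite (@sqr_sqrtr _ N%:R)// ltW. Qed.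

Lemma kU_lin a (x y : K) : U (a *: x + y) = a *: U x + U y.
Proof.
apply/funext => s; rewrite /kU.
have -> : (a *: x + y) (sg s) = a *: x (sg s) + y (sg s) by [].
rewrite codilation_lin//; change (alpha s *: (a *: codilation N (x (sg s)) + codilation N (y (sg s)))
  = a *: (alpha s *: codilation N (x (sg s))) + alpha s *: codilation N (y (sg s))).
by rewrite scalerDr !scalerA mulrC.
Qed.

Lemma kU_norm y : knorm (U y) = knorm y.
Proof.
apply/eqP; rewrite -(@eqrXn2 _ 2)// ?inorm_ge0//; apply/eqP/EFin_inj.
rewrite !sqr_knorm; congr (_ * _)%E; rewrite [RHS](reindex_inj (can_inj sgK))/=.
apply: eq_bigr => s _; rewrite !sqnorm_L2 (inormZ (L2dot_inner R)) alpha1 mul1r.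
by rewrite codilation_norm.
Qed.

Lemma codilationK (f : L2 R) : codilation N (dilation N f) = f.
Proof.
apply/L2_eqP; have h := ae_affine 0 n0 (mkL2E (cLfun2_dilation N_gt0 f)).
apply: ae_imp2 (codilationE N_gt0 (dilation N f)) h => x -> ; rewrite addr0 => ->.
rewrite mulrA -rmorphM mulfV ?gt_eqF// mul1r [_ / _]mulrAC mulfV ?mul1r//.
by rewrite gt_eqF.
Qed.

Lemma kU_surj y : exists x, U x = y.
Proof.
have a0 s : alpha s != 0.
  by apply/eqP => a0; have := alpha1 s; rewrite a0 normc0 => /esym/eqP; rewrite oner_eq0.
exists (fun t => (alpha (tau t))^-1 *: dilation N (y (tau t))).
apply/funext => s; rewrite /kU sgK; apply/L2_eqP.
have := codilation_lin N_gt0 (alpha s)^-1 (dilation N (y s)) 0.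
have h0 : codilation N (0 : L2 R) = 0.
  by have := codilationB N_gt0 (0 : L2 R) 0; rewrite !subrr.
by rewrite h0 !addr0 codilationK => ->; rewrite scalerA mulfV ?a0// scale1r; exact: aeW.
Qed.

Lemma kUE y s : \forall xi \ae mu, U y s xi = alpha s * (rN%:C * y (sg s) (N%:R * xi)).
Proof.
by apply: ae_imp2 (L2ZE (alpha s) (codilation N (y (sg s)))) (codilationE N_gt0 (y (sg s))) => x -> ->.
Qed.

(** The factor w is the product of the weights alpha along the orbit of s; its modulus is all that
    the estimates require. *)
Lemma iter_kUE n y s : exists2 w, normc w = 1 & \forall xi \ae mu,
  iter n U y s xi = w * ((rN ^+ n)%:C * y (iter n sg s) (N%:R ^+ n * xi)).
Proof.
elim: n s => [|n IH] s.
  by exists 1; [rewrite normcC normr1|apply: aeW => x; rewrite !expr0 !mul1r].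
have [w w1 hw] := IH (sg s); exists (alpha s * w); first by rewrite normcM alpha1 w1 mulr1.
have h := ae_affine 0 n0 hw; have -> : iter n.+1 sg s = iter n sg (sg s) by exact: iterSr.
apply: ae_imp2 (kUE (iter n U y) s) h => xi; rewrite iterS => ->; rewrite addr0 => ->.
by rewrite !exprSr rmorphM/= -[N%:R ^+ n * _ * _]mulrA; ring.
Qed.

Variable phi : K.
Local Notation G := (bracket theta phi).

(* Condition (ii), on the Fourier side. *)
Definition refinement m := \forall xi \ae mu, forall s,
  alpha s * rN%:C * phi (sg s) (N%:R * xi) = m (theta s + xi) * phi s xi.

Hypothesis G1 : \forall eta \ae mu, G eta = 1%E.

(** By the refinement equation, |m (eta)|^2 times the term (s, k) of the bracket at eta is N times a
    term of index sg s of the bracket at N eta. For fixed s these terms form a residue class modulo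
    N, displaced by q because N theta_s and theta_{sg s} differ by 2 pi q. Hence |m (eta)|^2 G (eta)
    <= N G (N eta), and both brackets are 1. *)
Lemma refinement_normc m : periodic m -> refinement m ->
  \forall eta \ae mu, normc (m eta) <= rN.
Proof.
move=> mper ref.
pose dens s (t : R) : R := normc (phi s t) ^+ 2.
have d0 s t : 0 <= dens s t by exact: sqr_ge0.
have href : \forall eta \ae mu, forall s (k : int),
    N%:R * dens (sg s) (N%:R * (eta - theta s + 2 * k%:~R * pi)) =
    normc (m eta) ^+ 2 * dens s (eta - theta s + 2 * k%:~R * pi).
  apply: (@ae_forall R I (fun s eta => forall k, _)) => s; apply: ae_forall => k.
  have := ae_affine (- theta s + 2 * k%:~R * pi) ltr01 ref.
  apply: ae_imp => eta; rewrite mul1r addrA => /(_ s) /(congr1 (fun w : R[i] => normc w ^+ 2)).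
  rewrite !normcM !exprMn alpha1 expr1n mul1r normcC ger0_norm ?(ltW r0)// rr => ->.
  rewrite (_ : theta s + _ = eta + 2 * pi * k%:~R); last by ring.
  by rewrite mper.
apply: ae_imp3 href G1 (ae_affine 0 n0 G1) => eta h g1; rewrite addr0 => gN.
rewrite -(@ler_pXn2r _ 2)// ?nnegrE ?normc_ge0 ?(ltW r0)// rr -lee_fin.
rewrite -[leLHS]mule1 -g1 -[leRHS]mule1 -gN /bracket.
have P0 s x : (0 <= Per (dens s) x)%E by apply: esum_ge0 => k _; rewrite lee_fin.
rewrite ge0_sume_distrr; last by move=> s _; exact: P0.
rewrite ge0_sume_distrr; last by move=> s _; exact: P0.
rewrite [leRHS](reindex_inj (can_inj sgK))/=; apply: lee_sum => s _.
rewrite -(PerZ _ (sqr_ge0 _) (d0 s)) -(PerZ _ (ler0n _ _) (d0 (sg s))).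
have [q hq] := expi_eq (thetaN s).
have := @Per_dilate R (fun t => N%:R * dens (sg s) t) (N%:R * eta - theta (sg s)) N (- q) N_gt0.
move=> /(_ (fun x => mulr_ge0 (ltW n0) (d0 _ _))); apply: le_trans.
rewrite le_eqVlt; apply/orP; left; apply/eqP; apply: eq_esum => k _.
congr (_%:E); rewrite -h; congr (_ * dens _ _).
rewrite rmorphD rmorphM rmorphN/= mulrDr mulrBr hq; ring.
Qed.

Lemma refinement_kU m : cmeasurable m -> periodic m -> (fun x => (ind x)%:C * m x) \in cLfun 2%:E ->
  refinement m <-> U phi = synthesis theta phi m.
Proof.
move=> mm mper mL; split.
  move=> ref; apply/funext => s; apply/L2_eqP.
  apply: ae_imp3 (kUE phi s) (synthesisE G1 s mm mper mL) ref => x -> -> h.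
  by rewrite mulrA h.
move=> e; apply: ae_forall => s; apply: ae_imp2 (kUE phi s) (synthesisE G1 s mm mper mL) => x.
by rewrite e => h1 h2; rewrite -mulrA -h1 h2.
Qed.

(** The new symbol is m (N t) m0 (t), periodic because N is an integer. Its square integrability on
    a period is read off from the finite norm of U (synthesis m). *)
Lemma kU_synthesis m m0 : cmeasurable m -> periodic m -> (fun x => (ind x)%:C * m x) \in cLfun 2%:E ->
  cmeasurable m0 -> periodic m0 -> refinement m0 ->
  exists m', [/\ cmeasurable m', periodic m', (fun x => (ind x)%:C * m' x) \in cLfun 2%:E &
    U (synthesis theta phi m) = synthesis theta phi m'].
Proof.
move=> mm mper mL mm0 mper0 ref; pose m' t := m (N%:R * t) * m0 t.
have mNper : periodic (fun t => m (N%:R * t)).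
  move=> x k; rewrite (_ : N%:R * _ = N%:R * x + 2 * pi * (N%:Z * k)%:~R) ?mper//.
  by rewrite intrM; ring.
have mm' : cmeasurable m'.
  by apply: cmeasurableM => //; apply: (cmeasurable_comp mm); exact: measurable_funM.
have mper' : periodic m' by move=> x k; rewrite /m' mNper mper0.
have h s : \forall xi \ae mu, U (synthesis theta phi m) s xi = m' (theta s + xi) * phi s xi.
  have h1 := ae_affine 0 n0 (synthesisE G1 (sg s) mm mper mL).
  apply: ae_imp3 (kUE (synthesis theta phi m) s) h1 ref => xi ->; rewrite addr0 => -> /(_ s) e.
  have [q hq] := expi_eq (thetaN s).
  rewrite /m' -mulrA -e (_ : N%:R * (_ + _) = theta (sg s) + N%:R * xi + 2 * pi * q%:~R).
    by rewrite mper; ring.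
  by rewrite mulrDr hq; ring.
have mL' : (fun x => (ind x)%:C * m' x) \in cLfun 2%:E.
  apply/cLfun2P; split; first exact: cmeasurable_period_cut.
  rewrite -(sqnorm_synthesis G1)//; apply: lte_sum_pinfty => s _.
  by rewrite (sqnorm_L2_eq (cmeasurable_synthesis _ _ _ mm') (h s)) ltry.
exists m'; split => //; apply/funext => s; apply/L2_eqP.
by apply: ae_imp2 (h s) (synthesisE G1 s mm' mper' mL') => xi -> ->.
Qed.
End Scaling.

(** * Density of the union *)

Section SpanDistance.
Variables (R : realType) (V : lmodType R[i]) (dot : V -> V -> R[i]) (e : nat -> V).
Hypotheses (dotP : inner_product dot) (eP : forall k l, dot (e k) (e l) = (k == l)%:R).
Local Notation energy y := (\sum_(0 <= j <oo) (normc (dot y (e j)) ^+ 2)%:E)%E.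
Local Notation S := (fourier_sum dot e).

Lemma partial_energy_le y n : ((\sum_(j < n) normc (dot y (e j)) ^+ 2)%:E <= energy y)%E.
Proof.
rewrite -sumEFin -(big_mkord xpredT (fun j => (normc (dot y (e j)) ^+ 2)%:E)).
by apply: nneseries_lim_ge => j _; rewrite lee_fin sqr_ge0.
Qed.

(** |y|^2 - energy y is the squared distance of y to the closed span, and v belongs to that span. *)
Lemma energy_deficit_le y v (s : R) : (energy y <= s%:E)%E -> hcvg dot (fun n => S n v) v ->
  inorm dot y ^+ 2 - s <= inorm dot (y - v) ^+ 2.
Proof.
move=> ys hv; case: (lerP (inorm dot y ^+ 2 - s) 0) => [|t0].
  by move=> /le_trans; apply; exact: sqr_ge0.
rewrite -[leLHS](@sqr_sqrtr _ (inorm dot y ^+ 2 - s)) ?(ltW t0)//.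
rewrite ler_pXn2r// ?nnegrE ?sqrtr_ge0 ?inorm_ge0//; apply/ler_addgt0Pr => d d0.
have [n hn] := hv _ d0; have {}hn := hn n (leqnn n).
apply: (@le_trans _ _ (inorm dot (y - S n y))).
  rewrite -(@ler_pXn2r _ 2)// ?nnegrE ?sqrtr_ge0 ?inorm_ge0//.
  rewrite (@sqr_sqrtr _ (inorm dot y ^+ 2 - s)) ?(ltW t0)// (sqr_inorm_sub_fourier_sum dotP eP).
  by rewrite lerB// -lee_fin (le_trans (partial_energy_le y n)).
apply: le_trans (fourier_sum_best dotP eP _ (fun j : 'I_n => dot v (e j))) _.
apply: le_trans (le_inorm_dist dotP _ v _) _.
by rewrite lerD2l (inormBC dotP) ltW.
Qed.

(** Conversely, the partial sums realize this distance in the limit. *)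
Lemma energy_approx y (d : R) : 0 < d -> ((inorm dot y ^+ 2)%:E < energy y + (d ^+ 2)%:E)%E ->
  exists n, inorm dot (y - S n y) < d.
Proof.
move=> d0 h; apply: contrapT => /forallNP no.
suff : (energy y + (d ^+ 2)%:E <= (inorm dot y ^+ 2)%:E)%E by rewrite leNgt h.
rewrite -leeBrDr//; apply: lime_le; first by apply: is_cvg_nneseries => j _ _; rewrite lee_fin sqr_ge0.
apply: nearW => n; rewrite big_mkord sumEFin -EFinB lee_fin.
have : d ^+ 2 <= inorm dot (y - S n y) ^+ 2.
  by rewrite ler_pXn2r ?nnegrE ?inorm_ge0 ?(ltW d0)// leNgt; apply/negP; exact: no.
by rewrite (sqr_inorm_sub_fourier_sum dotP eP); lra.
Qed.
End SpanDistance.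

Section SpreadPhases.
Variables (R : realType).

(** The minimum is started from 1, which also settles an empty family. *)
Lemma finite_lower_bound (J : finType) (f : J -> R) : (forall j, 0 < f j) ->
  exists2 d, 0 < d & forall j, d <= f j.
Proof.
move=> f0; exists (\big[Order.min/1]_j f j).
  by apply/bigmin_gtP; split=> // j _.
by move=> j; apply: bigmin_le_cond.
Qed.

(* Representatives of the phases that stay away from each other and from the ends of a period. *)
Lemma spread_phases (I : finType) (theta : I -> R) : injective (fun s => expi (theta s)) ->
  exists th a d, [/\ 0 < d, forall s, expi (th s) = expi (theta s),
    forall s, a + d <= th s <= a + 2 * pi - d &
    forall s t, s != t -> d + d <= `|th s - th t|].
Proof.
move=> inj.
pose th s := to_period (theta s); have p0 := pi2_gt0 R.
have thE s : expi (th s) = expi (theta s).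
  by rewrite /th /to_period expiD expiNV mulrAC expi_2piz invr1 mulr1.
have /choice[k hk] : forall s, exists k : int, 0 <= theta s + 2 * pi * k%:~R < 2 * pi.
  by move=> s; exact: int_translate.
have thb s : 0 <= th s < 2 * pi.
  by rewrite /th -(to_period_periodic (theta s) (k s)) to_period_id.
have [d1 d10 h1] := @finite_lower_bound I (fun s => 2 * pi - th s) ltac:(by move=> s; have := thb s; lra).
have [d2 d20 h2] := @finite_lower_bound (I * I)%type
  (fun st => if st.1 == st.2 then 1 else `|th st.1 - th st.2|)
  ltac:(move=> [s t] /=; case: eqVneq => // st; rewrite normr_gt0 subr_eq0;
        apply: contra_neq st => e; apply: inj; by rewrite -!thE e).
(* The phases lie between 0 and 2 pi - d1; a period that starts at -d1 / 2 shares the free margin d1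
   between its two ends. *)
exists th, (- (d1 / 2)), (Num.min d1 d2 / 2); split => //.
- by rewrite divr_gt0// lt_min d10.
- move=> s; have := thb s; have := h1 s => h3 h4.
  by have := ge_min d1 d1 d2; rewrite lexx/= => h5; apply/andP; split; lra.
- move=> s t st; have := h2 (s, t); rewrite /= (negbTE st) => h3.
  by rewrite -splitr (le_trans _ h3)// ge_min lexx orbT.
Qed.
End SpreadPhases.

(** * Scalar products with families of short support *)

Section WindowEnergy.
Variables (R : realType) (I : finType) (theta th : I -> R) (phi : I -> L2 R) (a d : R).
Local Notation mu := (@lebesgue_measure R).
Local Notation cint := (cintegral setT).
Hypothesis phi_le1 : forall s, \forall xi \ae mu, normc (phi s xi) <= 1.
Hypothesis thE : forall s, expi (th s) = expi (theta s).
Hypothesis th_itv : forall s, a + d <= th s <= a + 2 * pi - d.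
Hypothesis th_sep : forall s t, s != t -> d + d <= `|th s - th t|.
Variable u : I -> R -> R[i].
Hypotheses (uL : forall s, u s \in cLfun 2%:E) (u_supp : forall s x, d <= `|x| -> u s x = 0).

(** Because u_s lives in (-d, d), the functions g_s have disjoint supports inside the single period
    [a, a + 2 pi[: the periodization reduces to the plain sum b of the g_s. *)
Let g s eta := u s (eta - th s) * conjc (phi s (eta - th s)).

Let gL s : g s \in cLfun 2%:E.
Proof.
have h := ae_affine (- th s) ltr01 (phi_le1 s).
have uL' : (fun eta => u s (1 * eta - th s)) \in cLfun 2%:E by exact: cLfun2_affine.
have mf : cmeasurable (fun eta : R => conjc (phi s (1 * eta - th s))).
  apply: cmeasurableJ; apply: (cmeasurable_comp (L2_cmeasurable (phi s))).
  by apply: measurable_funB => //; exact: measurable_funM.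
have -> : g s = (fun eta => conjc (phi s (1 * eta - th s)) * u s (1 * eta - th s)).
  by apply/funext => x; rewrite mul1r mulrC.
by apply: (@cLfun2_bounded _ _ _ 1 uL' mf); apply: ae_imp h => x hx; rewrite normcJ'.
Qed.

Let b eta := \sum_s g s eta.

Let bL : b \in cLfun 2%:E. Proof. by apply: cLfun2_sum => s; exact: gL. Qed.

Let g_supp s eta : d <= `|eta - th s| -> g s eta = 0.
Proof. by move=> h; rewrite /g u_supp// mul0r. Qed.

Let b_supp : supported a b.
Proof.
move=> eta h; rewrite /b big1// => s _; apply: g_supp.
have := th_itv s => /andP[h1 h2]; rewrite leNgt; apply/negP; rewrite ltr_norml => /andP[h3 h4].
by apply: h; apply/andP; split; lra.
Qed.

Let sqr_b eta : normc (b eta) ^+ 2 = \sum_s normc (g s eta) ^+ 2.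
Proof.
have [[s hs]|no] := pselect (exists s, `|eta - th s| < d); last first.
  have g0 s : g s eta = 0 by apply: g_supp; rewrite leNgt; apply/negP => h; apply: no; exists s.
  by rewrite /b !big1 ?normc0 ?expr0n// => s _; rewrite g0 normc0 expr0n.
have g0 t : t != s -> g t eta = 0.
  move=> ts; apply: g_supp; rewrite leNgt; apply/negP => ht.
  have := th_sep ts; rewrite leNgt => /negP; apply.
  rewrite (_ : th t - th s = (eta - th s) - (eta - th t)); last by ring.
  by rewrite (le_lt_trans (ler_normB _ _))// ltrD.
rewrite /b (bigD1 s)//= big1 ?addr0 => [|t /g0//].
by rewrite [RHS](bigD1 s)//= big1 ?addr0// => t /g0 ->; rewrite normc0 expr0n.
Qed.

Let coef j : kdot (fun s => mkL2 (u s)) (kpow theta (- zenum j) phi) =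
  ((2 * pi)^-1)%:C * cint (fun eta => b eta * expi (- ((zenum j)%:~R * eta))).
Proof.
have mu_ s : cmeasurable (u s) by have [] := (cLfun2P (u s)).1 (uL s).
rewrite (kdot_fun (u := u) (v := fun s xi => expi (- ((- zenum j)%:~R * (theta s + xi))) * phi s xi))//.
- congr (_ * _).
  pose F s eta := g s eta * expi (- ((zenum j)%:~R * eta)).
  have Fi s : cintegrable (F s).
    have gi : cintegrable (g s).
      have := cLfun2_mul (cLfun2_affine (- th s) ltr01 (uL s)) (cLfun2J (cLfun2_affine (- th s) ltr01 (L2_fun (phi s)))).
      by under eq_fun do rewrite mul1r.
    have := cintegrable_expiM (- (zenum j)%:~R) gi.
    by under eq_fun do rewrite mulNr.
  transitivity (\sum_s cint (F s)).
    apply: eq_bigr => s _; have [_] := cint_affine (th s) ltr01 (Fi s).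
    rewrite invr1 mul1r => <-; congr cintegral; apply/funext => x.
    rewrite /F /g mul1r addrK conjcM expiJ opprK -mulrA; congr (_ * _).
    rewrite mulrC; congr (_ * _); rewrite !intrN !mulNr.
    rewrite !mulrDr !opprD !expiD [RHS]mulrC; congr (_ * _).
    (* The frequency is an integer, so the phase depends on theta_s only through e^{i theta_s}, and
       th_s may replace theta_s. *)
    by rewrite !expiNV !expiXz thE.
  rewrite -cint_sum//; congr cintegral; apply/funext => x.
  by rewrite /b mulr_suml.
- move=> s; apply: cmeasurableM; last exact: L2_cmeasurable.
  by apply: cmeasurable_expi; exact: measurable_kphase.
- by move=> s; exact: mkL2E.
- by move=> s; exact: kpowE.
Qed.

(** Parseval's identity for b; the disjoint supports remove all cross terms between the
    components. *)
Lemma window_energy :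
  (\sum_(0 <= j <oo) (normc (kdot (fun s => mkL2 (u s)) (kpow theta (- zenum j) phi)) ^+ 2)%:E =
   ((2 * pi)^-1)%:E * \sum_s \int[mu]_xi (normc (u s xi) ^+ 2 * normc (phi s xi) ^+ 2)%R%:E)%E.
Proof.
have p0 := pi2_gt0 R.
have mu_ s : cmeasurable (u s) by have [] := (cLfun2P (u s)).1 (uL s).
transitivity ((((2 * pi)^-1) ^+ 2)%:E * ((2 * pi)%:E * sqnorm b))%E.
  rewrite -(parseval_period bL b_supp) -nneseriesZl; last by move=> j _; rewrite lee_fin sqr_ge0.
  apply: eq_eseriesr => j _; rewrite coef normcM exprMn normcC ger0_norm ?invr_ge0 ?(ltW p0)//.
rewrite muleA -EFinM expr2 -mulrA mulVf ?gt_eqF// mulr1; congr (_ * _)%E.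
have mg s : measurable_fun setT (fun eta => (normc (g s eta) ^+ 2)%:E).
  by apply: measurable_sqnorm; have [] := (cLfun2P (g s)).1 (gL s).
transitivity (\sum_s \int[mu]_eta (normc (g s eta) ^+ 2)%:E)%E.
  rewrite -ge0_integral_sum//; last by move=> s x _; rewrite lee_fin sqr_ge0.
  by apply: eq_integral => x _; rewrite sqr_b sumEFin.
apply: eq_bigr => s _.
have := @ge0_integral_affine _ (fun eta => (normc (g s eta) ^+ 2)%:E) 1 (th s) ltr01 (mg s).
move=> /(_ (fun x => _)) h; rewrite -[LHS]mul1e -[in LHS]invr1 -h.
  by apply: eq_integral => x _; rewrite /g mul1r addrK normcM normcJ' exprMn.
by move=> x; rewrite lee_fin sqr_ge0.
Qed.
End WindowEnergy.

Section Components.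
Variables (R : realType) (I : finType).
Local Notation K := (I -> L2 R).
Local Notation knorm := (inorm (@kdot R I)).

Lemma sqr_knormE (y : K) : knorm y ^+ 2 = (2 * pi)^-1 * \sum_s L2norm (y s) ^+ 2.
Proof.
apply: EFin_inj; rewrite sqr_knorm EFinM -sumEFin; congr (_ * _)%E.
by apply: eq_bigr => s _; exact: sqnorm_L2.
Qed.

Lemma sqr_component_le (y : K) s : L2norm (y s) ^+ 2 <= 2 * pi * knorm y ^+ 2.
Proof.
rewrite sqr_knormE mulrA mulfV ?gt_eqF ?pi2_gt0// mul1r (bigD1 s)//= lerDl.
by apply: sumr_ge0 => t _; exact: sqr_ge0.
Qed.

Lemma hcvg_components (u : nat -> K) (y : K) :
  (forall s, hcvg (@L2dot R) (fun n => u n s) (y s)) -> hcvg (@kdot R I) u y.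
Proof.
(* D = #|I| + 1 is positive even when I is empty, and #|I| / D^2 < 1; sqrt (2 pi) undoes the
   normalization of [kdot]. *)
move=> h e e0; pose D := #|I|.+1%:R : R; pose b := e * Num.sqrt (2 * pi) / D.
have p0 := pi2_gt0 R.
have D1 : 1 <= D by rewrite ler1n.
have D0 : 0 < D by rewrite ltr0n.
have b0 : 0 < b by rewrite divr_gt0// mulr_gt0// sqrt2pi_gt0.
have /choice[M hM] : forall s, exists M, forall n, (M <= n)%N -> L2norm (u n s - y s) < b.
  by move=> s; exact: (h s).
exists (\max_s M s) => n hn.
rewrite -(@ltr_pXn2r _ 2)// ?nnegrE ?inorm_ge0 ?(ltW e0)// sqr_knormE.
apply: (@le_lt_trans _ _ ((2 * pi)^-1 * \sum_(s : I) b ^+ 2)).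
  rewrite ler_wpM2l ?invr_ge0 ?(ltW p0)//; apply: ler_sum => s _.
  rewrite ler_pXn2r// ?nnegrE ?inorm_ge0 ?(ltW b0)//; apply: ltW; apply: hM.
  by rewrite (leq_trans _ hn)// leq_bigmax.
rewrite sumr_const -[X in _ * X]mulr_natl /b expr_div_n exprMn (@sqr_sqrtr _ (2 * pi)) ?(ltW p0)//.
have -> : (2 * pi)^-1 * (#|I|%:R * (e ^+ 2 * (2 * pi) / D ^+ 2)) = e ^+ 2 * (#|I|%:R / D ^+ 2).
  by move: (2 * pi) p0 => w w0; field; rewrite !gt_eqF.
rewrite gtr_pMr ?exprn_gt0// ltr_pdivrMr ?exprn_gt0// mul1r.
apply: (@lt_le_trans _ _ D); first by rewrite ltr_nat.
by rewrite expr2 ler_pMr.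
Qed.
End Components.

(** * Concentration near the origin under iteration of U *)

Section Concentration.
Variables (R : realType) (I : finType) (N : nat) (sg tau : I -> I) (alpha : I -> R[i]).
Variables (theta : I -> R) (phi : I -> L2 R).
Hypotheses (N_ge2 : (2 <= N)%N) (sgK : cancel sg tau) (tauK : cancel tau sg).
Hypothesis alpha1 : forall s, normc (alpha s) = 1.
Hypothesis theta_inj : injective (fun s => expi (theta s)).
Local Notation mu := (@lebesgue_measure R).
Local Notation K := (I -> L2 R).
Local Notation KP := (@kdot_inner R I).
Local Notation knorm := (inorm (@kdot R I)).
Local Notation U := (@kU R I N sg alpha).
Local Notation rN := (Num.sqrt N%:R : R).
Local Notation G := (bracket theta phi).
Local Notation E j := (kpow theta (- zenum j) phi).
Local Notation energy y := (\sum_(0 <= j <oo) (normc (kdot y (E j)) ^+ 2)%:E)%E.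
Hypothesis G1 : \forall eta \ae mu, G eta = 1%E.

Let N_gt0 : (0 < N)%N. Proof. exact: ltnW. Qed.
Let n0 : 0 < N%:R :> R. Proof. by rewrite ltr0n. Qed.
Let r0 : 0 < rN. Proof. by rewrite sqrtr_gt0. Qed.
Let rr : rN ^+ 2 = N%:R. Proof. by rewrite (@sqr_sqrtr _ N%:R)// ltW. Qed.
Let p0 := pi2_gt0 R.
Let Nn0 n : 0 < N%:R ^+ n :> R. Proof. exact: exprn_gt0. Qed.

(* [focus n t] is |phi_{sg^-n t} (N^-n x)|^2. *)
Definition focus n t (x : R) : R := normc (phi (iter n tau t) (N%:R ^- n * x)) ^+ 2.
(** 1 - [focus] is nonnegative only almost everywhere; the maximum makes the integrands nonnegative
    at every point. *)
Definition deficit n t x : R := Num.max 0 (1 - focus n t x).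

Lemma measurable_focus n t : measurable_fun setT (focus n t).
Proof.
apply: measurable_sqr_normc; apply: (cmeasurable_comp (L2_cmeasurable _)).
exact: measurable_funM.
Qed.

Lemma measurable_deficit n t : measurable_fun setT (deficit n t).
Proof.
by apply: measurable_maxr => //; apply: measurable_funB => //; exact: measurable_focus.
Qed.

Lemma deficit_itv n t x : 0 <= deficit n t x <= 1.
Proof. by rewrite /deficit le_max lexx/= ge_max ler01 lerBlDr lerDl sqr_ge0. Qed.

Lemma focus_le1 n t : \forall x \ae mu, focus n t x <= 1.
Proof.
have V0 : 0 < N%:R ^- n :> R by rewrite invr_gt0.
have := ae_affine 0 V0 (normc_le1_of_bracket G1 (iter n tau t)); apply: ae_imp => x.
by rewrite addr0 /focus => h; rewrite expr_le1 ?normc_ge0.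
Qed.

Lemma expn_large (A d : R) : 0 < d -> exists n1, forall n, (n1 <= n)%N -> A < d * N%:R ^+ n.
Proof.
move=> d0; exists (Num.trunc `|A / d|).+1 => n hn.
rewrite mulrC -ltr_pdivrMr//; apply: le_lt_trans (ler_norm _) _.
have h1 : `|A / d| < n%:R.
  apply: lt_le_trans (_ : (Num.trunc `|A / d|).+1%:R <= _); last by rewrite ler_nat.
  by have /andP[] := trunc_itv (normr_ge0 (A / d)).
apply: lt_le_trans h1 _; rewrite -natrX ler_nat; apply: ltnW.
exact: ltn_expl.
Qed.

Let iter_tau n s : iter n tau (iter n sg s) = s.
Proof. by elim: n s => // n IH s; rewrite iterSr iterS sgK IH. Qed.

(** As soon as A < d N^n, the components of U^n f are supported in (-d, d), where [window_energy]
    applies. The substitution x = N^n xi then restores f and moves the dilation to phi. *)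
Lemma iter_kU_energy (f : I -> R -> R[i]) (A : R) : (forall t, f t \in cLfun 2%:E) ->
  (forall t x, A < `|x| -> f t x = 0) -> exists n1, forall n, (n1 <= n)%N ->
  (energy (iter n U (fun t => mkL2 (f t))) =
   ((2 * pi)^-1)%:E * \sum_t \int[mu]_x (normc (f t x) ^+ 2 * focus n t x)%R%:E)%E.
Proof.
move=> fL fA; have [th [a [d [d0 thE th_itv th_sep]]]] := spread_phases theta_inj.
have [n1 hn1] := expn_large A d0; exists n1 => n /hn1 hn.
have /choice[w hw] : forall s, exists w, normc w = 1 /\ \forall xi \ae mu,
    iter n U (fun t => mkL2 (f t)) s xi =
    w * ((rN ^+ n)%:C * mkL2 (f (iter n sg s)) (N%:R ^+ n * xi)).
  by move=> s; have [w w1 hw] := iter_kUE sg N_gt0 alpha1 n (fun t => mkL2 (f t)) s; exists w.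
pose u s xi := w s * ((rN ^+ n)%:C * f (iter n sg s) (N%:R ^+ n * xi + 0)).
have uL s : u s \in cLfun 2%:E.
  by apply: cLfun2Z; apply: cLfun2Z; exact: cLfun2_affine.
have uE : iter n U (fun t => mkL2 (f t)) = (fun s => mkL2 (u s)).
  apply/funext => s; apply/L2_eqP.
  have h := ae_affine 0 (Nn0 n) (mkL2E (fL (iter n sg s))).
  apply: ae_imp3 (hw s).2 h (mkL2E (uL s)) => x -> h1 ->.
  by rewrite /u -h1 addr0.
have u_supp s x : d <= `|x| -> u s x = 0.
  move=> dx; rewrite /u addr0 fA ?mulr0// normrM ger0_norm ?(ltW (Nn0 n))//.
  by rewrite (lt_le_trans hn)// mulrC ler_wpM2l// ltW.
rewrite uE (window_energy (normc_le1_of_bracket G1) thE th_itv th_sep uL u_supp).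
congr (_ * _)%E; rewrite [RHS](reindex_inj (can_inj (iter_tau n)))/=.
apply: eq_bigr => s _; pose h x := (normc (f (iter n sg s) x) ^+ 2 * focus n (iter n sg s) x)%:E.
have mh : measurable_fun setT h.
  apply/measurable_EFinP; apply: measurable_funM; last exact: measurable_focus.
  by apply: measurable_sqr_normc; have [] := (cLfun2P (f (iter n sg s))).1 (fL _).
have h0 x : (0 <= h x)%E by rewrite lee_fin mulr_ge0 ?sqr_ge0.
transitivity (\int[mu]_xi ((N%:R ^+ n)%:E * h (N%:R ^+ n * xi + 0)%R))%E.
  apply: eq_integral => x _; rewrite /h -EFinM; congr (_%:E).
  rewrite /u addr0 !normcM (hw s).1 mul1r normcC ger0_norm ?exprn_ge0 ?(ltW r0)//.
  rewrite exprMn exprAC rr -mulrA; congr (_ * (_ * _)).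
  by rewrite /focus iter_tau mulrA mulVf ?gt_eqF// mul1r.
rewrite ge0_integralZl//; first by rewrite (ge0_integral_affine _ (Nn0 n) mh h0) muleA -EFinM mulfV ?gt_eqF// mul1e.
by apply: (measurableT_comp mh); apply: measurable_funD => //; exact: measurable_funM.
Qed.

(* For large n, the square of the distance of [U^n f] to [V0]. *)
Definition gap n (f : I -> R -> R[i]) : \bar R :=
  (((2 * pi)^-1)%:E * \sum_t \int[mu]_x (normc (f t x) ^+ 2 * deficit n t x)%R%:E)%E.

Lemma energy_gap (f : I -> R -> R[i]) (A : R) : (forall t, f t \in cLfun 2%:E) ->
  (forall t x, A < `|x| -> f t x = 0) -> exists n1, forall n, (n1 <= n)%N ->
  ((knorm (fun t => mkL2 (f t)) ^+ 2)%:E = energy (iter n U (fun t => mkL2 (f t))) + gap n f)%E.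
Proof.
move=> fL fA; have [n1 hn1] := iter_kU_energy fL fA; exists n1 => n /hn1 ->.
have c0 : 0 <= (2 * pi)^-1 :> R by rewrite invr_ge0 ltW.
have mf t : measurable_fun setT (fun x => normc (f t x) ^+ 2).
  by apply: measurable_sqr_normc; have [] := (cLfun2P (f t)).1 (fL _).
rewrite sqr_knorm /gap -ge0_muleDr; last 2 first.
- by apply: sume_ge0 => t _; apply: integral_ge0 => x _; rewrite lee_fin mulr_ge0 ?sqr_ge0.
- apply: sume_ge0 => t _; apply: integral_ge0 => x _; rewrite lee_fin mulr_ge0 ?sqr_ge0//.
  by have /andP[] := deficit_itv n t x.
congr (_ * _)%E; rewrite -big_split/=; apply: eq_bigr => t _.
have m1 : measurable_fun setT (fun x => (normc (f t x) ^+ 2 * focus n t x)%:E).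
  by apply/measurable_EFinP; apply: measurable_funM; [exact: mf|exact: measurable_focus].
have m2 : measurable_fun setT (fun x => (normc (f t x) ^+ 2 * deficit n t x)%:E).
  by apply/measurable_EFinP; apply: measurable_funM; [exact: mf|exact: measurable_deficit].
have f0 x : (0 <= (normc (f t x) ^+ 2 * focus n t x)%:E)%E by rewrite lee_fin mulr_ge0 ?sqr_ge0.
have d0 x : (0 <= (normc (f t x) ^+ 2 * deficit n t x)%:E)%E.
  by rewrite lee_fin mulr_ge0 ?sqr_ge0//; have /andP[] := deficit_itv n t x.
rewrite sqnorm_L2 L2norm_mkL2// -ge0_integralD//; apply: ae_eq_integral => //.
- by apply/measurable_EFinP; exact: mf.
- exact: emeasurable_funD.
apply: ae_imp (focus_le1 n t) => x fx _; rewrite -EFinD -mulrDr /deficit max_r ?subr_ge0//.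
by rewrite addrC subrK mulr1.
Qed.

Let c0 : 0 < (2 * pi)^-1 :> R. Proof. by rewrite invr_gt0. Qed.

Lemma gap_ge0 n f : (0 <= gap n f)%E.
Proof.
rewrite mule_ge0 ?lee_fin ?(ltW c0)//; apply: sume_ge0 => t _; apply: integral_ge0 => x _.
by rewrite lee_fin mulr_ge0 ?sqr_ge0//; have /andP[] := deficit_itv n t x.
Qed.

Let EP : forall k l, kdot (kpow theta k phi) (kpow theta l phi) = (k == l)%:R.
Proof. exact/orthonormal_bracketP. Qed.
Let enP := shift_orthonormal EP.
Local Notation W := (fourier_rep N sg theta alpha).
Local Notation V0 := (@hclosure R W (@lin_span R W (fun k => kpow theta k phi))).
Let V0P := @shift_spanP R I N sg alpha theta phi EP.

Let kU_n n (y z : K) : iter n U (y - z) = iter n U y - iter n U z.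
Proof. exact: (@iter_isometryB _ W (kU_lin sg alpha N_gt0)). Qed.

Let kU_n_norm n (y : K) : knorm (iter n U y) = knorm y.
Proof. exact: (@iter_isometry_norm _ W (kU_norm N_gt0 sgK alpha1)). Qed.

(** If every U^n y lies in V0, then the distance from U^n f to V0 is at most |U^n (f - y)| = |f -
    y|. The lemma is applied to y = phi and to truncations f of phi, whose bounded support the
    distance formula requires. *)
Lemma gap_le (f : I -> R -> R[i]) (A : R) (y : K) : (forall t, f t \in cLfun 2%:E) ->
  (forall t x, A < `|x| -> f t x = 0) -> (forall n, V0 (iter n U y)) ->
  exists n1, forall n, (n1 <= n)%N -> (gap n f <= (knorm ((fun t => mkL2 (f t)) - y) ^+ 2)%:E)%E.
Proof.
move=> fL fA Vy; have [n1 hn1] := energy_gap fL fA; exists n1 => n /hn1.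
set z : K := fun t => mkL2 (f t) => e.
have e0 : (0 <= energy (iter n U z))%E by apply: nneseries_ge0 => j _ _; rewrite lee_fin sqr_ge0.
have efin : energy (iter n U z) \is a fin_num.
  rewrite ge0_fin_numE//; apply: le_lt_trans (ltry (knorm z ^+ 2)).
  by rewrite e leeDl// gap_ge0.
have := energy_deficit_le KP enP (s := fine (energy (iter n U z))) _ ((V0P _).1 (Vy n)).
move=> /(_ (iter n U z)); rewrite fineK// lexx => /(_ isT).
rewrite -kU_n !kU_n_norm => h.
have -> : gap n f = ((knorm z ^+ 2)%:E - energy (iter n U z))%E by rewrite e addeAC subee// add0e.
by rewrite -[X in (_ - X)%E]fineK// -EFinB lee_fin.
Qed.

(* The set where the limit superior of [focus n t] is smaller than 1. *)
Definition unfocused t : set R :=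
  \bigcup_k \bigcup_M \bigcap_n [set x | focus (n + M) t x <= 1 - k.+1%:R^-1].

Let tight t k M : set R := \bigcap_n [set x | focus (n + M) t x <= 1 - k.+1%:R^-1].

Let measurable_tight t k M : measurable (tight t k M).
Proof.
apply: bigcapT_measurable => n.
have := measurable_focus (n + M) t measurableT (measurable_itv `]-oo, (1 - k.+1%:R^-1)%R]).
by rewrite setTI; congr measurable; apply/seteqP; split => x /=; rewrite in_itv.
Qed.

Lemma measurable_unfocused t : measurable (unfocused t).
Proof.
apply: bigcupT_measurable => k; apply: bigcupT_measurable => M; exact: measurable_tight.
Qed.

Let wc m t : R -> R[i] := wcut m (phi t).
Let wcL m t : wc m t \in cLfun 2%:E. Proof. exact: cLfun2_wcut. Qed.
Let wc_supp m t x : m%:R < `|x| -> wc m t x = 0. Proof. exact: wcut_support. Qed.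

(** On a set [tight t k M] the deficit is at least 1 / (k + 1) from the index M on. The mass of
    phi_t on a bounded part of it is therefore at most a constant times the gap of a truncation of
    phi, and this gap is as small as desired. *)
Lemma vanish_on_unfocused : (forall n, V0 (iter n U phi)) ->
  forall t, \forall x \ae mu, unfocused t x -> phi t x = 0.
Proof.
move=> Vphi t.
suff h k M m' : \forall x \ae mu, cutoff (tight t k M `&` window m') (phi t) x = 0.
  have := ae_forall (fun k => ae_forall (fun M => ae_forall (h k M))).
  apply: ae_imp => x {}h [k _ [M _ tx]].
  have [m' xm'] : exists m' : nat, window m' x.
    exists (Num.trunc `|x|).+1; rewrite /window /= in_itv/= -ler_norml ltW//.
    by have /andP[] := trunc_itv (normr_ge0 x).
  by have := h k M m'; rewrite cutoffE mem_set.
have mB : measurable (tight t k M `&` window m').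
  by apply: measurableI; [exact: measurable_tight|exact: measurable_window].
set B := tight _ _ _ `&` _ in mB *.
apply: sqnorm_eq0; first by apply: cmeasurable_cutoff => //; exact: L2_cmeasurable.
apply/eqP; rewrite eq_le sqnorm_ge0 andbT; apply/lee_addgt0Pr => e e0; rewrite add0e.
(* k + 1 compensates the lower bound on the deficit, and 2 pi the normalization of [gap]. *)
pose C := k.+1%:R * (2 * pi) : R.
have C0 : 0 < C by rewrite mulr_gt0// ltr0n.
pose dl := Num.sqrt (e / C).
have dl0 : 0 < dl by rewrite sqrtr_gt0 divr_gt0.
have [m1 hm1] := hcvg_components (fun s => wcut_cvg (phi s)) dl0.
pose m := maxn m1 m'; have {}hm1 := hm1 m (leq_maxl _ _).
have [n1 hn1] := gap_le (wcL m) (@wc_supp m) Vphi.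
(* The index n1 + M is late enough both for the estimate of the gap and for the lower bound on the
   deficit. *)
have hn : (n1 <= n1 + M)%N by exact: leq_addr.
have {hn1 hn} hg := hn1 _ hn.
have h1 : (gap (n1 + M) (wc m) <= (e / C)%:E)%E.
  apply: le_trans hg _; have -> : e / C = dl ^+ 2.
    by rewrite /dl (@sqr_sqrtr _ (e / C))// ltW// divr_gt0.
  by rewrite lee_fin ler_pXn2r ?nnegrE ?inorm_ge0 ?(ltW dl0)// ltW.
apply: (@le_trans _ _ (C%:E * gap (n1 + M) (wc m))%E); last first.
  apply: le_trans (lee_wpmul2l _ h1) _; first by rewrite lee_fin ltW.
  by rewrite -EFinM mulrC divfK// gt_eqF.
rewrite /gap muleA -EFinM /C -mulrA mulfV ?gt_eqF// mulr1.
have m2 s : measurable_fun setT (fun x => (normc (wc m s x) ^+ 2 * deficit (n1 + M) s x)%:E).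
  apply/measurable_EFinP; apply: measurable_funM; last exact: measurable_deficit.
  by apply: measurable_sqr_normc; have [] := (cLfun2P (wc m s)).1 (wcL m s).
have d0 s x : (0 <= (normc (wc m s x) ^+ 2 * deficit (n1 + M) s x)%:E)%E.
  by rewrite lee_fin mulr_ge0 ?sqr_ge0//; have /andP[] := deficit_itv (n1 + M) s x.
apply: (@le_trans _ _ (k.+1%:R%:E * \int[mu]_x (normc (wc m t x) ^+ 2 * deficit (n1 + M) t x)%:E)%E); last first.
  rewrite lee_wpmul2l ?lee_fin// (bigD1 t)//= leeDl// sume_ge0// => s _.
  by apply: integral_ge0 => x _; exact: d0.
have kk : (0 <= k.+1%:R%:E :> \bar R)%E by rewrite lee_fin ler0n.
rewrite -ge0_integralZl//; last exact: m2.
have mc : measurable_fun setT (fun x => (normc (cutoff B (phi t) x) ^+ 2)%:E).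
  by apply: measurable_sqnorm; apply: cmeasurable_cutoff => //; exact: L2_cmeasurable.
have me : measurable_fun setT (fun x => k.+1%:R%:E * (normc (wc m t x) ^+ 2 * deficit (n1 + M) t x)%:E)%E.
  by apply: emeasurable_funM.
apply: ge0_le_integral => //; first by move=> x _; rewrite lee_fin sqr_ge0.
move=> x _; rewrite cutoffE; case: ifPn => [|_]; last first.
  by rewrite normc0 expr0n/=; apply: mule_ge0 => //; rewrite lee_fin.
rewrite inE => -[/(_ n1 Logic.I) /= fx xm].
have xw : window m x.
  move: xm; rewrite /window /= !in_itv/= -!ler_norml => /le_trans; apply.
  by rewrite ler_nat leq_maxr.
rewrite -EFinM lee_fin /wc /wcut cutoffE mem_set// mulrCA ler_peMr ?sqr_ge0//.
rewrite mulrC -ler_pdivrMr// mul1r /deficit le_max; apply/orP; right.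
by rewrite lerBrDl -lerBrDr.
Qed.

Variable q : I -> nat.
Hypothesis q_period : forall t, iter (q t) sg t = t.

(** As t has period q t under sg, dilation by N^(q t) shifts the sequence of the [focus n t] by q t
    terms, which leaves its limit superior unchanged. *)
Lemma unfocused_dilate t x : unfocused t (N%:R ^+ q t * x) <-> unfocused t x.
Proof.
have it : iter (q t) tau t = t by have := iter_tau (q t) t; rewrite q_period.
have e n : focus (n + q t) t (N%:R ^+ q t * x) = focus n t x.
  rewrite /focus iterD it; congr (normc (phi _ _) ^+ 2).
  by rewrite exprD invfM mulrA mulfVK// gt_eqF.
split=> -[k _ [M _ h]]; exists k => //.
  exists M => // n _ /=; have := h (n + q t)%N Logic.I.
  by rewrite /= addnAC e.
exists (M + q t)%N => // n _ /=; have := h n Logic.I.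
by rewrite /= addnA e.
Qed.

(* Condition (iii), on the Fourier side. *)
Hypothesis nonvanishing : forall t (A : set R), measurable A -> (0 < mu A)%E ->
  (fun x => (N ^ q t)%:R * x) @` A = A -> ~ \forall x \ae mu, A x -> phi t x = 0.

Lemma unfocused_null : (forall n, V0 (iter n U phi)) ->
  forall t, \forall x \ae mu, ~ unfocused t x.
Proof.
move=> Vphi t; have mE := measurable_unfocused t.
have : mu (unfocused t) = 0%E.
  apply/eqP; rewrite eq_le measure_ge0 andbT leNgt; apply/negP => E0.
  apply: (nonvanishing mE E0 _ (vanish_on_unfocused Vphi t)).
  rewrite natrX; apply/seteqP; split => [_ [x Ex <-]|x Ex]; first exact/unfocused_dilate.
  exists (N%:R ^- q t * x); last by rewrite mulrA mulfV ?mul1r// gt_eqF.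
  by apply/unfocused_dilate; rewrite mulrA mulfV ?mul1r// gt_eqF.
by move=> E0; exists (unfocused t); split => // x /= /contrapT.
Qed.
End Concentration.

Section Density.
Variables (R : realType) (I : finType) (N : nat) (sg tau : I -> I) (alpha : I -> R[i]).
Variables (theta : I -> R) (phi : I -> L2 R).
Hypotheses (N_ge2 : (2 <= N)%N) (sgK : cancel sg tau) (tauK : cancel tau sg).
Hypothesis alpha1 : forall s, normc (alpha s) = 1.
Hypothesis thetaN : forall s, expi (N%:R * theta s) = expi (theta (sg s)).
Hypothesis theta_inj : injective (fun s => expi (theta s)).
Local Notation mu := (@lebesgue_measure R).
Local Notation K := (I -> L2 R).
Local Notation KP := (@kdot_inner R I).
Local Notation knorm := (inorm (@kdot R I)).
Local Notation U := (@kU R I N sg alpha).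
Local Notation rN := (Num.sqrt N%:R : R).
Local Notation G := (bracket theta phi).
Local Notation E j := (kpow theta (- zenum j) phi).
Local Notation W := (fourier_rep N sg theta alpha).
Local Notation V0 := (@hclosure R W (@lin_span R W (fun k => kpow theta k phi))).
Hypothesis G1 : \forall eta \ae mu, G eta = 1%E.

Let N_gt0 : (0 < N)%N. Proof. exact: ltnW. Qed.
Let n0 : 0 < N%:R :> R. Proof. by rewrite ltr0n. Qed.
Let r0 : 0 < rN. Proof. by rewrite sqrtr_gt0. Qed.
Let p0 := pi2_gt0 R.
Let Nn0 n : 0 < N%:R ^+ n :> R. Proof. exact: exprn_gt0. Qed.
Let EP : forall k l, kdot (kpow theta k phi) (kpow theta l phi) = (k == l)%:R.
Proof. exact/orthonormal_bracketP. Qed.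
Let enP := shift_orthonormal EP.

Section Dense.
Variable m0 : R -> R[i].
Hypotheses (m0_per : periodic m0) (m0_ref : refinement N sg alpha theta phi m0).
Hypothesis unfocused0 : forall t, \forall x \ae mu, ~ unfocused N tau phi t x.

(** For s = sg^-(n+1) t and xi = N^-(n+1) x, the refinement equation reads sqrt N |phi_{sg s} (N
    xi)| = |m0 (theta_s + xi)| |phi_s (xi)|, where |m0| <= sqrt N. *)
Lemma focus_mono : \forall x \ae mu, forall n t, focus N tau phi n t x <= focus N tau phi n.+1 t x.
Proof.
apply: ae_forall => n; apply: ae_forall => t; pose s := iter n.+1 tau t.
have a0 : 0 < N%:R ^- n.+1 :> R by rewrite invr_gt0.
have h1 := ae_affine 0 a0 m0_ref.
have h2 := ae_affine (theta s) a0 (refinement_normc N_gt0 sgK alpha1 thetaN G1 m0_per m0_ref).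
apply: ae_imp2 h1 h2 => x; rewrite addr0 => /(_ s) /(congr1 (@normc R)).
rewrite !normcM alpha1 mul1r normcC ger0_norm ?(ltW r0)// addrC => e mb.
have e2 : N%:R * (N%:R ^- n.+1 * x) = N%:R ^- n * x :> R.
  by rewrite exprS invfM !mulrA mulfV ?gt_eqF// mul1r.
have e1 : sg s = iter n tau t by rewrite /s iterS tauK.
rewrite /focus ler_pXn2r// ?nnegrE ?normc_ge0//.
rewrite -e2 -e1 -(ler_pM2l r0) e; apply: ler_wpM2r => //; exact: normc_ge0.
Qed.

(** Off the unfocused set some [focus n1 t x] exceeds 1 - 1 / (k + 1), and by monotonicity so do all
    later ones. *)
Lemma deficit_cvg : \forall x \ae mu, forall t, (fun n => deficit N tau phi n t x) @ \oo --> (0 : R).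
Proof.
apply: ae_imp2 focus_mono (ae_forall unfocused0) => x mono unf t.
apply/cvgrPdist_lt => e e0.
have [k hk] : exists k : nat, k.+1%:R^-1 < e.
  have [k hk] := @expn_large R N N_ge2 e^-1 1 ltr01; exists (N ^ k).-1.
  rewrite prednK ?expn_gt0 ?N_gt0// -[e]invrK ltf_pV2 ?posrE ?invr_gt0 ?ltr0n ?expn_gt0 ?N_gt0//.
  by rewrite natrX; have := hk k (leqnn k); rewrite mul1r.
have [n1 hn1] : exists n1, 1 - k.+1%:R^-1 < focus N tau phi n1 t x.
  apply: contrapT => /forallNP no; apply: (unf t); exists k => //; exists 0%N => // n _ /=.
  by rewrite addn0 leNgt; apply/negP; exact: no.
exists n1 => // n /= hn; rewrite sub0r normrN ger0_norm; last by have /andP[] := deficit_itv N tau phi n t x.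
rewrite /deficit gt_max e0/=.
have : focus N tau phi n1 t x <= focus N tau phi n t x.
  by move: hn => /subnK <-; elim: (n - n1)%N => // l IH; rewrite addSn; exact: le_trans IH _.
move=> h; apply: le_lt_trans (lerB (lexx 1) h) _; apply: lt_trans hk.
by rewrite ltrBlDr -ltrBlDl.
Qed.

(** A truncation z within d / 2 of y stands in for y. Its gap tends to 0 by dominated convergence,
    the integrands being bounded by the sum of the |z_t|^2. *)
Lemma span_dense (y : K) (d : R) : 0 < d -> exists n v, V0 v /\ knorm (iter n U y - v) < d.
Proof.
move=> d0; have d2 : 0 < d / 2 by rewrite divr_gt0.
have [m hm] := hcvg_components (fun s => wcut_cvg (y s)) d2; have {}hm := hm m (leqnn m).
pose f s : R -> R[i] := wcut m (y s); pose z : K := fun s => mkL2 (f s).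
have fL s : f s \in cLfun 2%:E by exact: cLfun2_wcut.
have fA s x : m%:R < `|x| -> f s x = 0 by exact: wcut_support.
have [n1 hn1] := energy_gap N_ge2 sgK alpha1 theta_inj G1 fL fA.
pose F n x := (\sum_t normc (f t x) ^+ 2 * deficit N tau phi n t x)%:E.
pose H x := (\sum_t normc (f t x) ^+ 2)%:E.
have mf t : measurable_fun setT (fun x => normc (f t x) ^+ 2).
  by apply: measurable_sqr_normc; have [] := (cLfun2P (f t)).1 (fL t).
have mF n : measurable_fun setT (F n).
  apply/measurable_EFinP; apply: measurable_sum => t.
  by apply: measurable_funM => //; exact: measurable_deficit.
have mH : measurable_fun setT H by apply/measurable_EFinP; exact: measurable_sum.
have H0 x : (0 <= H x)%E by rewrite lee_fin sumr_ge0// => t _; rewrite sqr_ge0.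
have HI : mu.-integrable setT H.
  apply/integrableP; split => //; under eq_integral do rewrite gee0_abs//.
  rewrite /H; under eq_integral do rewrite -sumEFin.
  rewrite ge0_integral_sum//; last 2 first.
  - by move=> t; apply/measurable_EFinP; exact: mf.
  - by move=> t x _; rewrite lee_fin sqr_ge0.
  by apply: lte_sum_pinfty => t _; have [] := (cLfun2P (f t)).1 (fL t).
have FH n x : (0 <= F n x <= H x)%E.
  rewrite !lee_fin; apply/andP; split.
    by apply: sumr_ge0 => t _; rewrite mulr_ge0 ?sqr_ge0//; have /andP[] := deficit_itv N tau phi n t x.
  by apply: ler_sum => t _; rewrite ler_piMr ?sqr_ge0//; have /andP[] := deficit_itv N tau phi n t x.
have Fc : \forall x \ae mu, (fun n => F n x) @ \oo --> 0%E.
  apply: ae_imp deficit_cvg => x hx; apply: cvg_EFin; first exact: nearW.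
  suff S (l : seq I) : (fun n => \sum_(t <- l) normc (f t x) ^+ 2 * deficit N tau phi n t x) @ \oo --> (0 : R).
    exact: (S (index_enum I)).
  elim: l => [|t l IH].
    by under eq_fun do rewrite big_nil; exact: cvg_cst.
  have c1 : (fun n => normc (f t x) ^+ 2 * deficit N tau phi n t x) @ \oo --> (normc (f t x) ^+ 2 * 0 : R).
    by apply: cvgM; [exact: cvg_cst|exact: hx].
  have c2 := cvgD c1 IH; rewrite mulr0 addr0 in c2.
  have -> : (fun n => \sum_(t <- t :: l) normc (f t x) ^+ 2 * deficit N tau phi n t x) =
      (fun n => normc (f t x) ^+ 2 * deficit N tau phi n t x) +
      (fun n => \sum_(t <- l) normc (f t x) ^+ 2 * deficit N tau phi n t x).
    by apply/funext => n; rewrite big_cons.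
  exact: c2.
have e0 : 0 < 2 * pi * (d / 2) ^+ 2 by rewrite mulr_gt0// exprn_gt0.
have [n2 hn2] := dominated_vanish mF HI FH Fc e0.
pose n := maxn n1 n2; exists n.
have gE : gap N tau phi n f = (((2 * pi)^-1)%:E * \int[mu]_x F n x)%E.
  rewrite /gap /F; congr (_ * _)%E; under [in RHS]eq_integral do rewrite -sumEFin.
  rewrite ge0_integral_sum//.
  - by move=> t; apply/measurable_EFinP; apply: measurable_funM; [exact: mf|exact: measurable_deficit].
  - move=> t x _; rewrite lee_fin mulr_ge0 ?sqr_ge0//.
    by have /andP[] := deficit_itv N tau phi n t x.
have gs : (gap N tau phi n f < ((d / 2) ^+ 2)%:E)%E.
  rewrite gE muleC lte_pdivrMr//.
  by rewrite muleC -EFinM; apply: hn2; rewrite leq_maxr.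
have kn (x : K) : knorm (iter n U x) = knorm x.
  exact: (@iter_isometry_norm _ W (kU_norm N_gt0 sgK alpha1)).
have kB (x x' : K) : iter n U (x - x') = iter n U x - iter n U x'.
  exact: (@iter_isometryB _ W (kU_lin sg alpha N_gt0)).
have := energy_approx KP enP (y := iter n U z) d2; case.
  have e := hn1 n (leq_maxl _ _); rewrite kn e lteD2lE//.
  have g0 : (0 <= gap N tau phi n f)%E by exact: gap_ge0.
  rewrite ge0_fin_numE; last by apply: nneseries_ge0 => j _ _; rewrite lee_fin sqr_ge0.
  by apply: le_lt_trans (ltry (knorm z ^+ 2)); rewrite e leeDl.
move=> k hk; pose v := fourier_sum (@kdot R I) (fun j => E j) k (iter n U z).
exists v; split; first exact: shift_span_fourier_sum.
have h3 : knorm (iter n U y - iter n U z) < d / 2 by rewrite -kB kn (inormBC KP).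
apply: le_lt_trans (le_inorm_dist KP _ (iter n U z) _) _.
by rewrite [ltRHS]splitr; apply: ltrD.
Qed.
End Dense.
End Density.

(** * Triviality of the intersection *)

Section PeriodicMass.
Variable R : realType.
Local Notation mu := (@lebesgue_measure R).
Local Notation ind := (@period_indic R 0).

Definition band (L : nat) : set R := `[- (2 * pi * L%:R), 2 * pi * L%:R[%classic.

Lemma measurable_band L : measurable (band L). Proof. exact: measurable_itv. Qed.

(** The band consists of 2 L periods. Since zenum j lies in [-L, L[ exactly when j < 2 L, they are
    the first 2 L terms of the enumeration. *)
Lemma periodic_mass (g : R -> R) (L : nat) : measurable_fun setT g -> (forall x, 0 <= g x) ->
  periodic g ->
  (\int[mu]_x (\1_(band L) x * g x)%:E <= L.*2%:R%:E * \int[mu]_x (ind x * g x)%:E)%E.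
Proof.
move=> mg g0 gper; have p0 := pi2_gt0 R.
have h0 x : (0 <= (\1_(band L) x * g x)%:E)%E by rewrite lee_fin mulr_ge0.
have mh : measurable_fun setT (fun x => (\1_(band L) x * g x)%:E).
  apply/measurable_EFinP; apply: measurable_funM => //.
  exact: measurable_indic (measurable_band L).
have mi : measurable_fun setT (fun x => (ind x * g x)%:E).
  by apply/measurable_EFinP; apply: measurable_funM => //; exact: measurable_period_indic.
have i0 x : (0 <= (ind x * g x)%:E)%E by rewrite lee_fin mulr_ge0// period_indicE.
rewrite (periodization 0 p0 mh h0) -ge0_integralZl//.
rewrite [leLHS]integral_mkcond; apply: ge0_le_integral => //.
- move=> x _; rewrite patchE; case: ifP => // _; apply: nneseries_ge0 => j _ _; exact: h0.
- apply/(measurable_restrict _ (measurable_itv _) measurableT).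
  rewrite setTI; apply: measurable_funTS.
  apply: (@ge0_emeasurable_sum _ _ _ setT _ xpredT) => [j x _ _|j _]; first exact: h0.
  by apply: (measurableT_comp mh); exact: measurable_funD.
- by apply: emeasurable_funM.
move=> x _; rewrite patchE period_indicE mem_setE in_itv/= !add0r; case: ifP => [/andP[x0 x1]|_]; last first.
  by rewrite mul0r mule0.
rewrite mul1r -EFinM; apply: lime_le.
  by apply: is_cvg_nneseries => j _ _; exact: h0.
apply: nearW => n; rewrite big_mkord sumEFin lee_fin.
apply: (@le_trans _ _ (\sum_(j < n) (j < L.*2)%:R * g x)).
  apply: ler_sum => j _; rewrite gper ler_wpM2r// indicE; case: (boolP (_ \in _)) => [|_]; last by rewrite ler0n.
  rewrite inE /band /= in_itv/= => /andP[h1 h2].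
  suff -> : (j < L.*2)%N by [].
  have z1 : (zenum j < L%:Z).
    rewrite -(ltr_int R) -(ltr_pM2l p0).
    by apply: le_lt_trans h2; rewrite lerDr.
  have z2 : (- L%:Z - 1 < zenum j).
    rewrite -(ltr_int R) -(ltr_pM2l p0) rmorphB rmorphN/=.
    by move: h1; rewrite mulrBr mulrN mulr1; lra.
  rewrite -(zenumK j); case: (zenum j) z1 z2 => k /=.
    by move=> z1 _; rewrite ltn_double.
  by rewrite NegzE => _ z2; change (k.+1.*2 <= L.*2)%N; rewrite leq_double; lia.
rewrite -mulr_suml ler_wpM2r// -natr_sum ler_nat.
have -> : (\sum_(i < n) (i < L.*2) = minn n L.*2)%N; last by rewrite geq_minr.
by elim: n => [|n IH]; rewrite ?big_ord0 ?min0n// big_ord_recr/= IH; lia.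
Qed.

Lemma tail_cvg (f : L2 R) (d : R) (N : nat) : (2 <= N)%N -> 0 < d -> forall e : R, 0 < e ->
  exists n1, forall n, (n1 <= n)%N ->
    (sqnorm (cutoff [set x : R | d * N%:R ^+ n <= `|x|]%R f) < e%:E)%E.
Proof.
move=> N2 d0 e e0.
have mA n : measurable [set x : R | d * N%:R ^+ n <= `|x|].
  have := @normr_measurable R setT measurableT _ (measurable_itv `[d * N%:R ^+ n, +oo[).
  by rewrite setTI; congr measurable; apply/seteqP; split => x /=; rewrite in_itv/= andbT.
pose F n x := (normc (cutoff [set x : R | d * N%:R ^+ n <= `|x|] f x) ^+ 2)%:E.
pose H x := (normc (f x) ^+ 2)%:E.
apply: (@dominated_vanish R F H) => //.
- move=> n; apply: measurable_sqnorm; apply: cmeasurable_cutoff => //; exact: L2_cmeasurable.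
- apply/integrableP; split; first exact: measurable_sqnorm (L2_cmeasurable f).
  under eq_integral do rewrite gee0_abs ?lee_fin ?sqr_ge0//.
  exact: L2_sqnorm_lty.
- move=> n x; rewrite !lee_fin sqr_ge0/= ler_pXn2r// ?nnegrE ?normc_ge0//.
  exact: normc_cutoff_le.
apply: aeW => x; have [n1 hn1] := expn_large N2 `|x| d0.
apply: cvg_near_cst; exists n1 => // n /= /hn1 hn.
rewrite /F cutoffE memNset ?normc0 ?expr0n//=.
by apply/negP; rewrite -ltNge.
Qed.
End PeriodicMass.

Section Disjoint.
Variable R : realType.

Lemma L2dot_disjoint (f g : L2 R) :
  (\forall x \ae (@lebesgue_measure R), f x = 0 \/ g x = 0) -> L2dot f g = 0.
Proof.
move=> fg; rewrite -[f]mkL2K -[g]mkL2K L2dot_mkL2; [|exact: L2_fun|exact: L2_fun].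
rewrite (@ae_eq_cint _ _ (fun=> 0)).
- have := cintZ 0 (cintegrable0 R); rewrite mul0r => h.
  by rewrite h mul0r.
- by apply: cmeasurableM; [|apply: cmeasurableJ]; exact: L2_cmeasurable.
- exact: cmeasurable_cst.
- by apply: ae_imp fg => x [] ->; rewrite ?mul0r// conjCE conjc0 mulr0.
Qed.
End Disjoint.

Section Separation.
Variables (R : realType) (I : finType) (N : nat) (sg tau : I -> I) (alpha : I -> R[i]).
Variables (theta : I -> R) (phi : I -> L2 R).
Hypotheses (N_ge2 : (2 <= N)%N) (sgK : cancel sg tau) (tauK : cancel tau sg).
Hypothesis alpha1 : forall s, normc (alpha s) = 1.
Local Notation mu := (@lebesgue_measure R).
Local Notation K := (I -> L2 R).
Local Notation KP := (@kdot_inner R I).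
Local Notation knorm := (inorm (@kdot R I)).
Local Notation U := (@kU R I N sg alpha).
Local Notation rN := (Num.sqrt N%:R : R).
Local Notation G := (bracket theta phi).
Local Notation E j := (kpow theta (- zenum j) phi).
Local Notation W := (fourier_rep N sg theta alpha).
Local Notation V0 := (@hclosure R W (@lin_span R W (fun k => kpow theta k phi))).
Hypothesis G1 : \forall eta \ae mu, G eta = 1%E.

Let N_gt0 : (0 < N)%N. Proof. exact: ltnW. Qed.
Let n0 : 0 < N%:R :> R. Proof. by rewrite ltr0n. Qed.
Let r0 : 0 < rN. Proof. by rewrite sqrtr_gt0. Qed.
Let rr : rN ^+ 2 = N%:R. Proof. by rewrite (@sqr_sqrtr _ N%:R)// ltW. Qed.
Let p0 := pi2_gt0 R.
Let Nn0 n : 0 < N%:R ^+ n :> R. Proof. exact: exprn_gt0. Qed.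
Let EP : forall k l, kdot (kpow theta k phi) (kpow theta l phi) = (k == l)%:R.
Proof. exact/orthonormal_bracketP. Qed.
Let kn n (x : K) : knorm (iter n U x) = knorm x.
Proof. exact: (@iter_isometry_norm _ W (kU_norm N_gt0 sgK alpha1)). Qed.
Let kB n (x x' : K) : iter n U (x - x') = iter n U x - iter n U x'.
Proof. exact: (@iter_isometryB _ W (kU_lin sg alpha N_gt0)). Qed.

Lemma phase_bound (A : R) : exists L : nat, forall t, A + `|theta t| < 2 * pi * L%:R.
Proof.
pose B := `|A| + \sum_t `|theta t|.
exists (Num.trunc B).+1 => t.
have B0 : 0 <= B by rewrite addr_ge0 ?sumr_ge0.
have /andP[_ h] := trunc_itv B0.
apply: (@le_lt_trans _ _ B).
  by rewrite lerD ?ler_norm// (bigD1 t)//= lerDl sumr_ge0.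
apply: lt_le_trans h _; rewrite ler_peMl// mulrC.
have := @pi_ge2 R; lra.
Qed.

(** With v = [synthesis m], the Cauchy-Schwarz inequality separates f times the dilated periodic
    factor m from the dilated tail of phi. On the support of f the argument of m runs over at most 2
    L N^n periods, each of mass 2 pi |y|^2; this N^n cancels against the N^-n of the dilated tail,
    so the constant is independent of n. *)
Lemma coef_bound (y v : K) n s (f : R -> R[i]) (M A d : R) L : V0 v -> y = iter n U v -> 0 < d ->
  f \in cLfun 2%:E -> (forall x, normc (f x) <= M) ->
  (forall x, A < `|x| -> f x = 0) -> (forall x, `|x| < d -> f x = 0) ->
  (forall t, A + `|theta t| < 2 * pi * L%:R) -> 0 <= A ->
  normc (L2dot (mkL2 f) (y s)) ^+ 2 <= (M ^+ 2 * L.*2%:R * (2 * pi * knorm y ^+ 2)) *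
    fine (sqnorm (cutoff [set x : R | d * N%:R ^+ n <= `|x|] (phi (iter n sg s)))).
Proof.
move=> Vv yE d0 fL fM fA fd LA A0; pose t := iter n sg s.
have [m [mm mper mL vE]] := span_synthesis G1 EP Vv.
have [w w1 hw] := iter_kUE sg N_gt0 alpha1 n v s.
have mf : cmeasurable f by have [] := (cLfun2P f).1 fL.
set D := [set x : R | _].
have mD : measurable D.
  have := @normr_measurable R setT measurableT _ (measurable_itv `[d * N%:R ^+ n, +oo[).
  by rewrite setTI; congr measurable; apply/seteqP; split => x /=; rewrite in_itv/= andbT.
have cL : cutoff D (phi t) \in cLfun 2%:E by apply: cLfun2_cutoff => //; exact: L2_fun.
have mc : cmeasurable (cutoff D (phi t)) by have [] := (cLfun2P _).1 cL.
pose p xi := f xi * ((rN ^+ n)%:C * conjc (m (N%:R ^+ n * xi + theta t))).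
pose g xi := w * cutoff D (phi t) (N%:R ^+ n * xi + 0).
have gL : g \in cLfun 2%:E by apply: cLfun2Z; exact: cLfun2_affine.
have mp : cmeasurable p.
  apply: cmeasurableM => //; apply: cmeasurableM; first exact: cmeasurable_cst.
  apply: cmeasurableJ; apply: (cmeasurable_comp mm).
  by apply: measurable_funD => //; exact: measurable_funM.
pose F x := \1_(band (L * N ^ n)) x * normc (m x) ^+ 2 : R.
(* For |xi| <= A the argument N^n xi + theta_t has modulus at most N^n (A + |theta_t|) < 2 pi L N^n,
   so it lies in [band (L * N ^ n)]. *)
have mF : measurable_fun setT (fun x => (F x)%:E).
  apply/measurable_EFinP; apply: measurable_funM; last exact: measurable_sqr_normc.
  by apply: measurable_indic; exact: measurable_band.
have F0 x : (0 <= (F x)%:E)%E by rewrite lee_fin mulr_ge0 ?sqr_ge0.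
have pF xi : normc (p xi) ^+ 2 <= M ^+ 2 * N%:R ^+ n * F (N%:R ^+ n * xi + theta t).
  have [xA|Ax] := lerP `|xi| A; last first.
    rewrite /p fA// mul0r normc0 expr0n/=; have := F0 (N%:R ^+ n * xi + theta t).
    by rewrite lee_fin => h; apply: mulr_ge0 => //; apply: mulr_ge0; [exact: sqr_ge0|exact: ltW].
  rewrite /F indicE mem_set ?mul1r; last first.
    rewrite /band /= in_itv/= natrM natrX.
    have hA : `|N%:R ^+ n * xi| <= N%:R ^+ n * A by rewrite normrM ger0_norm ?(ltW (Nn0 n))// ler_wpM2l// ltW.
    have hN : 1 <= N%:R ^+ n :> R by rewrite -natrX ler1n expn_gt0 N_gt0.
    have : `|N%:R ^+ n * xi + theta t| < 2 * pi * (L%:R * N%:R ^+ n).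
      apply: le_lt_trans (ler_normD _ _) _; apply: le_lt_trans (lerD hA (lexx _)) _.
      apply: (@le_lt_trans _ _ (N%:R ^+ n * (A + `|theta t|))).
        by rewrite mulrDr lerD2l ler_peMl.
      by rewrite mulrA mulrC ltr_pM2r// LA.
    by rewrite ltr_norml => /andP[/ltW -> ->].
  rewrite /p !normcM normcJ' !exprMn normcC ger0_norm ?exprn_ge0 ?(ltW r0)// exprAC rr mulrA.
  rewrite ler_wpM2r ?sqr_ge0// ler_wpM2r ?(ltW (Nn0 n))//.
  by rewrite ler_pXn2r// ?nnegrE ?normc_ge0// (le_trans (normc_ge0 _) (fM xi)).
have M20 : 0 <= M ^+ 2 by exact: sqr_ge0.
have mFa : measurable_fun setT (fun xi : R => (F (N%:R ^+ n * xi + theta t))%:E).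
  apply: (measurableT_comp mF).
  by apply: measurable_funD => //; exact: measurable_funM.
have c0 : (0 <= (M ^+ 2 * N%:R ^+ n)%:E :> \bar R)%E by rewrite lee_fin mulr_ge0// ltW.
have sp : (sqnorm p <= (M ^+ 2 * (L * N ^ n).*2%:R * (2 * pi * knorm y ^+ 2))%:E)%E.
  apply: (@le_trans _ _ (\int[mu]_xi ((M ^+ 2 * N%:R ^+ n)%:E * (F (N%:R ^+ n * xi + theta t)%R)%:E))%E).
    apply: ge0_le_integral => //.
    - by move=> x _; rewrite lee_fin sqr_ge0.
    - exact: measurable_sqnorm.
    - exact: emeasurable_funM.
    - by move=> x _; rewrite -EFinM lee_fin.
  rewrite ge0_integralZl//.
  rewrite (ge0_integral_affine _ (Nn0 n) mF F0) muleA -EFinM mulfK ?gt_eqF//.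
  rewrite -[X in (_ <= X%:E)%E]mulrA [leRHS]EFinM; apply: lee_wpmul2l; first by rewrite lee_fin.
  have := @periodic_mass R (fun x => normc (m x) ^+ 2) (L * N ^ n).
  move=> /(_ (measurable_sqr_normc mm) (fun x => sqr_ge0 _)).
  move=> /(_ (fun x k => congr1 (fun z : R[i] => normc z ^+ 2) (mper x k))) /le_trans; apply.
  rewrite [leRHS]EFinM; apply: lee_wpmul2l; first by rewrite lee_fin.
  rewrite yE kn vE (synthesis_norm G1)// mulrA mulfV ?gt_eqF// mul1r L2norm_mkL2//.
  rewrite le_eqVlt; apply/orP; left; apply/eqP; apply: eq_integral => x _.
  by rewrite normcM normcC exprMn real_normK ?num_real// period_indicE; case: (_ <= _ < _); rewrite ?expr1n// expr0n.
have pL : p \in cLfun 2%:E by apply/cLfun2P; split => //; exact: le_lt_trans sp (ltry _).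
have sg_ : sqnorm g = ((N%:R ^- n)%:E * sqnorm (cutoff D (phi t)))%E.
  have mg' : cmeasurable (fun xi : R => cutoff D (phi t) (N%:R ^+ n * xi + 0)).
    have := cLfun2_affine 0 (Nn0 n) cL; by move/cLfun2P => [].
  by rewrite /g sqnormZ// w1 expr1n mul1e sqnorm_affine.
have e : L2dot (mkL2 f) (y s) = L2dot (mkL2 p) (mkL2 g).
  rewrite -[y s]mkL2K !L2dot_mkL2//; last exact: L2_fun.
  apply: ae_eq_cint.
  - by apply: cmeasurableM => //; apply: cmeasurableJ; exact: L2_cmeasurable.
  - by apply: cmeasurableM => //; apply: cmeasurableJ; have [] := (cLfun2P g).1 gL.
  have h2 := ae_affine 0 (Nn0 n) (synthesisE G1 t mm mper mL).
  rewrite yE; apply: ae_imp2 hw h2 => xi ->; rewrite vE addr0 => ->.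
  rewrite /p /g addr0 cutoffE; case: ifPn => [_|/negP xD].
    by rewrite !conjCE !conjcM conjc_real [theta t + _]addrC; ring.
  rewrite fd ?mul0r// ltNge; apply/negP => dx; apply: xD; rewrite inE /D /=.
  by rewrite normrM ger0_norm ?(ltW (Nn0 n))// mulrC ler_wpM2l// ltW.
have := cauchy_schwarz (L2dot_inner R) (mkL2 p) (mkL2 g); rewrite -e.
have hg := L2norm_mkL2 gL; have hp := L2norm_mkL2 pL.
have P0 := inorm_ge0 (@L2dot R) (mkL2 p); have Q0 := inorm_ge0 (@L2dot R) (mkL2 g).
move: (L2norm (mkL2 p)) (L2norm (mkL2 g)) (normc_ge0 (L2dot (mkL2 f) (y s))) hg hp P0 Q0 => P Q.
move: (normc _) => X X0 hg hp P0 Q0 XPQ.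
have hQ : Q ^+ 2 = N%:R ^- n * fine (sqnorm (cutoff D (phi t))).
  apply: EFin_inj; rewrite hg sg_ EFinM fineK//.
  by rewrite ge0_fin_numE ?sqnorm_ge0//; have [] := (cLfun2P _).1 cL.
move: sp; rewrite -hp lee_fin => hP.
apply: (@le_trans _ _ (P ^+ 2 * Q ^+ 2)).
  by rewrite -exprMn ler_pXn2r// ?nnegrE ?mulr_ge0.
have T0 : 0 <= fine (sqnorm (cutoff D (phi t))) by rewrite fine_ge0 ?sqnorm_ge0.
have hE : M ^+ 2 * (L * N ^ n).*2%:R * (2 * pi * knorm y ^+ 2) =
    M ^+ 2 * L.*2%:R * (2 * pi * knorm y ^+ 2) * N%:R ^+ n.
  by rewrite doubleMl natrM natrX; ring.
rewrite hE in hP; rewrite hQ.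
have NT0 : 0 <= N%:R ^- n * fine (sqnorm (cutoff D (phi t))) by rewrite mulr_ge0// invr_ge0 ltW.
apply: le_trans (ler_wpM2r NT0 hP) _.
by rewrite -[leLHS]mulrA mulVKf ?gt_eqF.
Qed.

(** The constant of [coef_bound] is the same for all n, while the tails of the finitely many
    components of phi tend to 0. *)
Lemma coef_vanish (y : K) s (f : R -> R[i]) (M A d : R) :
  (forall n, exists2 v, V0 v & y = iter n U v) -> 0 < d ->
  f \in cLfun 2%:E -> (forall x, normc (f x) <= M) ->
  (forall x, A < `|x| -> f x = 0) -> (forall x, `|x| < d -> f x = 0) -> 0 <= A ->
  L2dot (mkL2 f) (y s) = 0.
Proof.
move=> hy d0 fL fM fA fd A0; have [L LA] := phase_bound A.
pose C := M ^+ 2 * L.*2%:R * (2 * pi * knorm y ^+ 2).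
have C0 : 0 <= C.
  apply: mulr_ge0; first by apply: mulr_ge0; [exact: sqr_ge0|exact: ler0n].
  by apply: mulr_ge0; [exact: ltW|exact: sqr_ge0].
suff h : normc (L2dot (mkL2 f) (y s)) ^+ 2 <= 0.
  apply/eqP; rewrite -(normr_eq0 (L2dot _ _)) normrcE fmorph_eq0.
  by rewrite -sqrf_eq0 eq_le h sqr_ge0.
apply/ler_addgt0Pr => e e0; rewrite add0r.
have e1 : 0 < e / (C + 1) by rewrite divr_gt0// ltr_wpDl.
have /choice[n1 hn1] : forall t, exists n1, forall n, (n1 <= n)%N ->
    (sqnorm (cutoff [set x : R | d * N%:R ^+ n <= `|x|]%R (phi t)) < (e / (C + 1))%:E)%E.
  by move=> t; exact: tail_cvg.
pose n := (\max_t n1 t)%N; have [v Vv yE] := hy n.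
apply: le_trans (coef_bound s Vv yE d0 fL fM fA fd LA A0) _; rewrite -/C.
set S := sqnorm _.
have Se : (S < (e / (C + 1))%:E)%E by apply: hn1; rewrite /n leq_bigmax.
have Sf : fine S <= e / (C + 1).
  rewrite -lee_fin fineK ?ltW//.
  by rewrite ge0_fin_numE ?sqnorm_ge0// (lt_trans Se) ?ltry.
apply: le_trans (ler_wpM2l C0 Sf) _.
rewrite mulrCA ler_piMr ?(ltW e0)// ler_pdivrMr ?mul1r ?lerDl//.
by rewrite ltr_wpDl.
Qed.

(** The test functions are the truncations of y_s itself to the sets [A k], which exhaust the line
    except 0. They are orthogonal to y_s and converge to it, so y_s is orthogonal to itself. *)
Lemma span_separated (y : K) : (forall n, exists2 v, V0 v & y = iter n U v) -> y = 0.
Proof.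
move=> hy; apply/funext => s; apply: (inner_eq0 (L2dot_inner R)).
pose A k : set R := [set x | k.+1%:R^-1 <= `|x|] `&` [set x | `|x| <= k.+1%:R] `&`
  [set x | normc (y s x) <= k.+1%:R].
have mA k : measurable (A k).
  apply: measurableI; first apply: measurableI.
  - have := @normr_measurable R setT measurableT _ (measurable_itv `[k.+1%:R^-1, +oo[).
    by rewrite setTI; congr measurable; apply/seteqP; split => x /=; rewrite in_itv/= andbT.
  - have := @normr_measurable R setT measurableT _ (measurable_itv `]-oo, k.+1%:R]).
    by rewrite setTI; congr measurable; apply/seteqP; split => x /=; rewrite in_itv.
  - have := @measurable_normc _ _ R _ (L2_cmeasurable (y s)) measurableT _ (measurable_itv `]-oo, k.+1%:R]).
    by rewrite setTI; congr measurable; apply/seteqP; split => x /=; rewrite in_itv.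
have cvg := @cutoff_cvg R A (y s) mA.
suff -> : L2dot (y s) (y s) = 0 by [].
apply: (hcvg_dot (L2dot_inner R) (cvg _)).
  have h0 : \forall x \ae mu, x <> 0 :> R.
    by exists [set 0]; split => [//||x /= /contrapT ->//]; rewrite lebesgue_measure_set1.
  apply: ae_imp h0 => x /eqP x0.
  pose b := `|x|^-1 + `|x| + normc (y s x).
  have b0 : 0 <= b by rewrite /b !addr_ge0 ?invr_ge0 ?normc_ge0.
  exists (Num.trunc b).+1 => n hn.
  have bn : b <= n.+1%:R.
    have /andP[_ /ltW h] := trunc_itv b0; apply: le_trans h _; rewrite ler_nat.
    by apply: leq_trans hn _.
  have x1 : 0 < `|x| by rewrite normr_gt0.
  have i1 : 0 <= `|x|^-1 by rewrite invr_ge0.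
  have n2 := normc_ge0 (y s x).
  split; first split => /=.
  - rewrite -[leRHS]invrK lef_pV2 ?posrE ?invr_gt0//; apply: le_trans bn.
    by rewrite /b -addrA lerDl addr_ge0.
  - by apply: le_trans bn; rewrite /b addrAC lerDr addr_ge0.
  - by apply: le_trans bn; rewrite /b lerDr addr_ge0.
exists 0%N => k _.
apply: (@coef_vanish y s _ k.+1%:R k.+1%:R k.+1%:R^-1) => //.
- by apply: cLfun2_cutoff => //; exact: L2_fun.
- by move=> x; rewrite cutoffE; case: ifPn => [|_]; rewrite ?normc0// inE => -[].
- by move=> x xk; rewrite cutoffE memNset// => -[[_ /=]]; rewrite leNgt xk.
- by move=> x xk; rewrite cutoffE memNset// => -[[/= + _ _]]; rewrite leNgt xk.
Qed.

Lemma nonvanishing_of_dense s (q : nat) (A : set R) : (forall v, V0 v -> V0 (U v)) ->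
  (forall (y : K) (d : R), 0 < d -> exists n v, V0 v /\ knorm (iter n U y - v) < d) ->
  (0 < q)%N -> iter q sg s = s -> measurable A -> (0 < mu A)%E ->
  (fun x => (N ^ q)%:R * x) @` A = A -> ~ \forall x \ae mu, A x -> phi s x = 0.
Proof.
move=> VU dense q0 qs mA A0 AE phi0.
have VUn (l : nat) (v : K) : V0 v -> V0 (iter l U v).
  by move=> Vv; elim: l => [|l IH]; [exact: Vv|exact: (VU _ IH)].
(* An invariant set of positive measure has infinite measure, so its indicator is cut along the
   periods; one of the pieces is not negligible. The factor [expi 0] = 1 gives the form of
   [cLfun2_period_expi]. *)
pose h (k : int) : R -> R[i] := cutoff A (fun x => (period_indic (2 * pi * k%:~R) x)%:C * expi 0).
have hL k : h k \in cLfun 2%:E.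
  by apply: cLfun2_cutoff => //; apply: cLfun2_period_expi; exact: measurable_cst.
have mh k : cmeasurable (h k) by have [] := (cLfun2P _).1 (hL k).
have [k hk] : exists k, sqnorm (h k) != 0%E.
  apply: contrapT => /forallNP no.
  have : \forall x \ae mu, ~ A x.
    have h0 k : \forall x \ae mu, h k x = 0.
      by apply: sqnorm_eq0 => //; apply/eqP; have /negP := no k; rewrite negbK.
    apply: ae_imp (ae_forall h0) => x hx Ax; have [k kx] := int_translate x.
    have := hx (- k); rewrite /h cutoffE mem_set// expi0 mulr1 period_indicE.
    have -> : 2 * pi * (- k)%:~R <= x < 2 * pi * (- k)%:~R + 2 * pi.
      by move: kx; rewrite rmorphN/= => /andP[]; lra.
    by move=> /eqP; rewrite fmorph_eq0 oner_eq0.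
  move=> [B [mB B0 AB]]; have : (mu A <= mu B)%E.
    by apply: le_measure; rewrite ?inE// => x Ax; apply: AB => /=; exact.
  by rewrite B0 leNgt A0.
pose x0 : K := fun t => if t == s then mkL2 (h k) else 0.
have x0_gt0 : 0 < knorm x0.
  rewrite lt_neqAle inorm_ge0 andbT eq_sym; apply/eqP => x00.
  have := sqr_component_le x0 s; rewrite x00 expr0n mulr0 /x0 eqxx => h0.
  by move: hk; rewrite -L2norm_mkL2// eqe => /eqP; apply; apply/eqP; rewrite eq_le h0 sqr_ge0.
have [n1 [v1 [Vv1 d1]]] := dense x0 _ x0_gt0.
(* Density gives some exponent n1. As V0 is stable under U it may be raised to a multiple of q, for
   which U^n maps the component s to itself and the dilation preserves A. *)
pose n := (q * n1)%N; have n1n : (n1 <= n)%N by rewrite leq_pmull.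
have [v Vv dv] : exists2 v, V0 v & knorm (iter n U x0 - v) < knorm x0.
  exists (iter (n - n1) U v1); first exact: VUn.
  have -> : iter n U x0 = iter (n - n1) U (iter n1 U x0) by rewrite -iterD subnK.
  by rewrite -kB kn.
have ns : iter n sg s = s.
  by rewrite /n mulnC; elim: (n1) => // l IH; rewrite mulSn iterD IH qs.
have Aq x : A (N%:R ^+ q * x) -> A x.
  move=> Ax; have : ((fun x => (N ^ q)%:R * x) @` A) (N%:R ^+ q * x) by rewrite AE.
  by move=> [x' Ax']; rewrite natrX => /mulfI <-//; rewrite gt_eqF.
have An x : A (N%:R ^+ n * x) -> A x.
  rewrite /n; elim: (n1) => [|l IH]; first by rewrite muln0 expr0 mul1r.
  by rewrite mulnS exprD -mulrA => /Aq/IH.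
have orth j : kdot (iter n U x0) (E j) = 0.
  rewrite /kdot big1 ?mulr0// => t _; apply: L2dot_disjoint.
  have [w _ hw] := iter_kUE sg N_gt0 alpha1 n x0 t.
  have [ts|ts] := eqVneq (iter n sg t) s.
    have {}ts : t = s.
      have inj : injective (iter n sg) by elim: (n) => // l IH a b /(can_inj sgK)/IH.
      by apply: inj; rewrite ts ns.
    subst t; move: hw; rewrite ns /x0 eqxx => hw.
    have h2 := ae_affine 0 (Nn0 n) (mkL2E (hL k)).
    apply: ae_imp3 (kpowE theta (- zenum j) phi s) phi0 _; last first.
      by apply: ae_imp2 hw h2 => x e1 e2; exact: (conj e1 e2).
    move=> x -> px [-> ]; rewrite addr0 => ->; rewrite /h cutoffE.
    case: ifPn => [|_]; last by left; rewrite !mulr0.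
    by rewrite inE => /An/px ->; right; rewrite mulr0.
  move: hw; rewrite /x0 (negbTE ts) => hw.
  apply: ae_imp2 hw (ae_affine 0 (Nn0 n) (L20E R)) => x ->; rewrite addr0 => ->.
  by left; rewrite !mulr0.
have hv := (@shift_spanP R I N sg alpha theta phi EP v).1 Vv.
have ov : kdot v (iter n U x0) = 0.
  apply: (hcvg_dot KP hv); exists 0%N => l _.
  rewrite /fourier_sum (idot_suml KP) big1// => j _.
  rewrite (idotZl KP) [X in _ * X](_ : _ = 0) ?mulr0//.
  by rewrite (inner_herm KP) orth conjc0.
have := pythagoras KP (x := iter n U x0) (y := - v).
rewrite (idotNr KP) (inner_herm KP) ov conjc0 oppr0 => /(_ erefl) e.
have : knorm (iter n U x0 - v) ^+ 2 < knorm x0 ^+ 2.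
  by rewrite ltr_pXn2r// ?nnegrE ?inorm_ge0.
by rewrite e kn ltNge lerDl sqr_ge0.
Qed.
End Separation.

(** * The theorem *)

Section FourierSideTheorem.
Variables (R : realType) (I : finType) (N : nat) (sg tau : I -> I) (alpha : I -> R[i]).
Variables (theta : I -> R) (q : I -> nat) (phi : I -> L2 R).
Hypotheses (N_ge2 : (2 <= N)%N) (sgK : cancel sg tau) (tauK : cancel tau sg).
Hypothesis alpha1 : forall s, normc (alpha s) = 1.
Hypothesis thetaN : forall s, expi (N%:R * theta s) = expi (theta (sg s)).
Hypothesis theta_inj : injective (fun s => expi (theta s)).
Hypotheses (q_gt0 : forall s, (0 < q s)%N) (q_period : forall s, iter (q s) sg s = s).
Local Notation mu := (@lebesgue_measure R).
Local Notation U := (@kU R I N sg alpha).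
Local Notation W := (fourier_rep N sg theta alpha).
Local Notation V0 := (@hclosure R W (@lin_span R W (fun k => kpow theta k phi))).

Let N_gt0 : (0 < N)%N. Proof. exact: ltnW. Qed.

(** Essential boundedness of the filter is left to [refinement_normc], so m is described here by
    measurability and periodicity. *)
Lemma fourier_side_scaling_vector : @orthogonal_scaling_vector R W phi <->
  [/\ \forall eta \ae mu, bracket theta phi eta = 1%E,
      exists m, [/\ cmeasurable m, periodic m & refinement N sg alpha theta phi m] &
      forall s (A : set R), measurable A -> (0 < mu A)%E ->
        (fun x => (N ^ q s)%:R * x) @` A = A -> ~ \forall x \ae mu, A x -> phi s x = 0].
Proof.
have eE : (fun k => iterz (@wT R W) k phi) = (fun k => kpow theta k phi).
  by apply/funext => k; exact: iterz_kpow.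
have kE k : iterz (@wT R W) k phi = kpow theta k phi by exact: iterz_kpow.
rewrite (@orthogonal_scaling_vectorP _ W (@kdot_inner R I) (kU_lin sg alpha N_gt0)
  (kU_surj N_gt0 sgK alpha1) (kU_norm N_gt0 sgK alpha1)) eE.
have V0phi : V0 phi.
  apply: (@hclosure_sub _ W (@kdot_inner R I)); exists [:: (1, 0)].
  by rewrite big_seq1 scale1r kpow0.
split=> [[EP' VU dense _]|[G1 [m [mm mper ref]] nv]].
  have EP k l : kdot (kpow theta k phi) (kpow theta l phi) = (k == l)%:R.
    by rewrite -!kE; exact: EP'.
  have G1 := (orthonormal_bracketP theta phi).1 EP; split => //.
    have [m [mm mper mL e]] := span_synthesis G1 EP (VU _ V0phi).
    by exists m; split => //; apply/(refinement_kU sg alpha N_gt0 G1 mm mper mL).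
  move=> s A; apply: (nonvanishing_of_dense N_ge2 sgK alpha1 G1 VU dense) => //.
have EP := (orthonormal_bracketP theta phi).2 G1.
have VU v : V0 v -> V0 (U v).
  move=> Vv; have [m' [mm' mper' mL' ->]] := span_synthesis G1 EP Vv.
  have [m'' [mm'' mper'' mL'' ->]] := kU_synthesis N_gt0 thetaN G1 mm' mper' mL' mm mper ref.
  exact: synthesis_span.
have Vphi n : V0 (iter n U phi).
  by elim: n => [|n IH]; [exact: V0phi|exact: (VU _ IH)].
split.
- by move=> k l; rewrite !kE; exact: EP.
- exact: VU.
- move=> y d d0; apply: (span_dense N_ge2 sgK tauK alpha1 thetaN theta_inj G1 mper ref) => //.
  exact: (unfocused_null N_ge2 sgK alpha1 theta_inj G1 q_period nv Vphi).
- exact: (span_separated N_ge2 sgK alpha1 G1).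
Qed.
End FourierSideTheorem.

Section CircleFunctions.
Variable R : realType.
Local Notation mu := (@lebesgue_measure R).

Lemma Linfty_circle_cmeasurable (h : R[i] -> R[i]) : Linfty_circle h -> cmeasurable (pullback h).
Proof.
rewrite /Linfty_circle inE => /andP[]; rewrite !inE => /andP[+ _] /andP[+ _].
by rewrite !inE /= => hr hi; split.
Qed.

Lemma Linfty_circle_bounded (h : R[i] -> R[i]) (M : R) : cmeasurable (pullback h) ->
  (\forall t \ae mu, normc (pullback h t) <= M) -> Linfty_circle h.
Proof.
move=> [mr mi] hM.
have bnd (f : R -> R) : measurable_fun setT f -> (\forall t \ae mu, `|f t| <= M) -> f \in Lfun mu +oo%E.
  move=> mf fM; rewrite inE; apply/andP; split; first by rewrite inE.
  rewrite inE /= /finite_norm unlock /Lnorm; case: ifP => // _.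
  apply: (@le_lt_trans _ _ M%:E); last exact: ltry.
  by apply/ess_supP; apply: ae_imp fM => t; rewrite /= lee_fin.
rewrite /Linfty_circle inE; apply/andP; split; apply: bnd => //.
- by apply: ae_imp hM => t; apply: le_trans; exact: ler_normr_Re.
- by apply: ae_imp hM => t; apply: le_trans; exact: ler_normr_Im.
Qed.

Lemma periodic_pullback (h : R[i] -> R[i]) : periodic (pullback h).
Proof.
move=> x k; rewrite /pullback opprD expiD -mulrN -rmorphN/=.
by rewrite (_ : 2 * pi * _ = 2 * (- k)%:~R * pi) ?expi_2piz ?mulr1//; ring.
Qed.

(** A point e^{ia} of the circle determines a up to a multiple of 2 pi, which m ignores; the sign
    reflects the convention z = e^{-i theta}. Off the circle the default value 0 of [xget] is taken
    for a. *)
Lemma circle_extension (m : R -> R[i]) : periodic m -> exists h, pullback h = m.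
Proof.
move=> mper; exists (fun z => m (- xget 0 [set a : R | expi a = z])).
apply/funext => t; rewrite /pullback.
case: xgetP => [a -> /= at_|/(_ (- t))/(_ erefl)//].
have [k ->] := expi_eq at_.
by rewrite opprD opprK -[in RHS](mper t (- k)); congr m; rewrite rmorphN/=; ring.
Qed.
End CircleFunctions.

(** * From families of cycles to the Fourier side *)

Section Cycles.
Variables (R : realType) (N : nat).

Lemma iter_ordS (p : nat) (j : 'I_p) k : nat_of_ord (iter k (@ordS p) j) = ((j + k) %% p)%N.
Proof.
elim: k => [|k IH]; first by rewrite addn0 modn_small.
by rewrite iterS /= IH -addn1 modnDml addn1 addnS.
Qed.

Lemma iter_ordS_id (p : nat) (j : 'I_p) : iter p (@ordS p) j = j.
Proof. by apply/val_inj; rewrite /= iter_ordS modnDr modn_small. Qed.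

Lemma iter_ordS_transitive (p : nat) (j k : 'I_p) : exists l, iter l (@ordS p) j = k.
Proof.
exists (k + (p - j))%N; apply/val_inj; rewrite /= iter_ordS.
rewrite addnCA subnKC ?(ltnW (ltn_ord j))// modnDr modn_small//.
Qed.

(** A cycle is the orbit of any of its points under z -> z^N, so two cycles with a common point
    coincide. *)
Lemma cycle_range_sub (p p' : nat) (z : 'I_p -> R[i]) (z' : 'I_p' -> R[i]) k k' :
  is_cycle N z -> is_cycle N z' -> z k = z' k' -> range z `<=` range z'.
Proof.
move=> [_ _ _ zN] [_ _ _ zN'] e _ [j _ <-].
have [l <-] := iter_ordS_transitive k j.
exists (iter l (@ordS p') k') => //; elim: l => [|l IH] //.
by rewrite !iterS -zN -zN' IH.
Qed.
End Cycles.

Section CycleRepresentation.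
Variables (R : realType) (N n : nat) (p : 'I_n -> nat).
Variables (theta : forall i : 'I_n, 'I_(p i) -> R) (alpha : forall i : 'I_n, 'I_(p i) -> R[i]).
Hypothesis N_ge2 : (2 <= N)%N.
Hypothesis cycles : forall i, is_cycle N (fun k => expi (- theta (i := i) k)).
Hypothesis distinct : injective (fun i => range (fun k => expi (- theta (i := i) k))).
Hypothesis alpha1 : forall i k, `|alpha (i := i) k| = 1.
Local Notation S := {i : 'I_n & 'I_(p i)}.
Local Notation W1 := (dsum_rep (fun i => cycle_rep N (fun k => expi (- theta (i := i) k)) (alpha (i := i)))).

Definition next (s : S) : S := Tagged (fun i => 'I_(p i)) (ordS (tagged s)).
Definition prev (s : S) : S := Tagged (fun i => 'I_(p i)) (ord_pred (tagged s)).
Definition angle (s : S) : R := theta (tagged s).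
Definition weight (s : S) : R[i] := alpha (tagged s).
Local Notation W2 := (fourier_rep N next angle weight).

Let N_gt0 : (0 < N)%N. Proof. exact: ltnW. Qed.

Lemma nextK : cancel next prev.
Proof. by case=> i k; rewrite /next /prev /= ordSK. Qed.

Lemma prevK : cancel prev next.
Proof. by case=> i k; rewrite /next /prev /= ord_predK. Qed.

Lemma iter_next s : iter (p (tag s)) next s = s.
Proof.
case: s => i k /=; pose t := Tagged (fun i => 'I_(p i)).
suff h l : iter l next (t i k) = t i (iter l (@ordS _) k) by rewrite [LHS]h iter_ordS_id.
by elim: l => // l IH; rewrite !iterS IH.
Qed.

Lemma weight1 s : normc (weight s) = 1.
Proof. by have := alpha1 (tagged s); rewrite normrcE => -[]. Qed.

Lemma angleN s : expi (N%:R * angle s) = expi (angle (next s)).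
Proof.
have [_ _ _ /(_ (tagged s))] := cycles (tag s).
by rewrite expiX mulrN !expiNV => /invr_inj.
Qed.

(** Distinct cycles are disjoint, so all the points of all the cycles differ; this keeps the
    components apart near 0. *)
Lemma angle_inj : injective (fun s => expi (angle s)).
Proof.
move=> [i k] [i' k']; rewrite /angle /= => e.
have e1 : expi (- theta k) = expi (- theta k') by rewrite !expiNV e.
have ii : i = i'.
  apply: distinct; apply/seteqP; split.
    exact: (cycle_range_sub (cycles i) (cycles i') e1).
  exact: (cycle_range_sub (cycles i') (cycles i) (esym e1)).
subst i'; have [_ inj _ _] := cycles i.
by rewrite (inj _ _ e1).
Qed.

Definition spectral (x : wspace W1) : S -> L2 R := fun s => fourier (x (tag s) (tagged s)).

Lemma spectral_lin a (x y : wspace W1) : spectral (a *: x + y) = a *: spectral x + spectral y.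
Proof. by apply/funext => s; exact: fourier_lin. Qed.

Lemma spectral_surj y : exists x, spectral x = y.
Proof.
have /choice[x hx] := fun s => fourier_surj (y s).
exists (fun i k => x (Tagged (fun i => 'I_(p i)) k)); apply/funext => -[i k].
exact: (hx (Tagged (fun i => 'I_(p i)) k)).
Qed.

Lemma spectral_dot x y : kdot (spectral x) (spectral y) = wdot x y.
Proof.
rewrite /kdot /= (sig_big_dep xpredT (fun=> xpredT) (fun i k => L2dot (x i k) (y i k))).
rewrite mulr_sumr; apply: eq_bigr => s _.
by rewrite fourier_dot mulrA -rmorphM mulVf ?mul1r// gt_eqF ?pi2_gt0.
Qed.

(** The axioms are pulled back from [kdot] along the isometry [spectral]; definiteness uses the
    injectivity of the Fourier transform. *)
Lemma spectral_inner : inner_product (@wdot R W1).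
Proof.
split=> [a x y z|x y|x|x].
- by rewrite -!spectral_dot spectral_lin (inner_lin (@kdot_inner R S)).
- rewrite -(spectral_dot x y) -(spectral_dot y x); exact: (inner_herm (@kdot_inner R S)).
- by rewrite -spectral_dot; exact: (inner_ge0 (@kdot_inner R S)).
- rewrite -spectral_dot => /(inner_eq0 (@kdot_inner R S)) x0.
  apply: functional_extensionality_dep => i; apply/funext => k.
  apply: (@fourier_inj R); rewrite fourier0.
  exact: (congr1 (@^~ (Tagged (fun i => 'I_(p i)) k)) x0).
Qed.

Lemma spectral_U x : spectral (wU x) = kU N next weight (spectral x).
Proof. by apply/funext => s; rewrite /spectral /kU /= fourierZ fourier_dilation. Qed.

Lemma spectral_T x : spectral (wT x) = kpow angle 1 (spectral x).
Proof.
apply/funext => s; apply/L2_eqP.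
pose h (w : R[i]) := expi (- angle s) * w.
have hE t : pullback h t = expi (- (angle s + t)) by rewrite /pullback /h opprD expiD.
have mh : cmeasurable (pullback h).
  rewrite (_ : pullback h = fun t => expi (- (angle s + t))); last by apply/funext.
  by apply: cmeasurable_expi; apply: measurableT_comp => //; exact: measurable_funD.
have h1 t : normc (pullback h t) <= 1 by rewrite hE normc_expi.
apply: ae_imp2 (fourier_multiplierE (x (tag s) (tagged s)) mh h1) (kpowE angle 1 (spectral x) s) => xi.
by move=> e1 ->; rewrite mul1r -hE; exact: e1.
Qed.

Lemma cycle_scaling_vector (phi : wspace W1) :
  @orthogonal_scaling_vector R W1 phi <-> @orthogonal_scaling_vector R W2 (spectral phi).
Proof.
apply: (transport_scaling_vectorE (W1 := W1) (W2 := W2) (F := spectral)).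
- exact: spectral_inner.
- exact: kdot_inner.
- exact: spectral_lin.
- exact: spectral_surj.
- exact: spectral_dot.
- exact: spectral_U.
- exact: spectral_T.
- exact: (@kpow_inj _ _ angle 1).
- by move=> y; exists (kpow angle (- 1) y); rewrite /wT /= kpowD subrr kpow0.
Qed.
End CycleRepresentation.

Theorem corollary3p7 (R : realType) (N n : nat) (p : 'I_n -> nat)
    (theta : forall i : 'I_n, 'I_(p i) -> R)
    (alpha : forall i : 'I_n, 'I_(p i) -> R[i])
    (phi : forall i : 'I_n, 'I_(p i) -> L2 R)
    (N_ge2 : (2 <= N)%N)
    (cycles : forall i, is_cycle N (fun k => expi (- theta i k)))
    (distinct : injective (fun i => range (fun k => expi (- theta i k))))
    (alpha1 : forall i k, `|alpha i k| = 1) :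
  orthogonal_scaling_vector
    (W := dsum_rep (fun i =>
            cycle_rep N (fun k => expi (- theta i k)) (alpha i)))
    phi
  <->
  [/\ \forall xi \ae (@lebesgue_measure R),
        (\sum_(i < n) \sum_(k < p i)
           Per (fun t => normc (fourier (phi i k) t) ^+ 2)%R (xi - theta i k)%R)%E
        = 1%E,
      exists2 m0 : R[i] -> R[i], Linfty_circle m0 &
        \forall xi \ae (@lebesgue_measure R), forall (i : 'I_n) (j : 'I_(p i)),
          alpha i j * (Num.sqrt N%:R)%:C * fourier (phi i (ordS j)) (N%:R * xi)
          = pullback m0 (theta i j + xi) * fourier (phi i j) xi
    & forall (i : 'I_n) (j : 'I_(p i)) (E : set R),
        measurable E -> (0 < @lebesgue_measure R E)%E ->
        (fun x => (N ^ p i)%:R * x) @` E = E ->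
        ~ \forall xi \ae (@lebesgue_measure R),
            E xi -> fourier (phi i j) xi = 0].
Proof.
pose S := {i : 'I_n & 'I_(p i)}.
have wt1 := weight1 alpha1; have angN := angleN cycles; have angI := angle_inj cycles distinct.
have N_gt0 : (0 < N)%N by exact: ltnW.
have q0 (s : S) : (0 < p (tag s))%N by have [] := cycles (tag s).
apply: iff_trans (@cycle_scaling_vector R N n p theta alpha N_ge2 phi) _.
rewrite (fourier_side_scaling_vector _ N_ge2 (@nextK n p) (@prevK n p) wt1 angN angI q0 (@iter_next n p)).
set Phi : S -> L2 R := spectral phi.
have br xi : bracket (angle theta) Phi xi =
    (\sum_(i < n) \sum_(k < p i) Per (fun t => normc (fourier (phi i k) t) ^+ 2)%R (xi - theta i k)%R)%E.
  by rewrite (sig_big_dep xpredT (fun=> xpredT)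
    (fun i k => Per (fun t => normc (fourier (phi i k) t) ^+ 2) (xi - theta i k))).
split=> [[G1 [m [mm mper ref]] nv]|[G1 [m0 m0L ref] nv]]; split.
- by apply: ae_imp G1 => xi; rewrite br.
- have [h hm] := circle_extension mper; exists h.
    (* The filter is essentially bounded by sqrt N, a consequence of (i) and of the refinement
       equation. *)
    apply: (@Linfty_circle_bounded _ _ (Num.sqrt N%:R)); rewrite hm//.
    exact: (refinement_normc N_gt0 (@nextK n p) wt1 angN G1 mper ref).
  by apply: ae_imp ref => xi hx i j; rewrite hm; exact: (hx (Tagged (fun i => 'I_(p i)) j)).
- by move=> i j; exact: (nv (Tagged (fun i => 'I_(p i)) j)).
- by apply: ae_imp G1 => xi; rewrite br.
- exists (pullback m0); split; first exact: Linfty_circle_cmeasurable.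
    exact: periodic_pullback.
  by apply: ae_imp ref => xi hx [i j]; exact: hx.
- by move=> [i j]; exact: nv.
Qed.
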